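(* Let $r\in\mathbb{N}$. For every hereditary graph class $\mathcal{G}$ that has property $P_r(\phi, \gamma, \alpha)$ for some $\alpha \in (0,1)$ and $\phi, \gamma\in \mathbb{R}_{\geq 0}$, there is an algorithm that solves $K_r$-Cover on $\mathcal{G}$ in time \[ 2^{O_{r,\phi}\left(k^{\varepsilon} \log k\right )} \cdot n^{O_r(1)}\qquad \text{with}\quad \varepsilon = \frac{\gamma + \alpha(\phi+2)}{\gamma + \alpha(\phi+1)+1}<1. \]
   Context: In the $K_r$-Cover problem, given a graph $G$ and an integer $k$, one has to decide whether there is a set of at most $k$ vertices of $G$ whose deletion yields a graph with no clique on $r$ vertices. A graph class is hereditary if it is closed under taking induced subgraphs. For $\phi,\gamma\in\mathbb{R}_{\ge 0}$ and $\alpha\in(0,1)$, a graph class $\mathcal{G}$ has property $P_r(\phi,\gamma,\alpha)$ if there are functions $f(x)\in O(x^\phi)$ and $g(x)\in O(x^\gamma)$ such that for every $G\in\mathcal{G}$ with $n$ vertices and clique number less than $\omega$: (P1) $G$ has at most $f(\omega)\cdot n$ cliques of order less than $r$; and (P2) the treewidth of $G$ is at most $g(\omega)n^\alpha$. $n$ is the number of vertices of the input graph; subscripted $O$ hides constants depending on the listed parameters. *)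

(* Defs.v *)
From mathcomp Require Import all_boot all_order all_algebra.
From mathcomp Require Import all_classical all_reals all_analysis.
Import Order.TTheory GRing.Theory Num.Theory.
Import numFieldNormedType.Exports.

Set Implicit Arguments.
Unset Strict Implicit.
Unset Printing Implicit Defensive.

Local Open Scope ring_scope.

(* Finite simple graphs are labelled by 'I_n, so that they can serve as inputs
   of an algorithm. *)
Record sgraph := SGraph {
  order : nat;
  adj : rel 'I_order;
  adj_sym : symmetric adj;
  adj_irr : irreflexive adj
}.

Definition graph_class := sgraph -> Prop.

(* H embeds in G exactly when it is isomorphic to an induced subgraph of G;
   graph classes are, as usual, understood up to isomorphism. *)
Definition induced_in (H G : sgraph) : Prop :=
  exists2 h : 'I_(order H) -> 'I_(order G), injective h &
    forall x y, adj (h x) (h y) = adj x y.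

Definition hereditary (GG : graph_class) : Prop :=
  forall G H : sgraph, GG G -> induced_in H G -> GG H.

Definition clique (G : sgraph) (A : {set 'I_(order G)}) : bool :=
  [forall x in A, forall y in A, (x != y) ==> adj x y].

Definition clique_number (G : sgraph) : nat :=
  (\max_(A : {set 'I_(order G)} | clique A) #|A|)%N.

(* The empty set is not counted: otherwise the null graph, which lies in every
   nonempty hereditary class, would violate every bound of the form f * n. *)
Definition num_cliques_lt (G : sgraph) (r : nat) : nat :=
  #|[set A : {set 'I_(order G)} | [&& clique A, A != finset.set0 & (#|A| < r)%N]]|.

(* The cliques of G - S are the cliques of G that are disjoint from S. *)
Definition Kr_coverable (r : nat) (G : sgraph) (k : nat) : bool :=
  [exists S : {set 'I_(order G)}, (#|S| <= k)%N &&
    [forall A : {set 'I_(order G)},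
       (clique A && [disjoint A & S]) ==> (#|A| != r)]].

Definition is_tree (T : sgraph) : Prop :=
  [/\ (0 < order T)%N,
      forall x y : 'I_(order T), connect (@adj T) x y
    & forall s : seq 'I_(order T), (2 < size s)%N -> ~ ucycle (@adj T) s].

(* The last clause says that the nodes whose bag contains v induce a connected
   subgraph of T. *)
Definition tree_decomposition (G T : sgraph)
    (bag : 'I_(order T) -> {set 'I_(order G)}) : Prop :=
  [/\ is_tree T,
      forall v, exists t, v \in bag t,
      forall u v, adj u v -> exists t, (u \in bag t) && (v \in bag t)
    & forall v s t, v \in bag s -> v \in bag t ->
        connect (fun a b => [&& adj a b, v \in bag a & v \in bag b]) s t].

Definition has_width (G : sgraph) (w : nat) : Prop :=
  exists (T : sgraph) (bag : 'I_(order T) -> {set 'I_(order G)}),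
    tree_decomposition bag /\ forall t, (#|bag t| <= w.+1)%N.

Lemma has_width_order (G : sgraph) : has_width G (order G).
Proof.
have sym : symmetric (fun _ _ : 'I_1 => false) by [].
have irr : irreflexive (fun _ : 'I_1 => fun=> false) by [].
exists (SGraph sym irr), (fun=> [set: 'I_(order G)]); split; last first.
  by move=> t; rewrite cardsT card_ord leqnSn.
split=> /=.
- split=> //= [x y|s s2 /andP[_ us]]; first by rewrite !ord1 connect0.
  have := card_uniqP us; have := max_card (mem s); rewrite card_ord => h1 h2.
  by move: s2; rewrite -h2 ltnNge (leq_trans h1).
- by move=> v; exists ord0; rewrite inE.
- by move=> u v _; exists ord0; rewrite !inE.
- by move=> v s t _ _; rewrite !ord1 connect0.
Qed.

Lemma has_width_ex (G : sgraph) : exists w, `[< has_width G w >].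
Proof. by exists (order G); apply/asboolP; exact: has_width_order. Qed.

(* The null graph gets treewidth 0 rather than -1. *)
Definition treewidth (G : sgraph) : nat := ex_minn (has_width_ex G).

Section PropertyP.
Local Open Scope classical_set_scope.
Variable R : realType.

Definition clique_tw_bounds (r : nat) (alpha : R) (f g : nat -> R)
    (GG : graph_class) : Prop :=
  forall (G : sgraph) (omega : nat), GG G -> (clique_number G < omega)%N ->
    (num_cliques_lt G r)%:R <= f omega * (order G)%:R /\
    (treewidth G)%:R <= g omega * (order G)%:R `^ alpha.

Definition property_P (r : nat) (phi gamma alpha : R) (GG : graph_class)
    : Prop :=
  exists f g : nat -> R,
    [/\ f =O_\oo (fun x => x%:R `^ phi),
        g =O_\oo (fun x => x%:R `^ gamma)
      & clique_tw_bounds r alpha f g GG].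

(* property_P with an explicit constant K for both O's: by property_PE, having
   property_P is having property_P_with K for some K. Exposing K makes it
   possible to quantify the hidden constant of a running time bound before the
   class and before gamma and alpha. *)
Definition property_P_with (K : R) (r : nat) (phi gamma alpha : R)
    (GG : graph_class) : Prop :=
  clique_tw_bounds r alpha
    (fun x => K * x%:R `^ phi) (fun x => K * x%:R `^ gamma) GG.

Lemma bigO_powR_bound (phi : R) (f : nat -> R) : 0 <= phi ->
  f =O_\oo (fun x => x%:R `^ phi) ->
  exists2 K : R, 0 <= K &
    forall x, (0 < x)%N -> f x <= K * x%:R `^ phi.
Proof.
move=> phi0 /eqO_exP[k k0 [N _ hN]].
have S0 : 0 <= \sum_(i < N) `|f i| by apply: sumr_ge0.
exists (k + \sum_(i < N) `|f i|); first by rewrite addr_ge0 // ltW.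
move=> x x0; apply: le_trans (ler_norm _) _; rewrite mulrDl.
case: (leqP N x) => xN.
  apply: le_trans (hN x xN) _.
  by rewrite (ger0_norm (powR_ge0 _ _)) lerDl mulr_ge0 ?powR_ge0.
have p1 : 1 <= x%:R `^ phi :> R.
  rewrite -[leLHS](powRr0 x%:R) ler_powR //.
  by rewrite ler1n.
apply: (@le_trans _ _ (\sum_(i < N) `|f i|)).
  by rewrite (bigD1 (Ordinal xN)) //= lerDl sumr_ge0.
apply: (@le_trans _ _ ((\sum_(i < N) `|f i|) * x%:R `^ phi)).
  by rewrite ler_peMr.
by rewrite lerDr mulr_ge0 ?powR_ge0 // ltW.
Qed.

Lemma bigO_scale (K : R) (f e : nat -> R) :
  (forall x, f x = K * e x) -> f =O_\oo e.
Proof.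
move=> fE; apply/eqO_exP; exists (`|K| + 1); first by rewrite ltr_wpDl.
by apply: nearW => x; rewrite fE normrM ler_wpM2r // lerDl.
Qed.

Lemma property_PE (r : nat) (phi gamma alpha : R) (GG : graph_class) :
  0 <= phi -> 0 <= gamma ->
  property_P r phi gamma alpha GG <->
  exists K : R, property_P_with K r phi gamma alpha GG.
Proof.
move=> phi0 gamma0; split; last first.
  move=> [K PK].
  exists (fun x => K * x%:R `^ phi), (fun x => K * x%:R `^ gamma).
  split; [exact: (@bigO_scale K)|exact: (@bigO_scale K)|exact: PK].
move=> [f [g [/(bigO_powR_bound phi0)[K1 K10 h1]
              /(bigO_powR_bound gamma0)[K2 K20 h2] PP]]].
exists (K1 + K2) => G omega GGG lt_om.
have om0 : (0 < omega)%N by exact: leq_trans lt_om.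
have [b1 b2] := PP G omega GGG lt_om; split.
- apply: le_trans b1 _; rewrite ler_wpM2r //.
  by apply: le_trans (h1 _ om0) _; rewrite ler_wpM2r ?powR_ge0 // lerDl.
- apply: le_trans b2 _; rewrite ler_wpM2r ?powR_ge0 //.
  by apply: le_trans (h2 _ om0) _; rewrite ler_wpM2r ?powR_ge0 // lerDr.
Qed.

End PropertyP.

(* Model of computation: call-by-value first-order recursive programs over
   binary trees (pure LISP, in the style of Jones' languages WHILE and F), with
   one time unit per evaluation step. Every step only manipulates pointers
   (no arithmetic, no equality test on trees), so that this time measure is
   polynomially related to Turing machine time. *)
Inductive tree := Leaf | Node of tree & tree.

(* Variables are de Bruijn indices; [Case e e1 e2] evaluates [e1] if [e] is a
   leaf, and otherwise [e2] with the two subtrees as variables 0 and 1. *)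
Inductive tm :=
  | Var of nat
  | Nil
  | Cons of tm & tm
  | Case of tm & tm & tm
  | Let of tm & tm
  | Call of nat & tm.

(* The bodies of unary functions; function 0 is the entry point. *)
Definition program := seq tm.

Definition body (P : program) (f : nat) : tm := nth Nil P f.

(* [eval P s e v t]: in the environment s, e evaluates to v in time t. *)
Inductive eval (P : program) : seq tree -> tm -> tree -> nat -> Prop :=
  | EvalVar s i : eval P s (Var i) (nth Leaf s i) 1
  | EvalNil s : eval P s Nil Leaf 1
  | EvalCons s e1 e2 v1 v2 t1 t2 :
      eval P s e1 v1 t1 -> eval P s e2 v2 t2 ->
      eval P s (Cons e1 e2) (Node v1 v2) (t1 + t2).+1
  | EvalCaseLeaf s e e1 e2 v t t1 :
      eval P s e Leaf t -> eval P s e1 v t1 ->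
      eval P s (Case e e1 e2) v (t + t1).+1
  | EvalCaseNode s e e1 e2 a b v t t2 :
      eval P s e (Node a b) t -> eval P [:: a, b & s] e2 v t2 ->
      eval P s (Case e e1 e2) v (t + t2).+1
  | EvalLet s e1 e2 v1 v t1 t2 :
      eval P s e1 v1 t1 -> eval P (v1 :: s) e2 v t2 ->
      eval P s (Let e1 e2) v (t1 + t2).+1
  | EvalCall s f e v w t u :
      eval P s e v t -> eval P [:: v] (body P f) w u ->
      eval P s (Call f e) w (t + u).+1.

Lemma eval_det (P : program) s e v t v' t' :
  eval P s e v t -> eval P s e v' t' -> v = v' /\ t = t'.
Proof.
move=> ev; move: v' t'.
induction ev => v' t' ev'; inversion ev'; subst; try by [].
all: repeat match goal with
  | IH : forall v t, eval ?Q ?s ?e v t -> _, H : eval ?Q ?s ?e _ _ |- _ =>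
    destruct (IH _ _ H) as [eqv eqt]; clear H;
    try discriminate eqv; try (injection eqv as); subst
  end.
all: first [by [] | by split; congruence].
Qed.

Definition run (P : program) (input output : tree) (t : nat) : Prop :=
  eval P [:: input] (body P 0) output t.

Definition enc_bool (b : bool) : tree := if b then Node Leaf Leaf else Leaf.

Definition enc_nat (n : nat) : tree := iter n (Node Leaf) Leaf.

Definition enc_seq (T : Type) (enc : T -> tree) (s : seq T) : tree :=
  foldr (fun x l => Node (enc x) l) Leaf s.

Definition adjacency_rows (G : sgraph) : seq (seq bool) :=
  [seq [seq adj x y | y <- enum 'I_(order G)] | x <- enum 'I_(order G)].

(* Adjacency matrix, and k in unary. *)
Definition enc_instance (G : sgraph) (k : nat) : tree :=
  Node (enc_seq (enc_seq enc_bool) (adjacency_rows G)) (enc_nat k).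

(* [time n k] bounds the running time on the inputs (G, k) where G is a graph
   of the class with n vertices; nothing is required outside the class. *)
Definition solves_Kr_cover (R : realType) (P : program) (r : nat)
    (GG : graph_class) (time : nat -> nat -> R) : Prop :=
  forall (G : sgraph) (k : nat), GG G ->
    exists2 t : nat,
      run P (enc_instance G k) (enc_bool (Kr_coverable r G k)) t &
      t%:R <= time (order G) k.

(* Main.v *)
(* The r-cliques of G form a family F of sets to be hit by at most k vertices. If the sets of
   size c containing a set R include w^(c - |R|) sets, with c and then c - |R| minimal, they
   behave like a sunflower with heart R. With w = k + 1 a solution must hit R, so R replaces
   its supersets, until at most k r (k + 1)^(r - 1) sets are left. The algorithm then runs
   attempts for l = 1, 2, ... with w about k / l, each reducing F to families whose vertex
   sets V span graphs of small treewidth; an attempt gives up when it gets too expensive.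
   - If r <= phi + 2, branch on hitting a heart or taking all its petals. Added sets of size b
     weigh (3w)^(r - b): each petal branch adds a weight of at least w^r, and a family hit by
     k vertices has bounded weight, so O(l) petal branches suffice. Without hearts, the family
     has at most k r w^(r - 1) sets and its cliques have O(w) vertices.
   - If r > phi + 2, (P1) bounds the clique number by a constant, so there are linearly many
     cliques with less than r vertices. Starting from a packing, a set M of vertices grows by
     petals of its traces T, unless T has many disjoint petals, in which case T is trusted to
     be hit. Trusted traces are revised when M has eaten most of their petals, which happens
     boundedly often. At the end |M| = O(k w), and either at most l vertices of the solution
     lie outside M and can be guessed, or the trusted traces are hit within the same budget.
   On V, (P2) gives balanced separators of at most l vertices, hence an elimination order whose
   fronts have O(l log k) vertices, and dynamic programming along it has 2^(O(l log k)) states.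
   The two bounds on |V| and on the cliques of G[V] make l = O(k^eps) sufficient. *)

Require Import Defs.
From mathcomp Require Import all_boot all_order all_algebra.
From mathcomp Require Import all_classical all_reals all_analysis.
From mathcomp Require Import zify ring lra.
Import Defs.
Import Order.TTheory GRing.Theory Num.Theory.
Import numFieldNormedType.Exports.
Set Implicit Arguments.
Unset Strict Implicit.
Unset Printing Implicit Defensive.
Local Open Scope nat_scope.

(** * Polynomial-time functions of the program model *)

(** Two demands shape the proof. The hidden constants may not depend on [gamma] and [alpha], so the
    program never computes the exponent and tries [l] in increasing order instead. An attempt that
    answers is right for every [l]; property P is used for the claim that some attempt with
    [l = O(k ^ eps)] answers. The exponent solves one equation: if [l = k ^ eps] and
    [w = k ^ (1 - eps)], then the treewidth that (P2) allows for G[V] is again [k ^ eps] up to a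
    constant.

    The other obstacle is the concrete program model, in which every running time has to be derived.
    The budget of an attempt is therefore written in unary into the state of the main loop, as
    [padding]. An attempt is then polynomial in the size of its input, which follows from closure
    properties of polynomial time alone, and the exponential factor occurs only as a bound on the
    size of the states. After the first reduction of the family the number of its elements is
    polynomial in [k] for fixed [r], so that the graph contributes only a polynomial factor. *)

Class Enc (A : Type) := enc : A -> tree.
#[global] Instance Enc_tree : Enc tree := id.
#[global] Instance Enc_unit : Enc unit := fun=> Leaf.
#[global] Instance Enc_nat : Enc nat := enc_nat.
#[global] Instance Enc_bool : Enc bool := enc_bool.
#[global] Instance Enc_seq A (EA : Enc A) : Enc (seq A) := enc_seq enc.
#[global] Instance Enc_prod A B (EA : Enc A) (EB : Enc B) : Enc (A * B) :=
  fun p => Node (enc p.1) (enc p.2).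
#[global] Instance Enc_option A (EA : Enc A) : Enc (option A) :=
  fun o => if o is Some a then Node Leaf (enc a) else Leaf.
#[global] Instance Enc_sum A B (EA : Enc A) (EB : Enc B) : Enc (A + B) :=
  fun x => match x with
  | inl a => Node Leaf (enc a) | inr b => Node (Node Leaf Leaf) (enc b) end.

Fixpoint tsize (t : tree) : nat :=
  if t is Node a b then (tsize a + tsize b).+1 else 1.
Definition sz A {EA : Enc A} (a : A) : nat := tsize (enc a).

Lemma tsize_gt0 t : 0 < tsize t. Proof. by case: t. Qed.
Lemma sz_gt0 A {EA : Enc A} (a : A) : 0 < sz a. Proof. exact: tsize_gt0. Qed.

Definition loaded (P : program) (n : nat) (L : program) :=
  forall i, i < size L -> body P (n + i) = nth Nil L i.

Lemma loaded_cat P n L1 L2 :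
  loaded P n (L1 ++ L2) -> loaded P n L1 /\ loaded P (n + size L1) L2.
Proof.
move=> H; split=> i lti.
  by rewrite H ?size_cat ?ltn_addr // nth_cat lti.
by rewrite -addnA H ?size_cat ?ltn_add2l // nth_cat ltnNge leq_addr addKn.
Qed.

(* The helper functions of a piece of code may be stored from any index [n] on,
   so that programs compose without relocating calls; the environment below the
   argument is arbitrary, so that code can be used under binders. *)
Definition computes A B {EA : Enc A} {EB : Enc B} (f : A -> B) (T : A -> nat) :=
  forall n, exists (e : tm) (L : program), forall P, loaded P n L ->
  forall a s, exists2 t, eval P (enc a :: s) e (enc (f a)) t & t <= T a.

Section Computes.
Context {A B C : Type} {EA : Enc A} {EB : Enc B} {EC : Enc C}.

(** A program sees encodings only, so it can be read at any other types with the same encodings.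
    Proof data can thus be attached to an argument without being encoded. *)
Lemma computes_transport (f : A -> B) T A' (EA' : Enc A') B' (EB' : Enc B')
    (f' : A' -> B') T' :
  computes f T ->
  (forall a', exists a, [/\ enc a = enc a', enc (f a) = enc (f' a') & T a <= T' a']) ->
  computes f' T'.
Proof.
move=> cf H n; have [e [L H1]] := cf n; exists e, L => P /H1{}H1 a' s.
have [a [ea efa leT]] := H a'; have [t ev le_t] := H1 a s.
by exists t; [rewrite -ea -efa | apply: leq_trans leT].
Qed.

Lemma computes_id : computes (id : A -> A) (fun=> 1).
Proof.
move=> n; exists (Var 0), [::] => P _ a s; exists 1 => //.
exact: (EvalVar P (enc a :: s) 0).
Qed.

Fixpoint quote (t : tree) : tm :=
  if t is Node a b then Cons (quote a) (quote b) else Nil.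

Lemma eval_quote P s t : eval P s (quote t) t (tsize t).
Proof. by elim: t => [|a Ha b Hb] /=; constructor. Qed.

Lemma computes_const (b : B) : computes (fun _ : A => b) (fun=> sz b).
Proof.
move=> n; exists (quote (enc b)), [::] => P _ a s.
by exists (sz b) => //; exact: eval_quote.
Qed.

Lemma computes_comp (f : A -> B) (g : B -> C) Tf Tg :
  computes f Tf -> computes g Tg ->
  computes (g \o f) (fun a => (Tf a + Tg (f a)).+1).
Proof.
move=> cf cg n; have [e1 [L1 H1]] := cf n; have [e2 [L2 H2]] := cg (n + size L1).
exists (Let e1 e2), (L1 ++ L2) => P /loaded_cat[/H1{}H1 /H2{}H2] a s.
have [t1 ev1 le1] := H1 a s; have [t2 ev2 le2] := H2 (f a) (enc a :: s).
by exists (t1 + t2).+1; [apply: EvalLet ev1 ev2 | rewrite ltnS leq_add].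
Qed.

Lemma computes_pair (f : A -> B) (g : A -> C) Tf Tg :
  computes f Tf -> computes g Tg ->
  computes (fun a => (f a, g a)) (fun a => (Tf a + Tg a).+1).
Proof.
move=> cf cg n; have [e1 [L1 H1]] := cf n; have [e2 [L2 H2]] := cg (n + size L1).
exists (Cons e1 e2), (L1 ++ L2) => P /loaded_cat[/H1{}H1 /H2{}H2] a s.
have [t1 ev1 le1] := H1 a s; have [t2 ev2 le2] := H2 a s.
by exists (t1 + t2).+1; [apply: EvalCons ev1 ev2 | rewrite ltnS leq_add].
Qed.

Lemma computes_fst (f : A -> B * C) T :
  computes f T -> computes (fun a => (f a).1) (fun a => (T a).+2).
Proof.
move=> cf n; have [e [L H]] := cf n; exists (Case e Nil (Var 0)), L => P /H{}H a s.
have [t ev let_] := H a s; exists (t + 1).+1; last by rewrite addn1 !ltnS.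
move: ev; case: (f a) => b c ev.
by apply: EvalCaseNode ev _; apply: (EvalVar P [:: _, _ & _] 0).
Qed.

Lemma computes_snd (f : A -> B * C) T :
  computes f T -> computes (fun a => (f a).2) (fun a => (T a).+2).
Proof.
move=> cf n; have [e [L H]] := cf n; exists (Case e Nil (Var 1)), L => P /H{}H a s.
have [t ev let_] := H a s; exists (t + 1).+1; last by rewrite addn1 !ltnS.
move: ev; case: (f a) => b c ev.
by apply: EvalCaseNode ev _; apply: (EvalVar P [:: _, _ & _] 1).
Qed.

Lemma computes_case D {ED : Enc D} (h : A -> C) (f1 : A -> B) (f2 : D -> B)
    (f : A -> B) Th T1 T2 T :
  computes h Th -> computes f1 T1 -> computes f2 T2 ->
  (forall a, match enc (h a) with
   | Leaf => f1 a = f a /\ T1 a <= T a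
   | Node u v => exists d, [/\ enc d = Node (enc a) (Node u v),
                               f2 d = f a & T2 d <= T a]
   end) ->
  computes f (fun a => Th a + T a + 7).
Proof.
move=> ch c1 c2 Hf n; have [e0 [L0 H0]] := ch n.
have [e1 [L1 H1]] := c1 (n + size L0).
have [e2 [L2 H2]] := c2 (n + size L0 + size L1).
(* In the node branch the environment starts with [u], [v], [a]. The code of [f2] expects one
   argument, so they are first packed into the encoding of [(a, (u, v))]. *)
exists (Case e0 e1 (Let (Cons (Var 2) (Cons (Var 0) (Var 1))) e2)), (L0 ++ L1 ++ L2).
move=> P /loaded_cat[/H0{}H0 /loaded_cat[/H1{}H1 /H2{}H2]] a s.
have [t0 ev0 le0] := H0 a s; move: (Hf a); case E: (enc (h a)) ev0 => [|u v] ev0.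
  move=> [<- leT]; have [t1 ev1 le1] := H1 a s.
  exists (t0 + t1).+1; [exact: EvalCaseLeaf ev0 ev1 | lia].
move=> [d [ed <- leT]]; have [t2 ev2 le2] := H2 d [:: u, v, enc a & s].
exists (t0 + (5 + t2).+1).+1; last by lia.
apply: EvalCaseNode ev0 _; apply: EvalLet ev2; rewrite ed.
apply: (@EvalCons _ _ _ _ _ _ 1 3); first exact: (EvalVar P [:: u, v, enc a & s] 2).
apply: (@EvalCons _ _ _ _ _ _ 1 1); first exact: (EvalVar P [:: u, v, enc a & s] 0).
exact: (EvalVar P [:: u, v, enc a & s] 1).
Qed.

(** A loop is a tail-recursive function stored at index [n], followed by the helpers of [g]. One
    turn costs 7 steps beside [g], and the initial call costs 2. *)
Lemma computes_loop (g : A -> A + B) (F : A -> B) Tg TF (mu : A -> nat) :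
  computes g Tg ->
  (forall a, match g a with
   | inl a' => [/\ F a = F a', mu a' < mu a & Tg a + TF a' + 7 <= TF a]
   | inr b => F a = b /\ Tg a + 7 <= TF a end) ->
  computes F (fun a => TF a + 2).
Proof.
move=> cg HF n; have [e [L H]] := cg n.+1.
(* The value of [g] is a node made of a tag and a payload. A leaf as tag means [inl], and the
   function calls itself on the payload. For [inr] the inner [Case] has pushed two more variables,
   so that the payload is [Var 3]. *)
pose bd := Let e (Case (Var 0) Nil (Case (Var 0) (Call n (Var 1)) (Var 3))).
exists (Call n (Var 0)), (bd :: L) => P ldP.
have bdP : body P n = bd by have := ldP 0 isT; rewrite addn0.
have {}H : forall a s, exists2 t, eval P (enc a :: s) e (enc (g a)) t & t <= Tg a.
  by apply: H => i lti; have := ldP i.+1 lti; rewrite addSnnS.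
have main a : exists2 t, eval P [:: enc a] (body P n) (enc (F a)) t & t <= TF a.
  have [m] := ubnP (mu a); elim: m => // m IHm in a *; rewrite ltnS => lem.
  have [t ev le_t] := H a [::]; move: (HF a) ev; rewrite bdP.
  case Eg: (g a) => [a'|b].
    move=> [-> ltmu leT] ev.
    have [t' ev' le_t'] := IHm a' (leq_trans ltmu lem).
    exists (t + (1 + (1 + (1 + t').+1).+1).+1).+1; last by lia.
    apply: EvalLet ev _.
    apply: EvalCaseNode; first exact: (EvalVar P [:: _ ; _] 0).
    apply: EvalCaseLeaf; first exact: (EvalVar P [:: _, _ & _] 0).
    apply: EvalCall; [exact: (EvalVar P [:: _, _ & _] 1) | exact: ev'].
  move=> [-> leT] ev; exists (t + (1 + (1 + 1).+1).+1).+1; last by lia.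
  apply: EvalLet ev _.
  apply: EvalCaseNode; first exact: (EvalVar P [:: _ ; _] 0).
  apply: EvalCaseNode; first exact: (EvalVar P [:: _, _ & _] 0).
  exact: (EvalVar P [:: _, _, _, _ & _] 3).
move=> a s; have [t ev le_t] := main a; exists (1 + t).+1; last by lia.
by apply: EvalCall ev; exact: (EvalVar P (enc a :: s) 0).
Qed.

End Computes.

(** There is no leading constant: the base is at least 2, so constants and sums are absorbed by the
    exponent. *)
Definition polyb A {EA : Enc A} (T : A -> nat) :=
  exists d, forall a, T a <= (sz a).+1 ^ d.

Section Polyb.
Context {A : Type} {EA : Enc A}.
Implicit Types T : A -> nat.

Lemma polyb_le T T' : (forall a, T a <= T' a) -> polyb T' -> polyb T.
Proof. by move=> le [d H]; exists d => a; apply: leq_trans (le a) (H a). Qed.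

Lemma polyb_const n : polyb (fun _ : A => n).
Proof.
exists n => a; apply: leq_trans (ltnW (ltn_expl n (isT : 1 < 2))) _.
by case: n => // n; rewrite leq_exp2r // ltnS sz_gt0.
Qed.

Lemma polyb_sz : polyb (fun a : A => sz a).
Proof. by exists 1 => a; rewrite expn1. Qed.

Lemma polyb_mul T T' : polyb T -> polyb T' -> polyb (fun a => T a * T' a).
Proof.
by move=> [d H] [d' H']; exists (d + d') => a; rewrite expnD leq_mul.
Qed.

Lemma polyb_add T T' : polyb T -> polyb T' -> polyb (fun a => T a + T' a).
Proof.
move=> [d H] [d' H']; exists (d + d').+1 => a.
apply: leq_trans (leq_add (H a) (H' a)) _; rewrite expnS expnD.
have: 1 < (sz a).+1 by rewrite ltnS sz_gt0.
have: 0 < (sz a).+1 ^ d by rewrite expn_gt0.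
have: 0 < (sz a).+1 ^ d' by rewrite expn_gt0.
set y := expn _ d'; set x := expn _ d; set z := _.+1; nia.
Qed.

Lemma polyb_exp T e : polyb T -> polyb (fun a => T a ^ e).
Proof.
move=> [d H]; exists (d * e) => a; rewrite expnM.
by case: e => // e; rewrite leq_exp2r.
Qed.

Lemma polyb_comp B {EB : Enc B} (f : A -> B) (T : B -> nat) :
  polyb (fun a => sz (f a)) -> polyb T -> polyb (fun a => T (f a)).
Proof.
move=> pf [d H]; apply: (@polyb_le _ (fun a => (sz (f a) + 1) ^ d)) => [a|].
  by rewrite addn1.
by apply: polyb_exp; apply: polyb_add pf (polyb_const 1).
Qed.

End Polyb.

(** The size of the value needs a bound of its own: [Cons (Var 0) (Var 0)] doubles a tree in
    constant time, so that a value may be exponentially larger than the time spent on it. *)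
Definition PT A B {EA : Enc A} {EB : Enc B} (f : A -> B) :=
  exists T, [/\ computes f T, polyb T & polyb (fun a => sz (f a))].

Section PTbasic.
Context {A : Type} {EA : Enc A}.

Lemma PT_ext B {EB : Enc B} (f g : A -> B) : f =1 g -> PT f -> PT g.
Proof. by move=> /funext ->. Qed.

Lemma PT_id : PT (id : A -> A).
Proof. exists (fun=> 1); split; [exact: computes_id|exact: polyb_const|exact: polyb_sz]. Qed.

Lemma PT_const B {EB : Enc B} (b : B) : PT (fun _ : A => b).
Proof. exists (fun=> sz b); split; [exact: computes_const|exact: polyb_const|exact: polyb_const]. Qed.

Lemma PT_comp B C {EB : Enc B} {EC : Enc C} (f : A -> B) (g : B -> C) :
  PT g -> PT f -> PT (fun a => g (f a)).
Proof.
move=> [Tg [cg pg sg]] [Tf [cf pf sf]].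
exists (fun a => (Tf a + Tg (f a)).+1); split; first exact: computes_comp.
  apply: (@polyb_le _ _ _ (fun a => Tf a + Tg (f a) + 1)) => [a|]; first by rewrite addn1.
  by apply: polyb_add _ (polyb_const _); apply: polyb_add pf _; apply: polyb_comp.
by apply: (polyb_comp sf sg).
Qed.

Lemma PT_pair B C {EB : Enc B} {EC : Enc C} (f : A -> B) (g : A -> C) :
  PT f -> PT g -> PT (fun a => (f a, g a)).
Proof.
move=> [Tf [cf pf sf]] [Tg [cg pg sg]].
exists (fun a => (Tf a + Tg a).+1); split; first exact: computes_pair.
  apply: (@polyb_le _ _ _ (fun a => Tf a + Tg a + 1)) => [a|]; first by rewrite addn1.
  by apply: polyb_add _ (polyb_const _); apply: polyb_add.
apply: (@polyb_le _ _ _ (fun a => sz (f a) + sz (g a) + 1)) => [a|].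
  by rewrite /sz /= addn1.
by apply: polyb_add _ (polyb_const _); apply: polyb_add.
Qed.

Lemma PT_fst B C {EB : Enc B} {EC : Enc C} (f : A -> B * C) :
  PT f -> PT (fun a => (f a).1).
Proof.
move=> [Tf [cf pf sf]]; exists (fun a => (Tf a).+2); split; first exact: computes_fst.
  apply: (@polyb_le _ _ _ (fun a => Tf a + 2)) => [a|]; first by rewrite addn2.
  exact: polyb_add _ (polyb_const _).
apply: polyb_le sf => a; rewrite /sz; case: (f a) => b c /=; lia.
Qed.

Lemma PT_snd B C {EB : Enc B} {EC : Enc C} (f : A -> B * C) :
  PT f -> PT (fun a => (f a).2).
Proof.
move=> [Tf [cf pf sf]]; exists (fun a => (Tf a).+2); split; first exact: computes_snd.
  apply: (@polyb_le _ _ _ (fun a => Tf a + 2)) => [a|]; first by rewrite addn2.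
  exact: polyb_add _ (polyb_const _).
apply: polyb_le sf => a; rewrite /sz; case: (f a) => b c /=; lia.
Qed.

Lemma PT_transport B {EB : Enc B} (f : A -> B) A' {EA' : Enc A'} B' {EB' : Enc B'}
    (f' : A' -> B') :
  PT f ->
  (forall a', exists2 a, enc a = enc a' & enc (f a) = enc (f' a')) -> PT f'.
Proof.
move=> [T [cf [d pT] [d' sf]]] H; exists (fun a' => (sz a').+1 ^ d); split.
- apply: computes_transport cf _ => a'; have [a ea ef] := H a'; exists a; split=> //.
  by apply: leq_trans (pT a) _; rewrite /sz ea.
- by exists d.
exists d' => a'; have [a ea ef] := H a'; have := sf a.
by rewrite /sz ea ef.
Qed.

Lemma PT_case B C D {EB : Enc B} {EC : Enc C} {ED : Enc D}
    (h : A -> C) (f1 : A -> B) (f2 : D -> B) (f : A -> B) :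
  PT h -> PT f1 -> PT f2 ->
  (forall a, match enc (h a) with
   | Leaf => f1 a = f a
   | Node u v => exists2 d, enc d = Node (enc a) (Node u v) & f2 d = f a
   end) -> PT f.
Proof.
move=> [Th [ch ph sh]] [T1 [c1 p1 s1]] [T2 [c2 [d2 p2] [d2' s2]]] Hf.
pose N a := (@sz _ EA a + @sz _ EC (h a)).+2.
have leN a d u v : enc (h a) = Node u v -> enc d = Node (enc a) (Node u v) ->
    (sz d).+1 <= N a.
  by rewrite /N /sz => -> -> /=; lia.
have pN e : polyb (fun a => N a ^ e).
  apply: polyb_exp; apply: (@polyb_le _ _ _ (fun a => sz a + sz (h a) + 2)) => [a|].
    by rewrite addn2.
  by apply: polyb_add _ (polyb_const _); apply: polyb_add sh; apply: polyb_sz.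
have leX a e x : x.+1 <= N a -> x.+1 ^ e <= N a ^ e.
  by case: e => // e; rewrite leq_exp2r.
exists (fun a => Th a + (T1 a + N a ^ d2) + 7); split.
- apply: (computes_case ch c1 c2) => a; move: (Hf a).
  case E: (enc (h a)) => [|u v]; first by split=> //; rewrite leq_addr.
  move=> [d ed fd]; exists d; split=> //; apply: leq_trans (p2 d) _.
  by apply: leq_trans (leq_addl _ _); apply: leX (leN _ _ _ _ E ed).
- by apply: polyb_add _ (polyb_const _); apply: polyb_add ph _; apply: polyb_add.
apply: (@polyb_le _ _ _ (fun a => sz (f1 a) + N a ^ d2')) => [a|]; last exact: polyb_add.
move: (Hf a); case E: (enc (h a)) => [|u v]; first by move=> ->; rewrite leq_addr.
move=> [d ed <-]; apply: leq_trans (s2 d) _; apply: leq_trans (leq_addl _ _).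
exact: leX (leN _ _ _ _ E ed).
Qed.

(** Iterating a polynomial-time step can make the state explode, as every turn might square its
    size. Hence [Bd], which bounds the size of the state and does not increase along the run. *)
Lemma PT_loop B {EB : Enc B} (g : A -> A + B) (F : A -> B) (Bd mu : A -> nat) :
  PT g -> polyb Bd -> polyb mu -> (forall a, sz a <= Bd a) ->
  (forall a, match g a with
   | inl a' => [/\ F a = F a', mu a' < mu a & Bd a' <= Bd a]
   | inr b => F a = b end) -> PT F.
Proof.
move=> [Tg [cg [d pg] [d' sg]]] pB pmu leB HF.
pose X e a := (Bd a).+1 ^ e.
have leX e a x : x <= Bd a -> x.+1 ^ e <= X e a.
  by rewrite /X; case: e => // e; rewrite leq_exp2r.
have pX e : polyb (X e).
  apply: polyb_exp; apply: (@polyb_le _ _ _ (fun a => Bd a + 1)) => [a|].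
    by rewrite addn1.
  exact: polyb_add _ (polyb_const _).
exists (fun a => (mu a + 1) * (X d a + 7) + 2); split.
- apply: (computes_loop (mu := mu) cg) => a; move: (HF a).
  have leT : Tg a <= X d a by apply: leq_trans (pg a) (leX _ _ _ _).
  case: (g a) => [a'|b] H; last by split=> //; move: leT; nia.
  case: H => -> ltmu le'; split=> //; have {}le' : X d a' <= X d a by apply: leX.
  move: (X d a) (X d a') le' leT => x x' le' leT.
  have : (mu a' + 1) * (x' + 7) <= mu a * (x + 7) by rewrite leq_mul ?addn1 ?leq_add2r.
  by rewrite mulnDl; lia.
- by do ![apply: polyb_add|apply: polyb_mul|exact: polyb_const|done|exact: pX].
apply: (polyb_le _ (pX d')) => a.
have [m] := ubnP (mu a); elim: m => // m IHm in a *; rewrite ltnS => lem.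
move: (HF a) (sg a); case E: (g a) => [a'|b].
  move=> [-> ltmu le'] _; apply: leq_trans (IHm _ (leq_trans ltmu lem)) _; exact: leX.
move=> ->; rewrite {1}/sz /= => szb; apply: leq_trans (leX d' _ _ (leB a)).
by apply: leq_trans szb; rewrite /sz; lia.
Qed.

End PTbasic.

Section PTdata.
Context {C : Type} {EC : Enc C}.

Lemma PT_match_seq B X {EB : Enc B} {EX : Enc X} (s : C -> seq X)
    (f0 : C -> B) (f1 : C -> X -> seq X -> B) :
  PT s -> PT f0 -> PT (fun p : C * (X * seq X) => f1 p.1 p.2.1 p.2.2) ->
  PT (fun c => if s c is x :: s' then f1 c x s' else f0 c).
Proof.
move=> ps p0 p1; apply: (PT_case ps p0 p1) => c.
case: (s c) => [|x s'] //=; by exists (c, (x, s')).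
Qed.

Lemma PT_match_nat B {EB : Enc B} (s : C -> nat) (f0 : C -> B) (f1 : C -> nat -> B) :
  PT s -> PT f0 -> PT (fun p : C * (unit * nat) => f1 p.1 p.2.2) ->
  PT (fun c => if s c is n.+1 then f1 c n else f0 c).
Proof.
move=> ps p0 p1; apply: (PT_case ps p0 p1) => c.
case: (s c) => [|n] //=; by exists (c, (tt, n)).
Qed.

Lemma PT_match_tree B {EB : Enc B} (s : C -> tree) (f0 : C -> B)
    (f1 : C -> tree -> tree -> B) :
  PT s -> PT f0 -> PT (fun p : C * (tree * tree) => f1 p.1 p.2.1 p.2.2) ->
  PT (fun c => if s c is Node x y then f1 c x y else f0 c).
Proof.
move=> ps p0 p1; apply: (PT_case ps p0 p1) => c; rewrite /enc /=.
case: (s c) => [|x y] //=; by exists (c, (x, y)).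
Qed.

Lemma PT_if B {EB : Enc B} (b : C -> bool) (f1 f2 : C -> B) :
  PT b -> PT f1 -> PT f2 -> PT (fun c => if b c then f1 c else f2 c).
Proof.
move=> pb p1 p2.
have p1' : PT (fun p : C * (unit * unit) => f1 p.1).
  exact: PT_comp p1 (PT_fst (PT_id)).
apply: (PT_case pb p2 p1') => c.
case: (b c) => //=; by exists (c, (tt, tt)).
Qed.

Lemma PT_match_option B X {EB : Enc B} {EX : Enc X} (s : C -> option X)
    (f0 : C -> B) (f1 : C -> X -> B) :
  PT s -> PT f0 -> PT (fun p : C * X => f1 p.1 p.2) ->
  PT (fun c => if s c is Some x then f1 c x else f0 c).
Proof.
move=> ps p0 p1.
have p1' : PT (fun p : C * (unit * X) => f1 p.1 p.2.2).
  exact: (PT_comp p1 (PT_pair (PT_fst PT_id) (PT_snd (PT_snd PT_id)))).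
apply: (PT_case ps p0 p1') => c.
case: (s c) => [x|] //=; by exists (c, (tt, x)).
Qed.

Lemma PT_cons X {EX : Enc X} (f : C -> X) (s : C -> seq X) :
  PT f -> PT s -> PT (fun c => f c :: s c).
Proof. by move=> pf ps; apply: (PT_transport (PT_pair pf ps)) => c; exists c. Qed.

Lemma PT_some X {EX : Enc X} (f : C -> X) : PT f -> PT (fun c => Some (f c)).
Proof.
move=> pf; have p : PT (fun c => (tt, f c)) by exact: PT_pair (PT_const _) pf.
by apply: (PT_transport p) => c; exists c.
Qed.

Lemma PT_S (f : C -> nat) : PT f -> PT (fun c => (f c).+1).
Proof.
move=> pf; have p : PT (fun c => (tt, f c)) by exact: PT_pair (PT_const _) pf.
by apply: (PT_transport p) => c; exists c.
Qed.

Lemma PT_inl X Y {EX : Enc X} {EY : Enc Y} (f : C -> X) :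
  PT f -> PT (fun c => inl (f c) : X + Y).
Proof.
move=> pf; have p : PT (fun c => (tt, f c)) by exact: PT_pair (PT_const _) pf.
by apply: (PT_transport p) => c; exists c.
Qed.

Lemma PT_inr X Y {EX : Enc X} {EY : Enc Y} (f : C -> Y) :
  PT f -> PT (fun c => inr (f c) : X + Y).
Proof.
move=> pf; have p : PT (fun c => ((tt, tt), f c)) by exact: PT_pair (PT_const _) pf.
by apply: (PT_transport p) => c; exists c.
Qed.

Lemma sz_pair X Y {EX : Enc X} {EY : Enc Y} (x : X) (y : Y) :
  sz (x, y) = (sz x + sz y).+1.
Proof. by []. Qed.

Lemma sz_cons X {EX : Enc X} (x : X) s : sz (x :: s) = (sz x + sz s).+1.
Proof. by []. Qed.

Lemma sz_drop X {EX : Enc X} (s : seq X) i : sz (drop i s) <= sz s.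
Proof.
elim: s i => [|x s IHs] [|i] //=; apply: leq_trans (IHs i) _; rewrite sz_cons; lia.
Qed.

Lemma sz_size X {EX : Enc X} (s : seq X) : size s < sz s.
Proof. by elim: s => //= x s IHs; rewrite sz_cons; lia. Qed.

End PTdata.

Section PTfold.
Context {C : Type} {EC : Enc C}.

(* The loop state consisting of [c], of the unread part of the list and of the
   accumulator is presented as the pair of [c] and of the number of elements
   read, so that a size bound is only needed for the states that do occur. *)
Lemma PT_foldl X Z {EX : Enc X} {EZ : Enc Z} (s : C -> seq X) (z : C -> Z)
    (h : C -> Z -> X -> Z) :
  PT s -> PT z -> PT (fun p : C * Z * X => h p.1.1 p.1.2 p.2) ->
  (exists d, forall c i, sz (foldl (h c) (z c) (take i (s c))) <= (sz c).+1 ^ d) ->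
  PT (fun c => foldl (h c) (z c) (s c)).
Proof.
move=> ps pz ph [d Hd].
pose st (p : C * nat) := (p.1, (drop p.2 (s p.1), foldl (h p.1) (z p.1) (take p.2 (s p.1)))).
pose ES : Enc (C * nat) := fun p => @enc _ (Enc_prod EC (Enc_prod (Enc_seq EX) EZ)) (st p).
pose G (p : C * (seq X * Z)) : (C * (seq X * Z)) + Z :=
  if p.2.1 is x :: s' then inl (p.1, (s', h p.1 p.2.2 x)) else inr p.2.2.
have pG : PT G.
  apply: (PT_match_seq (f0 := fun p => inr p.2.2)
           (f1 := fun p x s' => inl (p.1, (s', h p.1 p.2.2 x)))).
  - exact: PT_fst (PT_snd PT_id).
  - exact: PT_inr (PT_snd (PT_snd PT_id)).
  apply: PT_inl; apply: PT_pair; first exact: PT_fst (PT_fst PT_id).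
  apply: PT_pair; first exact: PT_snd (PT_snd PT_id).
  apply: (PT_comp (f := fun p => ((p.1.1, p.1.2.2), p.2.1)) ph).
  apply: PT_pair; first apply: PT_pair.
  - exact: PT_fst (PT_fst PT_id).
  - exact: PT_snd (PT_snd (PT_fst PT_id)).
  - exact: PT_fst (PT_snd PT_id).
pose g (p : C * nat) : (C * nat) + Z :=
  if p.2 < size (s p.1) then inl (p.1, p.2.+1) else inr (foldl (h p.1) (z p.1) (s p.1)).
(* [G] acts on the actual loop states. Seen through the encoding [ES] it is [g], which only advances
   the counter. *)
have pg : @PT _ _ ES (@Enc_sum _ _ ES EZ) g.
  apply: (@PT_transport _ _ _ _ G _ ES _ _ g pG) => -[c i].
  exists (st (c, i)); first by [].
  rewrite /G /g /st /=; case: ltnP => [lti|lei]; last first.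
    by rewrite drop_oversize // take_oversize.
  case E: (drop i (s c)) => [|x s'].
    by have := size_drop i (s c); rewrite E /=; lia.
  rewrite /enc /= /enc /= /ES /enc /st /=; congr (Node _ (Node _ (Node _ _))).
    by congr enc_seq; rewrite -addn1 addnC -drop_drop E /= drop0.
  congr enc; rewrite -addn1 takeD E /= take0 foldl_cat //.
pose F (p : C * nat) := foldl (h p.1) (z p.1) (s p.1).
have szc (p : C * nat) : sz p.1 <= @sz _ ES p 
  by change (@sz _ ES p) with (sz (st p)); rewrite sz_pair; lia.
have [ds Hs] : polyb (fun c => sz (s c)) by case: ps => ? [].
pose bd c := @sz _ EC c + ((@sz _ EC c).+1 ^ ds + (@sz _ EC c).+1 ^ d + 2).
have pbd : @polyb _ ES (fun p => bd p.1).
  have pe e : @polyb _ ES (fun p => (sz p.1).+1 ^ e).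
    by exists e => p; case: e => // e; rewrite leq_exp2r // ltnS.
  apply: polyb_add; first by exists 1 => p; rewrite expn1; apply: leq_trans (szc p) _.
  by apply: polyb_add _ (polyb_const _); apply: polyb_add.
have pmu : @polyb _ ES (fun p : C * nat => size (s p.1) - p.2).
  exists 1 => -[c i]; rewrite expn1 -size_drop.
  change (@sz _ ES (c, i)) with (sz (st (c, i))); rewrite /st /= !sz_pair.
  have := @sz_size _ EX (drop i (s c)); lia.
have PF : @PT _ _ ES EZ F.
  apply: (PT_loop pg pbd pmu) => -[c i] /=.
    change (@sz _ ES (c, i)) with (sz (st (c, i))); rewrite /st /= !sz_pair /bd.
    have := Hd c i; have := leq_trans (@sz_drop _ EX (s c) i) (Hs c); lia.
  rewrite /g /=; case: ltnP => // lti; split=> //=; lia.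
have [T [cF [dT pT] [dF sF]]] := PF.
have ps0 : PT (fun c => (c, (s c, z c))) by apply: PT_pair PT_id (PT_pair ps pz).
have [T0 [c0 p0 s0]] := ps0.
exists (fun c => (T0 c + T (c, 0)).+1); split.
- move=> n; have [e1 [L1 H1]] := c0 n; have [e2 [L2 H2]] := cF (n + size L1).
  exists (Let e1 e2), (L1 ++ L2) => P /loaded_cat[/H1{}H1 /H2{}H2] a sc.
  have [t1 ev1 le1] := H1 a sc; have [t2 ev2 le2] := H2 (a, 0) (enc a :: sc).
  exists (t1 + t2).+1; last by rewrite ltnS leq_add.
  by apply: EvalLet ev1 _; move: ev2; rewrite /ES /st {1}/enc /= drop0 take0.
- apply: (@polyb_le _ _ _ (fun c => T0 c + (sz (c, (s c, z c)) + 1) ^ dT + 1)).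
    move=> c; rewrite addn1 ltnS leq_add2l; apply: leq_trans (pT _) _.
    by change (@sz _ ES (c, 0)) with (sz (st (c, 0))); rewrite /st /= drop0 take0 addn1.
  apply: polyb_add _ (polyb_const _); apply: polyb_add => //; apply: polyb_exp.
  exact: polyb_add _ (polyb_const _).
apply: (@polyb_le _ _ _ (fun c => (sz (c, (s c, z c)) + 1) ^ dF)).
  move=> c; apply: leq_trans (sF (c, 0)) _.
  by change (@sz _ ES (c, 0)) with (sz (st (c, 0))); rewrite /st /= drop0 take0 addn1.
by apply: polyb_exp; apply: polyb_add _ (polyb_const _).
Qed.

End PTfold.

(** * Arithmetic, lists and equality tests in polynomial time *)

Class EncInj (A : Type) {EA : Enc A} := enc_inj : injective (@enc A EA).
Arguments EncInj A {EA}.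

#[global] Instance EncInj_nat : EncInj nat.
Proof. by elim=> [|m IHm] [|n] //= [] /IHm ->. Qed.
#[global] Instance EncInj_bool : EncInj bool.
Proof. by case; case. Qed.
#[global] Instance EncInj_prod A B {EA : Enc A} {EB : Enc B} {IA : EncInj A} {IB : EncInj B} :
  EncInj (A * B).
Proof. by move=> [a b] [a' b'] [] /(@enc_inj _ _ IA) -> /(@enc_inj _ _ IB) ->. Qed.
#[global] Instance EncInj_seq A {EA : Enc A} {IA : EncInj A} : EncInj (seq A).
Proof.
by elim=> [|x s IHs] [|y t] //= [] /(@enc_inj _ _ IA) -> /IHs ->.
Qed.

Lemma sz_seqE X {EX : Enc X} (s : seq X) : sz s = (\sum_(x <- s) (sz x).+1).+1.
Proof.
elim: s => [|x s IHs]; first by rewrite big_nil.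
by rewrite big_cons sz_cons IHs; lia.
Qed.

Lemma sz_take X {EX : Enc X} (s : seq X) i : sz (take i s) <= sz s.
Proof. by rewrite -{2}(cat_take_drop i s) !sz_seqE big_cat /=; lia. Qed.

Lemma sz_rev X {EX : Enc X} (s : seq X) : sz (rev s) = sz s.
Proof.
elim: s => // x s; rewrite rev_cons -cats1 !sz_seqE big_cat big_seq1 big_cons /=; lia.
Qed.

Lemma sz_cat X {EX : Enc X} (s t : seq X) : sz (s ++ t) <= sz s + sz t.
Proof. by rewrite !sz_seqE big_cat /=; lia. Qed.

Lemma sz_nat n : sz n = n.*2.+1.
Proof. by elim: n => // n IHn; rewrite /sz /= -/(sz n) IHn; lia. Qed.

Lemma sz_bool (b : bool) : sz b <= 3. Proof. by case: b. Qed.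

Lemma PT_polyb {C} {EC : Enc C} B {EB : Enc B} (f : C -> B) : PT f -> polyb (fun c => sz (f c)).
Proof. by case=> ? []. Qed.

Lemma PT_foldl_b {C} {EC : Enc C} X Z {EX : Enc X} {EZ : Enc Z} (s : C -> seq X) (z : C -> Z)
    (h : C -> Z -> X -> Z) (T : C -> nat) :
  PT s -> PT z -> PT (fun p : C * Z * X => h p.1.1 p.1.2 p.2) ->
  polyb T -> (forall c i, sz (foldl (h c) (z c) (take i (s c))) <= T c) ->
  PT (fun c => foldl (h c) (z c) (s c)).
Proof.
move=> ps pz ph [d pT] H; apply: PT_foldl ps pz ph _; exists d => c i.
exact: leq_trans (H c i) (pT c).
Qed.

Lemma PT_not {C} {EC : Enc C} (b : C -> bool) : PT b -> PT (fun c => ~~ b c).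
Proof.
move=> pb; apply: (@PT_ext _ _ _ _ (fun c => if b c then false else true)) => [c|].
  by case: (b c).
exact: PT_if pb (PT_const _) (PT_const _).
Qed.

Lemma PT_and {C} {EC : Enc C} (b b' : C -> bool) : PT b -> PT b' -> PT (fun c => b c && b' c).
Proof. by move=> pb pb'; exact: PT_if pb pb' (PT_const _). Qed.

Lemma PT_or {C} {EC : Enc C} (b b' : C -> bool) : PT b -> PT b' -> PT (fun c => b c || b' c).
Proof. by move=> pb pb'; exact: PT_if pb (PT_const _) pb'. Qed.

Lemma PT_nseq {C} {EC : Enc C} (n : C -> nat) : PT n -> PT (fun c => nseq (n c) tt).
Proof.
move=> pn; apply: (PT_transport pn) => c; exists c => //.
by elim: (n c) => // m; rewrite /enc /= /enc /= => ->.
Qed.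

Lemma PT_size {C} {EC : Enc C} X {EX : Enc X} (s : C -> seq X) : PT s -> PT (fun c => size (s c)).
Proof.
move=> ps.
have E t : foldl (fun n (_ : X) => n.+1) 0 t = size t.
  by rewrite -[RHS]add0n; elim: t 0 => [|x t IHt] n //=; rewrite ?addn0 // IHt addSnnS.
apply: (@PT_ext _ _ _ _ (fun c => foldl (fun n (_ : X) => n.+1) 0 (s c))) => [c|].
  exact: E.
have [d pd] := PT_polyb ps.
apply: (PT_foldl_b (T := fun c => 2 * sz (s c)) ps (PT_const 0)).
- exact: PT_S (PT_snd (PT_fst PT_id)).
- by apply: polyb_mul (polyb_const _) _; exists d.
move=> c i; rewrite E sz_nat size_take_min; have := @sz_size _ EX (s c); lia.
Qed.

Lemma PT_rev {C} {EC : Enc C} X {EX : Enc X} (s : C -> seq X) : PT s -> PT (fun c => rev (s c)).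
Proof.
move=> ps.
have E (t : seq X) : foldl (fun acc x => x :: acc) [::] t = rev t.
  by rewrite -[RHS]cats0 -/(catrev t [::]) -catrevE; elim: t [::] => //= x t IHt a.
apply: (@PT_ext _ _ _ _ (fun c => foldl (fun acc x => x :: acc) [::] (s c))) => [c|].
  exact: E.
apply: (PT_foldl_b (T := fun c => sz (s c)) ps (PT_const [::])).
- exact: PT_cons (PT_snd PT_id) (PT_snd (PT_fst PT_id)).
- exact: PT_polyb.
by move=> c i; rewrite E sz_rev sz_take.
Qed.

Lemma polyb_sum {C} {EC : Enc C} X {EX : Enc X} (s : C -> seq X) (T : C * X -> nat) :
  PT s -> polyb T -> polyb (fun c => \sum_(x <- s c) T (c, x)).
Proof.
move=> ps [d pT].
apply: (@polyb_le _ _ _ (fun c => sz (s c) * (sz c + sz (s c) + 1) ^ d)); last first.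
  apply: polyb_mul; first exact: PT_polyb.
  by apply: polyb_exp; apply: polyb_add _ (polyb_const _); apply: polyb_add polyb_sz (PT_polyb ps).
move=> c; apply: (@leq_trans (size (s c) * (sz c + sz (s c) + 1) ^ d)); last first.
  by rewrite leq_mul2r ltnW ?orbT //; exact: sz_size.
have H t : sz t <= sz (s c) ->
    \sum_(x <- t) T (c, x) <= size t * (sz c + sz (s c) + 1) ^ d.
  elim: t => [|x t IHt]; first by rewrite big_nil.
  rewrite big_cons sz_cons /= => le; rewrite mulSn leq_add //; last by apply: IHt; lia.
  apply: leq_trans (pT _) _; rewrite sz_pair; case: (d) => // e; rewrite leq_exp2r //; lia.
exact: H.
Qed.

Lemma PT_map {C} {EC : Enc C} X Y {EX : Enc X} {EY : Enc Y} (s : C -> seq X) (f : C -> X -> Y) :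
  PT s -> PT (fun p : C * X => f p.1 p.2) -> PT (fun c => [seq f c x | x <- s c]).
Proof.
move=> ps pf.
have E c (t : seq X) : foldl (fun acc x => f c x :: acc) [::] t = rev (map (f c) t).
  rewrite -[RHS]cats0 -/(catrev _ [::]) -catrevE.
  by elim: t [::] => //= x t IHt a.
apply: (@PT_ext _ _ _ _ (fun c => rev (foldl (fun acc x => f c x :: acc) [::] (s c)))) => [c|].
  by rewrite E revK.
apply: PT_rev.
pose T c := (\sum_(x <- s c) (@sz _ EY (f c x)).+1).+1.
apply: (PT_foldl_b (T := T) ps (PT_const [::])).
- apply: (PT_cons _ (PT_snd (PT_fst PT_id))).
  apply: (PT_comp (f := fun p => (p.1.1, p.2)) pf).
  exact: PT_pair (PT_fst (PT_fst PT_id)) (PT_snd PT_id).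
- apply: (@polyb_le _ _ _ (fun c => \sum_(x <- s c) (sz (f c x) + 1) + 1)) => [c|].
    by rewrite /T addn1 ltnS; under eq_bigr do rewrite -addn1.
  apply: polyb_add _ (polyb_const _).
  apply: (polyb_sum (T := fun p => sz (f p.1 p.2) + 1)) => //.
  by apply: polyb_add _ (polyb_const _); exact: PT_polyb pf.
move=> c i; rewrite E sz_rev sz_seqE /T ltnS big_map.
by rewrite -{2}(cat_take_drop i (s c)) big_cat leq_addr.
Qed.

Lemma sz_filter X {EX : Enc X} (p : pred X) (s : seq X) : sz (seq.filter p s) <= sz s.
Proof.
elim: s => //= x s IHs; case: ifP => _; rewrite !sz_cons; lia.
Qed.

Lemma PT_filter {C} {EC : Enc C} X {EX : Enc X} (s : C -> seq X) (f : C -> X -> bool) :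
  PT s -> PT (fun p : C * X => f p.1 p.2) -> PT (fun c => [seq x <- s c | f c x]).
Proof.
move=> ps pf.
have E c (t : seq X) :
    foldl (fun acc x => if f c x then x :: acc else acc) [::] t = rev (seq.filter (f c) t).
  rewrite -[RHS]cats0 -/(catrev _ [::]) -catrevE.
  by elim: t [::] => //= x t IHt a; rewrite IHt; case: ifP.
apply: (@PT_ext _ _ _ _ (fun c =>
  rev (foldl (fun acc x => if f c x then x :: acc else acc) [::] (s c)))) => [c|].
  by rewrite E revK.
apply: PT_rev.
apply: (PT_foldl_b (T := fun c => sz (s c)) ps (PT_const [::])).
- apply: PT_if.
  + apply: (PT_comp (f := fun p => (p.1.1, p.2)) pf).
    exact: PT_pair (PT_fst (PT_fst PT_id)) (PT_snd PT_id).
  + exact: PT_cons (PT_snd PT_id) (PT_snd (PT_fst PT_id)).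
  exact: PT_snd (PT_fst PT_id).
- exact: PT_polyb.
by move=> c i; rewrite E sz_rev; apply: leq_trans (sz_filter _ _) (sz_take _ _).
Qed.

Lemma PT_has {C} {EC : Enc C} X {EX : Enc X} (s : C -> seq X) (f : C -> X -> bool) :
  PT s -> PT (fun p : C * X => f p.1 p.2) -> PT (fun c => has (f c) (s c)).
Proof.
move=> ps pf.
apply: (@PT_ext _ _ _ _ (fun c => ~~ (if [seq x <- s c | f c x] is x :: s then false else true))).
  by move=> c; elim: (s c) => //= x t; case: (f c x).
apply: PT_not; apply: (PT_match_seq (f1 := fun _ _ _ => false)); last exact: PT_const.
  exact: PT_filter.
exact: PT_const.
Qed.

Lemma PT_all {C} {EC : Enc C} X {EX : Enc X} (s : C -> seq X) (f : C -> X -> bool) :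
  PT s -> PT (fun p : C * X => f p.1 p.2) -> PT (fun c => all (f c) (s c)).
Proof.
move=> ps pf.
apply: (@PT_ext _ _ _ _ (fun c => ~~ has (fun x => ~~ f c x) (s c))) => [c|].
  by rewrite -all_predC; apply: eq_all => x /=; rewrite negbK.
by apply: PT_not; apply: PT_has => //; apply: PT_not.
Qed.

Lemma PT_cat {C} {EC : Enc C} X {EX : Enc X} (s t : C -> seq X) :
  PT s -> PT t -> PT (fun c => s c ++ t c).
Proof.
move=> ps pt.
have E (u v : seq X) : foldl (fun acc x => x :: acc) v u = rev u ++ v.
  by rewrite -catrevE; elim: u v => //= x u IHu a.
apply: (@PT_ext _ _ _ _ (fun c => foldl (fun acc x => x :: acc) (t c) (rev (s c)))) => [c|].
  by rewrite E revK.
apply: (PT_foldl_b (T := fun c => sz (s c) + sz (t c))) => //.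
- exact: PT_rev.
- exact: PT_cons (PT_snd PT_id) (PT_snd (PT_fst PT_id)).
- by apply: polyb_add; exact: PT_polyb.
move=> c i; rewrite E; apply: leq_trans (sz_cat _ _) _.
by rewrite leq_add2r sz_rev; apply: leq_trans (sz_take _ _) _; rewrite sz_rev.
Qed.

Lemma PT_flatten {C} {EC : Enc C} X {EX : Enc X} (s : C -> seq (seq X)) :
  PT s -> PT (fun c => flatten (s c)).
Proof.
move=> ps.
have E (t : seq (seq X)) : foldl (fun acc x => acc ++ x) [::] t = flatten t.
  by rewrite -[RHS]cat0s; elim: t [::] => [|x t IHt] a /=; rewrite ?cats0 // IHt catA.
apply: (@PT_ext _ _ _ _ (fun c => foldl (fun acc x => acc ++ x) [::] (s c))) => [c|].
  exact: E.
have H (t : seq (seq X)) : sz (flatten t) <= sz t.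
  elim: t => // x t IHt; rewrite sz_cons /=; apply: leq_trans (sz_cat _ _) _; lia.
apply: (PT_foldl_b (T := fun c => sz (s c)) ps (PT_const [::])).
- exact: PT_cat (PT_snd (PT_fst PT_id)) (PT_snd PT_id).
- exact: PT_polyb.
by move=> c i; rewrite E; apply: leq_trans (H _) (sz_take _ _).
Qed.

Lemma PT_iter {C} {EC : Enc C} Z {EZ : Enc Z} (n : C -> nat) (z : C -> Z) (h : C -> Z -> Z) (T : C -> nat) :
  PT n -> PT z -> PT (fun p : C * Z => h p.1 p.2) -> polyb T ->
  (forall c i, i <= n c -> sz (iter i (h c) (z c)) <= T c) ->
  PT (fun c => iter (n c) (h c) (z c)).
Proof.
move=> pn pz ph pT H.
have E c m : foldl (fun z (_ : unit) => h c z) (z c) (nseq m tt) = iter m (h c) (z c).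
  by elim: m (z c) => // m IHm a; rewrite iterSr -IHm.
apply: (@PT_ext _ _ _ _ (fun c => foldl (fun z (_ : unit) => h c z) (z c) (nseq (n c) tt))).
  by move=> c; exact: E.
apply: (PT_foldl_b (T := T)) => //; first exact: PT_nseq.
  exact: (PT_comp ph (PT_fst PT_id)).
move=> c i; have -> : take i (nseq (n c) tt) = nseq (minn i (n c)) tt.
  by elim: i (n c) => [|i IHi] [|m] //=; rewrite ?min0n ?minn0 // minnSS /= IHi.
by rewrite E H // geq_minr.
Qed.

Lemma PT_pred {C} {EC : Enc C} (n : C -> nat) : PT n -> PT (fun c => (n c).-1).
Proof.
move=> pn; apply: (@PT_ext _ _ _ _ (fun c => if n c is m.+1 then m else 0)) => [c|].
  by case: (n c).
apply: (PT_match_nat (f1 := fun _ m => m) pn (PT_const 0)).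
exact: PT_snd (PT_snd PT_id).
Qed.

Lemma PT_add {C} {EC : Enc C} (m n : C -> nat) : PT m -> PT n -> PT (fun c => m c + n c).
Proof.
move=> pm pn; apply: (@PT_ext _ _ _ _ (fun c => iter (m c) S (n c))) => [c|].
  by rewrite iter_succn addnC.
apply: (PT_iter (T := fun c => 2 * sz (m c) + sz (n c)) (h := fun=> S)) => //.
- exact: PT_S (PT_snd PT_id).
- by apply: polyb_add (PT_polyb pn); apply: polyb_mul (polyb_const _) (PT_polyb pm).
by move=> c i; rewrite iter_succn !sz_nat; lia.
Qed.

Lemma PT_sub {C} {EC : Enc C} (m n : C -> nat) : PT m -> PT n -> PT (fun c => m c - n c).
Proof.
move=> pm pn; apply: (@PT_ext _ _ _ _ (fun c => iter (n c) predn (m c))) => [c|].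
  by rewrite iter_predn.
apply: (PT_iter (T := fun c => sz (m c)) (h := fun=> predn)) => //.
- exact: PT_pred (PT_snd PT_id).
- exact: PT_polyb pm.
by move=> c i; rewrite iter_predn !sz_nat; lia.
Qed.

Lemma PT_mul {C} {EC : Enc C} (m n : C -> nat) : PT m -> PT n -> PT (fun c => m c * n c).
Proof.
move=> pm pn; apply: (@PT_ext _ _ _ _ (fun c => iter (m c) (addn (n c)) 0)) => [c|].
  by rewrite iter_addn_0 mulnC.
apply: (PT_iter (T := fun c => sz (m c) * sz (n c)) (h := fun c => addn (n c))) => //.
- exact: PT_const.
- apply: PT_add (PT_snd PT_id); exact: (PT_comp pn (PT_fst PT_id)).
- by apply: polyb_mul; exact: PT_polyb.
by move=> c i; rewrite iter_addn_0 !sz_nat; nia.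
Qed.

Lemma PT_leq {C} {EC : Enc C} (m n : C -> nat) : PT m -> PT n -> PT (fun c => m c <= n c).
Proof.
move=> pm pn.
apply: (@PT_ext _ _ _ _ (fun c => if m c - n c is m'.+1 then false else true)) => [c|].
  by rewrite /leq; case: (_ - _).
apply: (PT_match_nat (f1 := fun _ _ => false)); [exact: PT_sub|exact: PT_const|exact: PT_const].
Qed.

Lemma PT_exp {C} {EC : Enc C} (m : C -> nat) e : PT m -> PT (fun c => m c ^ e).
Proof.
move=> pm; elim: e => [|e IHe]; first exact: PT_const.
apply: (@PT_ext _ _ _ _ (fun c => m c * m c ^ e)) => [c|]; first by rewrite expnS.
exact: PT_mul.
Qed.

(** The model has no equality test. The pairs of trees still to be compared form a work list, which
    turns the double recursion on trees into a loop. *)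
Definition teq_step (l : seq (tree * tree)) : seq (tree * tree) + bool :=
  if l is p :: l' then
    if p.1 is Node a b then
      if p.2 is Node c d then inl ((a, c) :: (b, d) :: l') else inr false
    else if p.2 is Node c d then inr false else inl l'
  else inr true.

Fixpoint teq (t u : tree) : bool :=
  match t, u with
  | Leaf, Leaf => true
  | Node a b, Node c d => teq a c && teq b d
  | _, _ => false end.

Lemma teqP t u : reflect (t = u) (teq t u).
Proof.
apply: (iffP idP) => [|<-]; last by elim: t => //= a -> b ->.
by elim: t u => [|a IHa b IHb] [|c d] //= /andP[/IHa -> /IHb ->].
Qed.

Lemma PT_teq_step : PT teq_step.
Proof.
apply: (PT_match_seq (f0 := fun=> inr true) (f1 := fun _ p l' =>
    if p.1 is Node a b then
      if p.2 is Node c d then inl ((a, c) :: (b, d) :: l') else inr false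
    else if p.2 is Node c d then inr false else inl l')).
- exact: PT_id.
- exact: PT_const.
apply: (PT_match_tree (s := fun p => p.2.1.1) (f0 := fun p => if p.2.1.2 is Node c d then inr false else inl p.2.2)
   (f1 := fun p a b => if p.2.1.2 is Node c d then inl ((a, c) :: (b, d) :: p.2.2) else inr false)).
- exact: PT_fst (PT_fst (PT_snd PT_id)).
- apply: (PT_match_tree (f1 := fun _ _ _ => inr false)).
  + exact: PT_snd (PT_fst (PT_snd PT_id)).
  + exact: PT_inl (PT_snd (PT_snd PT_id)).
  + exact: PT_const.
apply: (PT_match_tree (s := fun q => q.1.2.1.2) (f0 := fun=> inr false)
  (f1 := fun q c d => inl ((q.2.1, c) :: (q.2.2, d) :: q.1.2.2))).
- exact: PT_snd (PT_fst (PT_snd (PT_fst PT_id))).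
- exact: PT_const.
apply: PT_inl; apply: PT_cons; last apply: PT_cons.
- exact: PT_pair (PT_fst (PT_snd (PT_fst PT_id))) (PT_fst (PT_snd PT_id)).
- exact: PT_pair (PT_snd (PT_snd (PT_fst PT_id))) (PT_snd (PT_snd PT_id)).
- exact: PT_snd (PT_snd (PT_fst (PT_fst PT_id))).
Qed.

(** Replacing a pair of nodes by the two pairs of their children leaves the encoding of the work
    list equally large, and lowers the total size of the left trees by one. *)
Lemma PT_teq : PT (fun l : seq (tree * tree) => all (fun p => teq p.1 p.2) l).
Proof.
have szp (p : tree * tree) : sz p = (tsize p.1 + tsize p.2).+1 by [].
pose mu (l : seq (tree * tree)) := sumn [seq tsize p.1 | p <- l].
apply: (PT_loop (Bd := fun l => sz l) (mu := mu) PT_teq_step) => //.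
- exact: polyb_sz.
- apply: (polyb_le _ polyb_sz) => l; elim: l => // p l IHl.
  by rewrite sz_cons szp /mu /= -/(mu l); lia.
case=> [|[[|a b] [|c d]] l] //=; rewrite ?sz_cons ?szp /mu /=; split=> //; try lia.
Qed.

Lemma PT_eq {C} {EC : Enc C} (X : eqType) {EX : Enc X} {IX : EncInj X} (f g : C -> X) :
  PT f -> PT g -> PT (fun c => f c == g c).
Proof.
move=> pf pg.
have H : PT (fun c => [:: (enc (f c), enc (g c))]).
  apply: PT_cons (PT_const [::]).
  by apply: (PT_transport (PT_pair pf pg)) => c; exists c.
apply: PT_ext (PT_comp PT_teq H) => c; rewrite /= andbT.
by apply/teqP/eqP => [/(@enc_inj _ _ IX)|->].
Qed.

Lemma PT_mem {C} {EC : Enc C} (X : eqType) {EX : Enc X} {IX : EncInj X} (f : C -> X) (s : C -> seq X) :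
  PT f -> PT s -> PT (fun c => f c \in s c).
Proof.
move=> pf ps; apply: (@PT_ext _ _ _ _ (fun c => has (fun x => f c == x) (s c))) => [c|].
  by rewrite -has_pred1; apply: eq_has => x /=; rewrite eq_sym.
apply: PT_has => //; apply: PT_eq (PT_snd PT_id); exact: (PT_comp pf (PT_fst PT_id)).
Qed.

Lemma PT_undup {C} {EC : Enc C} (X : eqType) {EX : Enc X} {IX : EncInj X} (s : C -> seq X) :
  PT s -> PT (fun c => undup (s c)).
Proof.
move=> ps; pose h (acc : seq X) x := if x \in acc then acc else x :: acc.
have E (t : seq X) : foldl h [::] (rev t) = undup t.
  rewrite foldl_rev; elim: t => //= x t ->; rewrite /h mem_undup; by case: ifP.
apply: (@PT_ext _ _ _ _ (fun c => foldl h [::] (rev (s c)))) => [c|]; first exact: E.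
have H (t : seq X) : sz (undup t) <= sz t.
  by elim: t => //= x t IHt; case: ifP => _; rewrite !sz_cons; lia.
apply: (PT_foldl_b (T := fun c => sz (s c)) (h := fun=> h) _ (PT_const [::])).
- exact: PT_rev.
- have pz : PT (fun p : C * seq X * X => p.1.2) by exact: PT_snd (PT_fst PT_id).
  by apply: PT_if => //; [apply: PT_mem (PT_snd PT_id) _|apply: PT_cons (PT_snd PT_id) _].
- exact: PT_polyb.
move=> c i; rewrite -[take _ _]revK E; apply: leq_trans (H _) _; rewrite sz_rev.
by apply: leq_trans (sz_take _ _) _; rewrite sz_rev.
Qed.

Lemma PT_ohead {C} {EC : Enc C} X {EX : Enc X} (s : C -> seq X) : PT s -> PT (fun c => ohead (s c)).
Proof.
move=> ps; apply: (PT_match_seq (f0 := fun=> None) (f1 := fun _ x _ => Some x) ps (PT_const _)).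
exact: PT_some (PT_fst (PT_snd PT_id)).
Qed.

Lemma PT_iota {C} {EC : Enc C} (m n : C -> nat) : PT m -> PT n -> PT (fun c => iota (m c) (n c)).
Proof.
move=> pm pn; pose h (p : nat * seq nat) := (p.1.+1, p.1 :: p.2).
have E a b : iter b h (a, [::]) = (a + b, rev (iota a b)).
  elim: b => [|b IHb]; first by rewrite addn0.
  have -> : iota a b.+1 = rcons (iota a b) (a + b) by rewrite -cats1 -addn1 iotaD.
  by rewrite iterS IHb /h /= addnS rev_rcons.
apply: (@PT_ext _ _ _ _ (fun c => rev (iter (n c) h (m c, [::])).2)) => [c|].
  by rewrite E revK.
apply: PT_rev; apply: PT_snd.
apply: (PT_iter (T := fun c => (sz (n c) + 2) * (2 * (sz (m c) + sz (n c)) + 2)) (h := fun=> h)) => //.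
- exact: PT_pair pm (PT_const _).
- have p1 : PT (fun p : C * (nat * seq nat) => p.2.1) by exact: PT_fst (PT_snd PT_id).
  by apply: PT_pair; [exact: PT_S|apply: PT_cons => //; exact: PT_snd (PT_snd PT_id)].
- have [a b] := (PT_polyb pn, PT_polyb pm).
  by do ?[apply: polyb_mul|apply: polyb_add|exact: polyb_const|done].
move=> c i lei; rewrite E sz_pair sz_rev sz_seqE.
have: \sum_(x <- iota (m c) i) (sz x).+1 <= \sum_(x <- iota (m c) i) (2 * (m c + n c)).+2.
  rewrite !big_seq; apply: leq_sum => x; rewrite mem_iota sz_nat; lia.
rewrite sum_nat_const_seq || rewrite big_const_seq count_predT size_iota iter_addn_0.
rewrite !sz_nat; nia.
Qed.

Lemma PT_count {C} {EC : Enc C} X {EX : Enc X} (s : C -> seq X) (f : C -> X -> bool) :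
  PT s -> PT (fun p : C * X => f p.1 p.2) -> PT (fun c => count (f c) (s c)).
Proof.
move=> ps pf; apply: (@PT_ext _ _ _ _ (fun c => size [seq x <- s c | f c x])) => [c|].
  by rewrite size_filter.
by apply: PT_size; apply: PT_filter.
Qed.

Lemma PT_nth {C} {EC : Enc C} X {EX : Enc X} (s : C -> seq X) (x0 : X) (n : C -> nat) :
  PT s -> PT n -> PT (fun c => nth x0 (s c) (n c)).
Proof.
move=> ps pn.
have pb (D : Type) (ED : Enc D) (t : D -> seq X) : PT t -> PT (fun d => behead (t d)).
  move=> pt; apply: (PT_match_seq (f0 := fun=> [::]) (f1 := fun _ _ s' => s') pt (PT_const _)).
  exact: PT_snd (PT_snd PT_id).
have E i (t : seq X) : iter i behead t = drop i t.
  by elim: i t => [|i IHi] t; rewrite ?drop0 // iterSr IHi; case: t.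
apply: (@PT_ext _ _ _ _ (fun c => if iter (n c) behead (s c) is x :: _ then x else x0)) => [c|].
  by rewrite E -[n c in RHS]addn0 -nth_drop; case: drop.
apply: (PT_match_seq (f1 := fun _ x _ => x) _ (PT_const _)); last exact: PT_fst (PT_snd PT_id).
apply: (PT_iter (T := fun c => sz (s c)) (h := fun=> behead)) => //.
- exact: pb (PT_snd PT_id).
- exact: PT_polyb.
by move=> c i _; rewrite E sz_drop.
Qed.

(** * Hearts and petals of set families *)

Notation fam := (seq (seq nat)).

Definition sub (R A : seq nat) := all (fun x => x \in A) R.
Definition dif (A R : seq nat) := [seq x <- A | x \notin R].
Definition cap (A M : seq nat) := [seq x <- A | x \in M].
Definition hit (S A : seq nat) := has (fun x => x \in S) A.
Definition hits S (F : fam) := all (hit S) F.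
Definition cnt (F : fam) R c := count (fun A => (size A == c) && sub R A) F.

(** All subsets of [A] when [size A <= n]. The fuel keeps the length of the result below [2 ^ n] for
    every [A], so that the function is polynomial on all inputs and not only on families of small
    sets. *)
Fixpoint subs n (A : seq nat) : fam :=
  if n is n'.+1 then
    if A is x :: A' then [seq x :: B | B <- subs n' A'] ++ subs n' A' else [:: [::]]
  else [:: [::]].

Definition hearts r (F : fam) : fam := undup (flatten [seq subs r A | A <- F]).

Definition is_flower w F c j R :=
  [&& size R + j == c, 0 < size R & w ^ j <= cnt F R c].

(** The order of enumeration matters: the head of this list has the least [c] and, for this [c], the
    least [j]. *)
Definition flowers r w (F : fam) : seq (nat * seq nat) :=
  flatten [seq flatten [seq [seq (c, R) | R <- [seq R <- hearts r F | is_flower w F c j R]]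
                       | j <- iota 1 c.-1] | c <- iota 2 r.-1].

Definition flower r w F := ohead (flowers r w F).

Definition hstep R (F : fam) : fam := R :: [seq A <- F | ~~ sub R A].
Definition petals c R (F : fam) : fam :=
  [seq dif A R | A <- [seq A <- F | (size A == c) && sub R A]].
Definition pstep c R (F : fam) : fam :=
  petals c R F ++ [seq A <- F | ~~ has (fun B => sub B A) (petals c R F)].

(** Sets are strictly increasing lists, so that equal sets are equal lists. Since members form an
    antichain, hearts and petals, being proper subsets of members, are not members themselves. *)
Definition wf r (F : fam) :=
  [/\ uniq F, forall A : seq nat, A \in F -> sorted ltn A,
      forall A : seq nat, A \in F -> 0 < size A <= r
    & forall A B : seq nat, A \in F -> B \in F -> sub A B -> A = B].

Definition covers (F F' : fam) := forall A : seq nat, A \in F -> exists2 B : seq nat, B \in F' & sub B A.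

Lemma subP R A : reflect {subset R <= A} (sub R A).
Proof. exact: allP. Qed.

Lemma sub_refl A : sub A A. Proof. by apply/subP. Qed.

Lemma sub_trans B A C : sub A B -> sub B C -> sub A C.
Proof. by move=> /subP AB /subP BC; apply/subP => x /AB /BC. Qed.

Lemma sorted_ltn_uniq A : sorted ltn A -> uniq A.
Proof. exact: (sorted_uniq ltn_trans ltnn). Qed.

Lemma sorted_dif A R : sorted ltn A -> sorted ltn (dif A R).
Proof. exact: (sorted_filter ltn_trans). Qed.

Lemma sorted_cap A R : sorted ltn A -> sorted ltn (cap A R).
Proof. exact: (sorted_filter ltn_trans). Qed.

Lemma sorted_eq_mem A B : sorted ltn A -> sorted ltn B -> A =i B -> A = B.
Proof. exact: (irr_sorted_eq ltn_trans ltnn). Qed.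

Lemma sub_size_eq A B :
  sorted ltn A -> sorted ltn B -> sub A B -> size B <= size A -> A = B.
Proof.
move=> sA sB /subP AB le; apply: sorted_eq_mem => //.
by have [] := uniq_min_size (sorted_ltn_uniq sA) AB le.
Qed.

Lemma sub_size A B : sorted ltn A -> sub A B -> size A <= size B.
Proof. by move=> /sorted_ltn_uniq uA /subP AB; apply: uniq_leq_size. Qed.

Lemma mem_dif A R x : (x \in dif A R) = (x \in A) && (x \notin R).
Proof. by rewrite mem_filter andbC. Qed.

Lemma mem_cap A R x : (x \in cap A R) = (x \in A) && (x \in R).
Proof. by rewrite mem_filter andbC. Qed.

Lemma hitP S A : reflect (exists2 x, x \in A & x \in S) (hit S A).
Proof. exact: hasP. Qed.

Lemma sub_hit S A B : sub A B -> hit S A -> hit S B.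
Proof. by move=> /subP AB /hitP[x /AB xB xS]; apply/hitP; exists x. Qed.

Lemma covers_refl F : covers F F.
Proof. by move=> A AF; exists A => //; exact: sub_refl. Qed.

Lemma covers_trans F2 F1 F3 : covers F1 F2 -> covers F2 F3 -> covers F1 F3.
Proof.
move=> c1 c2 A /c1[B BF BA]; have [D DF DB] := c2 B BF; exists D => //.
exact: sub_trans BA.
Qed.

Lemma covers_hits S F F' : covers F F' -> hits S F' -> hits S F.
Proof.
by move=> c /allP h; apply/allP => A /c[B /h hB BA]; exact: sub_hit hB.
Qed.

Lemma size_dif A R : sorted ltn A -> sorted ltn R -> sub R A ->
  size (dif A R) = size A - size R.
Proof.
move=> sA sR RA; have E : size R = count (fun x => x \in R) A.
  rewrite -size_filter; congr size; apply: sorted_eq_mem => //; first exact: sorted_cap.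
  by move=> x; rewrite mem_cap; case xR: (x \in R); rewrite ?andbF // (subP _ _ RA).
by rewrite size_filter E -(count_predC (fun x => x \in R) A) addKn.
Qed.

Lemma subs_subseq n A B : B \in subs n A -> subseq B A.
Proof.
elim: n A B => [|n IHn] [|x A] B /=; try by rewrite inE => /eqP ->; rewrite ?sub0seq.
rewrite mem_cat => /orP[/mapP[D /IHn DA ->]|/IHn BA]; first by rewrite /= eqxx.
exact: subseq_trans BA (subseq_cons _ _).
Qed.

Lemma mem_subs n A B : size A <= n -> subseq B A -> B \in subs n A.
Proof.
elim: n A B => [|n IHn] [|x A] B //=; try by move=> _; rewrite inE; case: B.
rewrite ltnS mem_cat => le.
case: B => [|y B] /= BA; apply/orP; first by right; apply: IHn => //; exact: sub0seq.
case: eqP BA => [-> BA|_ BA]; last by right; exact: IHn.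
by left; apply: map_f; exact: IHn.
Qed.

Lemma sorted_subseq_sub R A :
  sorted ltn R -> sorted ltn A -> sub R A = subseq R A.
Proof.
move=> sR sA; apply/idP/idP => [RA|/mem_subseq RA]; last exact/subP.
have -> : R = cap A R.
  apply: sorted_eq_mem => //; first exact: sorted_cap.
  by move=> x; rewrite mem_cap; case xR: (x \in R); rewrite ?andbF // (subP _ _ RA).
exact: filter_subseq.
Qed.

Lemma mem_hearts r F R : wf r F -> sorted ltn R ->
  (R \in hearts r F) = has (sub R) F.
Proof.
move=> [uF sF zF _] sR; rewrite mem_undup; apply/flatten_mapP/hasP.
  move=> [A AF /subs_subseq RA]; by exists A => //; rewrite (sorted_subseq_sub sR (sF A AF)).
move=> [A AF RA]; exists A => //; apply: mem_subs.
  by case/andP: (zF A AF).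
by rewrite -(sorted_subseq_sub sR (sF A AF)).
Qed.

Lemma hearts_sorted r F R : wf r F -> R \in hearts r F -> sorted ltn R.
Proof.
move=> [uF sF _ _]; rewrite mem_undup => /flatten_mapP[A AF /subs_subseq].
by move=> /(subseq_sorted ltn_trans); apply; exact: sF.
Qed.

Lemma cnt_gt0 F R c : 0 < cnt F R c -> exists A : seq nat, [/\ A \in F, size A = c & sub R A].
Proof. by rewrite -has_count => /hasP[A AF /andP[/eqP]]; exists A. Qed.

Lemma ohead_flatmap (T : Type) (g : nat -> seq T) m n x :
  ohead (flatten [seq g i | i <- iota m n]) = Some x ->
  exists i, [/\ m <= i < m + n, ohead (g i) = Some x
             & forall i', m <= i' < i -> g i' = [::]].
Proof.
elim: n m => // n IHn m /=; case E: (g m) => [|y s] /=.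
  move=> /IHn[i [lei gi H]]; exists i; split=> //; first by lia.
  move=> i'; rewrite leq_eqVlt => /andP[/orP[/eqP <- //|lt1] lt2].
  by apply: H; rewrite lt1.
move=> [<-]; exists m; rewrite E; split=> //=; first by lia.
by move=> i'; lia.
Qed.

Lemma ohead_flatmap_none (T : Type) (g : nat -> seq T) m n :
  ohead (flatten [seq g i | i <- iota m n]) = None ->
  forall i, m <= i < m + n -> g i = [::].
Proof.
elim: n m => [|n IHn] m /=; first by move=> _ i; lia.
case E: (g m) => [|y s] //= /IHn H i.
rewrite leq_eqVlt => /andP[/orP[/eqP <- //|lt1] lt2].
by apply: H; lia.
Qed.

Definition noflower w F c j :=
  forall R, sorted ltn R -> 0 < size R -> size R + j = c -> cnt F R c < w ^ j.

Lemma noflower_nil r w F c j : wf r F -> 0 < w ->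
  [seq (c, R) | R <- [seq R <- hearts r F | is_flower w F c j R]] = [::] ->
  noflower w F c j.
Proof.
move=> wfF w0 H R sR R0 Rc; rewrite ltnNge; apply/negP => le.
suff : (c, R) \in [seq (c, R) | R <- [seq R <- hearts r F | is_flower w F c j R]].
  by rewrite H.
apply: map_f; rewrite mem_filter /is_flower Rc eqxx R0 le /= mem_hearts //.
have [|A [AF _ RA]] := @cnt_gt0 F R c; first by apply: leq_trans le; rewrite expn_gt0 w0.
by apply/hasP; exists A.
Qed.

Lemma flower_some r w F c R : wf r F -> 0 < w -> flower r w F = Some (c, R) ->
  [/\ sorted ltn R, has (sub R) F, 0 < size R < c & c <= r] /\
  [/\ w ^ (c - size R) <= cnt F R c,
      forall c' j', 0 < j' < c' -> c' < c -> noflower w F c' j'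
    & forall j', 0 < j' -> j' < c - size R -> noflower w F c j'].
Proof.
move=> wfF w0; rewrite /flower /flowers => E1; have [c0 [c0r E0 Hc]] := ohead_flatmap E1.
have [j [jc0 E Hj]] := ohead_flatmap E0; move: {E0 E1} Hc Hj.
move: E; case E: [seq _ | _ <- _] => [|y s] //= [yE] Hc Hj.
have : y \in y :: s by rewrite mem_head.
rewrite -E yE => /mapP[R' RF [eqc eqR]]; move: RF; rewrite -eqR -eqc mem_filter.
move=> /andP[/and3P[/eqP Rc R0 le] RF]; have sR := hearts_sorted wfF RF.
rewrite -eqc in jc0 Hj Hc c0r *; have jE : c - size R = j by lia.
split; first by split=> //; [rewrite -(mem_hearts wfF sR)|lia|lia].
rewrite jE; split=> // [c' j' j'c' c'c|j' j'0 j'j]; apply: (noflower_nil wfF) => //.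
  have H : ohead (flatten [seq [seq (c', R) | R <- [seq R <- hearts r F | is_flower w F c' j R]]
                | j <- iota 1 c'.-1]) = None by rewrite Hc //; lia.
  by have /= -> := @ohead_flatmap_none _ _ _ _ H j'; last lia.
by apply: Hj; lia.
Qed.

Lemma flower_none r w F : wf r F -> 0 < w -> flower r w F = None ->
  forall c j, 0 < j < c -> c <= r -> noflower w F c j.
Proof.
rewrite /flower /flowers => wfF w0 E1; have H := ohead_flatmap_none E1; move=> c j jc cr; apply: (noflower_nil wfF) => //.
have H1 : ohead (flatten [seq [seq (c, R) | R <- [seq R <- hearts r F | is_flower w F c j R]]
                | j <- iota 1 c.-1]) = None by rewrite H //; lia.
by have /= -> := @ohead_flatmap_none _ _ _ _ H1 j; last lia.
Qed.

Section Steps.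
Variables (r w : nat) (F : fam) (c : nat) (R : seq nat).
Hypotheses (wfF : wf r F) (sR : sorted ltn R) (R0 : 0 < size R < c)
  (fl : 0 < cnt F R c).

Lemma flower_notin : R \notin F.
Proof.
have [uF sF zF aF] := wfF; have [A [AF Ac RA]] := cnt_gt0 fl.
by apply/negP => RF; have E := aF _ _ RF AF RA; move: R0; rewrite E Ac; lia.
Qed.

Lemma flower_sup A : A \in F -> sub R A -> size R < size A.
Proof.
have [uF sF zF aF] := wfF => AF RA; rewrite ltnNge; apply/negP => le.
by have := flower_notin; rewrite (sub_size_eq sR (sF _ AF) RA le) AF.
Qed.

Lemma wf_hstep : wf r (hstep R F).
Proof.
have [uF sF zF aF] := wfF; have [A0 [A0F A0c RA0]] := cnt_gt0 fl.
have notsub A : A \in F -> sub A R -> False.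
  move=> AF AR; have E := aF _ _ AF A0F (sub_trans AR RA0); subst A.
  by have := sub_size (sF _ A0F) AR; rewrite A0c; lia.
split=> [|A|A|A B]; rewrite /hstep ?inE /=.
- by rewrite filter_uniq // andbT mem_filter negb_and flower_notin orbT.
- by case/orP=> [/eqP -> //|]; rewrite mem_filter => /andP[_ /sF].
- case/orP=> [/eqP ->|]; first by have := zF _ A0F; rewrite A0c; lia.
  by rewrite mem_filter => /andP[_ /zF].
rewrite !mem_filter; case/orP=> [/eqP ->|/andP[nA AF]]; case/orP=> [/eqP ->|/andP[nB BF]] //.
- by rewrite (negPf nB).
- by move/(notsub _ AF).
exact: aF.
Qed.

Lemma covers_hstep : covers F (hstep R F).
Proof.
move=> A AF; case RA: (sub R A); first by exists R; rewrite ?mem_head.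
by exists A; rewrite ?sub_refl // inE mem_filter RA AF orbT.
Qed.

Lemma petalP P : P \in petals c R F ->
  exists A : seq nat, [/\ A \in F, size A = c, sub R A & P = dif A R].
Proof.
by move=> /mapP[A]; rewrite mem_filter => /andP[/andP[/eqP Ac RA] AF] ->; exists A.
Qed.

Lemma petal_facts P : P \in petals c R F ->
  [/\ sorted ltn P, size P = c - size R & P \notin F].
Proof.
have [uF sF zF aF] := wfF.
move=> /petalP[A [AF Ac RA ->]]; split; first exact/sorted_dif/sF.
  by rewrite (size_dif (sF A AF) sR RA) Ac.
apply/negP => PF; have E : dif A R = A.
  by apply: aF => //; apply/subP => x; rewrite mem_dif => /andP[].
have : size (dif A R) = size A by rewrite E.
by rewrite (size_dif (sF A AF) sR RA) Ac; lia.
Qed.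

Lemma uniq_petals : uniq (petals c R F).
Proof.
have [uF sF zF aF] := wfF.
rewrite map_inj_in_uniq ?filter_uniq // => A B; rewrite !mem_filter.
move=> /andP[/andP[_ RA] AF] /andP[/andP[_ RB] BF] E.
apply: (sorted_eq_mem (sF A AF) (sF B BF)) => x; have := congr1 (fun s => x \in s) E.
rewrite /= !mem_dif; case xR: (x \in R); last by rewrite !andbT.
by rewrite (subP _ _ RA) ?(subP _ _ RB).
Qed.

Lemma size_petals : size (petals c R F) = cnt F R c.
Proof. by rewrite size_map size_filter. Qed.

Lemma petal_sub P : P \in petals c R F ->
  exists A : seq nat, [/\ A \in F, sub P A, sub R A & ~~ hit R P].
Proof.
move=> /petalP[A [AF Ac RA ->]]; exists A; split=> //.
  by apply/subP => x; rewrite mem_dif => /andP[].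
by apply/hasPn => x; rewrite mem_dif => /andP[].
Qed.

Lemma wf_pstep : wf r (pstep c R F).
Proof.
have [uF sF zF aF] := wfF.
(* A member inside the petal of [B] equals [B] by the antichain property, but a petal misses the
   nonempty heart that [B] contains. *)
have nsub A P : A \in F -> P \in petals c R F -> sub A P -> False.
  move=> AF /petal_sub[B [BF PB RB /hasPn nRP]] AP.
  have E := aF _ _ AF BF (sub_trans AP PB); subst B.
  have [x xR] : exists x, x \in R by case: (R) R0 => // x s _; exists x; rewrite mem_head.
  by have := subP _ _ AP x (subP _ _ RB _ xR) => /nRP; rewrite xR.
split=> [|A|A|A B]; rewrite /pstep ?mem_cat.
- rewrite cat_uniq uniq_petals filter_uniq // andbT /=.
  apply/hasPn => A; rewrite mem_filter => /andP[_ AF]; apply/negP => AP.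
  exact: nsub AF AP (sub_refl A).
- by case/orP=> [/petal_facts[]//|]; rewrite mem_filter => /andP[_ /sF].
- case/orP=> [AP|]; last by rewrite mem_filter => /andP[_ /zF].
  have [_ -> _] := petal_facts AP; have [B [BF Bc _ _]] := petalP AP.
  by have := zF _ BF; lia.
rewrite !mem_filter; case/orP=> [AP|/andP[nA AF]]; case/orP=> [BP|/andP[nB BF]].
- have [sA zA _] := petal_facts AP; have [sB zB _] := petal_facts BP.
  by move=> AB; apply: sub_size_eq => //; rewrite zA zB.
- by move=> AB; case/hasP: nB; exists A.
- by move/(nsub _ _ AF BP).
exact: aF.
Qed.

Lemma covers_pstep : covers F (pstep c R F).
Proof.
move=> A AF; case E: (has (fun B => sub B A) (petals c R F)).
  by case/hasP: E => B BP BA; exists B; rewrite ?mem_cat ?BP.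
by exists A; rewrite ?sub_refl // mem_cat mem_filter E AF orbT.
Qed.

Lemma hits_hstep S : hits S F -> hit S R -> hits S (hstep R F).
Proof.
move=> /allP hF hR; rewrite /hits /= hR /=; apply/allP => A.
by rewrite mem_filter => /andP[_ /hF].
Qed.

Lemma hits_pstep S : hits S F -> ~~ hit S R -> hits S (pstep c R F).
Proof.
move=> /allP hF hR; apply/allP => A; rewrite mem_cat => /orP[|].
  move=> /petalP[B [/hF /hitP[x xB xS] _ RB ->]]; apply/hitP; exists x => //.
  by rewrite mem_dif xB /=; apply: contra hR => xR; apply/hitP; exists x.
by rewrite mem_filter => /andP[_ /hF].
Qed.

Lemma size_flatten_hstep : size (flatten (hstep R F)) < size (flatten F).
Proof.
have [uF sF zF aF] := wfF; have [A [AF Ac RA]] := cnt_gt0 fl.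
have -> : size (flatten F) = size (flatten [seq A <- F | sub R A])
    + size (flatten [seq A <- F | ~~ sub R A]).
  have /perm_flatten/perm_size <- := permEl (perm_filterC (sub R) F).
  by rewrite flatten_cat size_cat.
rewrite /= size_cat ltn_add2r; apply: (@leq_trans (size A)); first by lia.
have : A \in [seq A <- F | sub R A] by rewrite mem_filter RA.
move: [seq A <- F | sub R A]; elim=> //= B s IHs; rewrite inE size_cat.
by case/orP=> [/eqP ->|/IHs]; lia.
Qed.

End Steps.

(** * Branching, organised by the number of petal steps *)

Definition heartS r w F := if flower r w F is Some cR then hstep cR.2 F else F.
Definition petalS r w F : seq fam :=
  if flower r w F is Some cR then [:: pstep cR.1 cR.2 F] else [::].
(** A heart step lowers the total size of the members, so this many steps exhaust the flowers. *)
Definition chain r w (F : fam) := iter (size (flatten F)) (heartS r w) F.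
(** The binary branching is regrouped: any number of heart steps followed by one petal step. Heart
    steps can be numerous, but they only contribute a choice among polynomially many families, so
    the size of the search is governed by the number of petal steps alone. *)
Definition expand r w (F : fam) : seq fam :=
  flatten [seq petalS r w F' | F' <- traject (heartS r w) F (size (flatten F)).+1].

Lemma flower_cnt r w F c R : wf r F -> 0 < w -> flower r w F = Some (c, R) ->
  [/\ sorted ltn R, 0 < size R < c & 0 < cnt F R c].
Proof.
move=> wfF w0 /(flower_some wfF w0)[[sR _ R0 _] [le _ _]]; split=> //.
by apply: leq_trans le; rewrite expn_gt0 w0.
Qed.

Section Chain.
Variables (r w : nat).
Hypothesis w0 : 0 < w.

Lemma wf_heartS F : wf r F -> wf r (heartS r w F).
Proof.
rewrite /heartS => wfF; case E: flower => [[c R]|] //=.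
by have [sR R0 fl] := flower_cnt wfF w0 E; apply: wf_hstep fl.
Qed.

Lemma covers_heartS F : covers F (heartS r w F).
Proof.
by rewrite /heartS; case: flower => [[c R]|]; [exact: covers_hstep|exact: covers_refl].
Qed.

Lemma wf_iter F n : wf r F -> wf r (iter n (heartS r w) F).
Proof. by move=> wfF; elim: n => //= n; exact: wf_heartS. Qed.

Lemma covers_iter F n : covers F (iter n (heartS r w) F).
Proof.
elim: n => [|n IHn]; first exact: covers_refl.
rewrite iterS; apply: (covers_trans IHn). apply: covers_heartS.
Qed.

Lemma iter_noflower F n : wf r F -> size (flatten F) <= n ->
  flower r w (iter n (heartS r w) F) = None.
Proof.
elim: n F => [|n IHn] F wfF le.
  case E: flower => [[c R]|] //=; have [sR R0 fl] := flower_cnt wfF w0 E.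
  by have := size_flatten_hstep wfF sR R0 fl; lia.
rewrite iterSr; case E: (flower r w F) => [[c R]|].
  have [sR R0 fl] := flower_cnt wfF w0 E.
  apply: IHn; rewrite /heartS E; first by apply: wf_hstep fl.
  by have := size_flatten_hstep wfF sR R0 fl; rewrite /=; lia.
have H : heartS r w F = F by rewrite /heartS E.
by rewrite H; elim: n {IHn le} => //= n IHn; rewrite -iterS iterSr H.
Qed.

Lemma wf_chain F : wf r F -> wf r (chain r w F).
Proof. exact: wf_iter. Qed.

Lemma covers_chain F : covers F (chain r w F).
Proof. exact: covers_iter. Qed.

Lemma chain_noflower F : wf r F -> flower r w (chain r w F) = None.
Proof. by move=> wfF; exact: iter_noflower. Qed.

Lemma expandP F F1 : F1 \in expand r w F -> exists n c R,
  [/\ flower r w (iter n (heartS r w) F) = Some (c, R)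
    & F1 = pstep c R (iter n (heartS r w) F)].
Proof.
move=> /flatten_mapP[F' /trajectP[n _ ->]]; rewrite /petalS.
case E: flower => [[c R]|] //; rewrite inE => /eqP ->; by exists n, c, R.
Qed.

Lemma expand_spec F F1 : wf r F -> F1 \in expand r w F -> wf r F1 /\ covers F F1.
Proof.
move=> wfF /expandP[n [c [R [E ->]]]]; have wfn := wf_iter n wfF.
have [sR R0 fl] := flower_cnt wfn w0 E; split; first by apply: wf_pstep.
apply: (covers_trans (@covers_iter _ _)); exact: covers_pstep.
Qed.

End Chain.

(** Every member is charged to a vertex of [S] that lies in it. The bounds in terms of the size of a
    solution are all derived from this charging. *)
Lemma hits_sum S (G : fam) (f : seq nat -> nat) : hits S G ->
  \sum_(A <- G) f A <= \sum_(s <- S) \sum_(A <- G | s \in A) f A.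
Proof.
move=> /allP hG; rewrite (exchange_big_dep predT) //=.
rewrite !big_seq; apply: leq_sum => A /hG/hitP[x xA xS].
by rewrite (big_rem x) //= xA leq_addr.
Qed.

Definition ins s (R : seq nat) := sort leq (s :: R).

Lemma size_ins s R : size (ins s R) = (size R).+1.
Proof. by rewrite size_sort. Qed.

Lemma sorted_ins s R : s \notin R -> sorted ltn R -> sorted ltn (ins s R).
Proof.
move=> sR /sorted_ltn_uniq uR; rewrite ltn_sorted_uniq_leq sort_uniq /= sR uR /=.
exact: sort_sorted leq_total _.
Qed.

Lemma sub_ins s R A : sub (ins s R) A = (s \in A) && sub R A.
Proof.
rewrite /sub /ins; have /perm_all -> : perm_eq (sort leq (s :: R)) (s :: R).
  by rewrite perm_sort.
by [].
Qed.

Lemma cnt_top r F B : wf r F -> sorted ltn B -> cnt F B (size B) <= 1.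
Proof.
move=> [uF sF _ _] sB; apply: (@leq_trans (count (pred1 B) F)); last first.
  by rewrite count_uniq_mem // leq_b1.
rewrite /cnt -!size_filter; apply: uniq_leq_size; first by rewrite filter_uniq.
move=> A; rewrite !mem_filter => /andP[/andP[/eqP zA BA] AF]; rewrite AF andbT /= eq_sym.
by apply/eqP; apply: (sub_size_eq sB (sF A AF) BA); rewrite zA.
Qed.

(** If [S] missed [R], every one of the at least [(k + 1) ^ j] members of size [c] around [R] would
    contain some [s] of [S] outside [R]. As [j] is minimal, [R] with [s] added has fewer than
    [(k + 1) ^ (j - 1)] such supersets, or at most one if [j = 1], and [k] times this bound is too
    few. *)
Lemma heart_forced r k F c R S : wf r F -> flower r k.+1 F = Some (c, R) ->
  size S <= k -> hits S F -> hit S R.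
Proof.
move=> wfF E Sk hF; have [[sR _ Rc cr] [le _ nof]] := flower_some wfF (ltn0Sn k) E.
rewrite -[hit S R]negbK; apply/negP => nR.
pose L := [seq A <- F | (size A == c) && sub R A].
have hL : hits S L by apply/allP => A; rewrite mem_filter => /andP[_]; move/allP: hF; apply.
have := hits_sum (fun=> 1) hL; rewrite sum1_size leqNgt => /negP; apply.
have -> : size L = cnt F R c by rewrite size_filter.
apply: leq_trans le; set j := c - size R in nof *.
have [j' jE] : exists j', j = j'.+1 by exists j.-1; rewrite /j; lia.
apply: (@leq_ltn_trans (k * k.+1 ^ j')); last first.
  by rewrite jE expnS mulSn addnC -[X in X < _]addn0 ltn_add2l expn_gt0.
apply: (@leq_trans (\sum_(s <- S) k.+1 ^ j')); last first.
  by rewrite big_const_seq count_predT iter_addn_0 mulnC leq_mul2r Sk orbT.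
rewrite !big_seq; apply: leq_sum => s sS; rewrite -big_filter sum1_size size_filter.
have sR' : s \notin R by apply: contra nR => xR; apply/hitP; exists s.
rewrite count_filter.
have -> : count (predI (fun A => s \in A) (fun A => (size A == c) && sub R A)) F
        = cnt F (ins s R) c.
  by apply: eq_count => A /=; rewrite sub_ins andbCA.
case: j' jE => [|j'] jE.
  have {1}-> : c = size (ins s R) by rewrite size_ins; lia.
  by apply: (cnt_top wfF); exact: sorted_ins.
by apply/ltnW/nof; rewrite ?sorted_ins ?size_ins //; lia.
Qed.

Lemma hits_chain r k F S : wf r F -> size S <= k -> hits S F -> hits S (chain r k.+1 F).
Proof.
rewrite /chain => wfF Sk hF; elim: (size _) => // n IHn; rewrite iterS /heartS.
case E: flower => [[c R]|] //=; apply: hits_hstep => //.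
by apply: heart_forced E Sk IHn; exact: wf_iter.
Qed.

(** No single vertex is a heart, so each vertex of the solution lies in at most [w ^ (c - 1)]
    members of each size [c]. *)
Lemma noflower_size r w F S k : wf r F -> 0 < w -> flower r w F = None ->
  size S <= k -> hits S F -> size F <= k * (r * w ^ r.-1).
Proof.
move=> wfF w0 /(flower_none wfF w0) nof Sk hF.
have := hits_sum (fun=> 1) hF; rewrite sum1_size => /leq_trans; apply.
apply: (@leq_trans (\sum_(s <- S) r * w ^ r.-1)); last first.
  by rewrite big_const_seq count_predT iter_addn_0 mulnC leq_mul2r Sk orbT.
apply: leq_sum => s _; rewrite -big_filter sum1_size size_filter.
have [uF sF zF aF] := wfF.
have H : count (fun A => s \in A) F <= \sum_(c <- iota 1 r) cnt F [:: s] c.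
  rewrite /cnt; under eq_bigr do rewrite -sum1_count big_mkcond /=.
  rewrite exchange_big /= -sum1_count big_mkcond /= !big_seq; apply: leq_sum => A AF.
  case sA: (s \in A) => //; rewrite (big_rem (size A)) /=; last first.
    by rewrite mem_iota; have := zF A AF; lia.
  have sA' : sub [:: s] A by rewrite /sub /= sA.
  by rewrite eqxx.
apply: (leq_trans H); apply: (@leq_trans (\sum_(c <- iota 1 r) w ^ r.-1)); last first.
  by rewrite big_const_seq count_predT iter_addn_0 size_iota mulnC.
rewrite !big_seq; apply: leq_sum => c; rewrite mem_iota => cr.
have [c1|c1] := leqP c 1.
  have -> : c = size [:: s] by rewrite /=; lia.
  apply: leq_trans (cnt_top wfF _) _ => //; by rewrite expn_gt0 w0.
apply: (@leq_trans (w ^ c.-1)); last by rewrite leq_pexp2l //; lia.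
by apply/ltnW/nof => //=; lia.
Qed.

(** * The weight of the added sets *)

Section Potential.
Variables (r w : nat).
Hypothesis w0 : 0 < w.

Definition wt (A : seq nat) := (3 * w) ^ (r - size A).
(** The factor 2: when sets of size [j] are added, fewer than [w ^ (j - |R|)] of the old ones
    contain [R], because [j] is below the minimal [c] of a flower, and the step itself adds at most
    as many. *)
Definition bounded (G : fam) := forall R j, sorted ltn R -> 0 < size R < j ->
  j <= r -> cnt G R j <= 2 * w ^ (j - size R).

Lemma geom n : \sum_(i < n) 2 * 3 ^ i = 3 ^ n - 1.
Proof.
elim: n => [|n IHn]; first by rewrite big_ord0.
have : 0 < 3 ^ n by rewrite expn_gt0.
by rewrite big_ord_recr /= IHn expnS; lia.
Qed.

(** This explains the base [3 * w] of the weight. The supersets of [B] weigh at most the sum of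
    [2 * 3 ^ i], for [i] below [r - |B|], times [w ^ (r - |B|)]. The sum is [3 ^ (r - |B|) - 1], so
    [B] outweighs all that it displaces by [w ^ (r - |B|)]. *)
Lemma loss G B : bounded G -> (forall A : seq nat, A \in G -> size A <= r) ->
  sorted ltn B -> 0 < size B <= r ->
  \sum_(A <- G | sub B A && (size B < size A)) wt A
    <= w ^ (r - size B) * (3 ^ (r - size B) - 1).
Proof.
move=> bG zG sB B0; set b := size B in B0 *.
apply: (@leq_trans (\sum_(i < r - b) cnt G B (r - i) * (3 * w) ^ i)).
  rewrite /cnt; under [X in _ <= X]eq_bigr => i _.
    rewrite -sum1_count big_mkcond big_distrl /=; over.
  rewrite exchange_big big_mkcond /= !big_seq; apply: leq_sum => A AG.
  case: ifP => // /andP[BA ltA]; have zA := zG A AG.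
  have lt : r - size A < r - b by move: (size A) zA ltA; rewrite -/b; lia.
  rewrite (bigD1 (Ordinal lt)) //=; have -> : r - (r - size A) = size A by rewrite subKn.
  by rewrite eqxx BA mul1n leq_addr.
rewrite -geom big_distrr /=; apply: leq_sum => i _.
apply: (@leq_trans (2 * w ^ (r - i - b) * (3 * w) ^ i)).
  by rewrite leq_mul2r bG ?orbT //; have := ltn_ord i; lia.
have -> : w ^ (r - b) = w ^ (r - i - b) * w ^ i.
  by rewrite -expnD; congr (_ ^ _); have := ltn_ord i; lia.
rewrite expnMn; set x := w ^ _; set y := w ^ _; set z := 3 ^ _; nia.
Qed.

(** For each vertex [s] of the solution, [loss] with [B] the singleton of [s] bounds the weight of
    the larger members containing [s]; the singleton itself accounts for the factor 2. *)
Lemma potential_bound G S k : uniq G -> bounded G -> 0 < r ->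
  (forall A : seq nat, A \in G -> sorted ltn A) -> (forall A : seq nat, A \in G -> 0 < size A <= r) ->
  size S <= k -> hits S G ->
  \sum_(A <- G) wt A <= k * (2 * (3 ^ r.-1 * w ^ r.-1)).
Proof.
move=> uG bG r0 sG zG Sk hG; apply: leq_trans (hits_sum _ hG) _.
apply: (@leq_trans (\sum_(s <- S) 2 * (3 ^ r.-1 * w ^ r.-1))); last first.
  by rewrite big_const_seq count_predT iter_addn_0 mulnC leq_mul2r Sk orbT.
apply: leq_sum => s _; rewrite (bigID (fun A => size A == 1)) /= mul2n -addnn.
apply: leq_add.
  rewrite -big_filter; have [le1|] := leqP (size [seq A <- G | (s \in A) && (size A == 1)]) 1.
    move: le1 (filter_all (fun A => (s \in A) && (size A == 1)) G).
    case: [seq A <- G | _] => [|A [|//]] /=; first by rewrite big_nil.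
    rewrite big_seq1 andbT => _ /andP[_ /eqP A1].
    by rewrite /wt A1 subn1 expnMn.
  rewrite ltnNge => /negP[]; apply: (@leq_trans (size [:: [:: s]])) => //.
  apply: uniq_leq_size; first by rewrite filter_uniq.
  move=> A; rewrite mem_filter inE => /andP[/andP[sA /eqP A1] _].
  by case: A A1 sA => [|x [|//]] //= _; rewrite inE => /eqP ->.
have zG' A : A \in G -> size A <= r by move/zG; case/andP.
have := @loss G [:: s] bG zG' isT; rewrite /= r0 subn1 => /(_ isT) H.
apply: (@leq_trans (w ^ r.-1 * (3 ^ r.-1 - 1))); last first.
  by rewrite mulnC leq_mul2r leq_subr orbT.
apply: leq_trans H; rewrite big_mkcond [X in _ <= X]big_mkcond /=.
rewrite big_seq [X in _ <= X]big_seq; apply: leq_sum => A /zG zA.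
rewrite andbT; case: ifP => // /andP[-> A1] /=; case: ifP => //; lia.
Qed.

End Potential.

Section Path.
Variables (r w k : nat) (S : seq nat).
Hypotheses (r0 : 0 < r) (w0 : 0 < w) (Sk : size S <= k).

(* [G] consists of the sets of [F] that were added by some step. *)
Definition pathinv (F G : fam) t :=
  [/\ wf r F, uniq G, {subset G <= F} & bounded r w G] /\
  (hits S F /\ t * w ^ r <= \sum_(A <- G) wt r w A).

Lemma cnt_sub F G R c : uniq G -> {subset G <= F} -> cnt G R c <= cnt F R c.
Proof.
move=> uG GF; rewrite /cnt -!size_filter; apply: uniq_leq_size.
  by rewrite filter_uniq.
by move=> A; rewrite !mem_filter => /andP[-> /GF].
Qed.

(** Every removed set is charged to one of the sets of [P] inside it, and [loss] applies to each of
    these. *)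
Lemma wt_keep (G : fam) (P : fam) b : bounded r w G ->
  (forall A : seq nat, A \in G -> size A <= r) ->
  (forall B : seq nat, B \in P -> sorted ltn B /\ size B = b) -> 0 < b <= r ->
  (forall A B : seq nat, A \in G -> B \in P -> sub B A -> b < size A) ->
  \sum_(A <- G) wt r w A <=
    \sum_(A <- [seq A <- G | ~~ has (fun B => sub B A) P]) wt r w A
    + size P * (w ^ (r - b) * (3 ^ (r - b) - 1)).
Proof.
move=> bG zG hP b0 hGP; rewrite (bigID (fun A => has (fun B => sub B A) P)) /= addnC.
rewrite big_filter leq_add2l.
apply: (@leq_trans (\sum_(B <- P) \sum_(A <- G | sub B A && (size B < size A)) wt r w A)).
  rewrite (exchange_big_dep predT) //= big_mkcond big_seq [X in _ <= X]big_seq.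
  apply: leq_sum => A AG; case: ifP => // /hasP[B BP BA].
  rewrite (big_rem B) //= BA; have [_ zB] := hP B BP.
  by rewrite zB (hGP A B AG BP BA) /= leq_addr.
rewrite -sum1_size big_distrl /= !big_seq; apply: leq_sum => B /hP[sB zB].
by rewrite mul1n; have := loss w0 bG zG sB; rewrite zB; apply.
Qed.

Lemma pathinv_hstep F G t c R : pathinv F G t -> flower r w F = Some (c, R) ->
  hit S R -> exists G', pathinv (hstep R F) G' t.
Proof.
move=> [[wfF uG GF bG] [hF le]] E hR.
have [[sR _ Rc cr] [lec nofc nofj]] := flower_some wfF w0 E.
have [_ _ fl] := flower_cnt wfF w0 E; have [uF sF zF aF] := wfF.
have RF := flower_notin wfF sR Rc fl.
exists (R :: [seq A <- G | ~~ has (fun B => sub B A) [:: R]]).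
set G1 := [seq A <- G | _].
have sG' : {subset G1 <= G} by move=> A; rewrite mem_filter => /andP[].
have uG' : uniq G1 by rewrite filter_uniq.
split; [split|split].
- exact: wf_hstep fl.
- by rewrite cons_uniq uG' andbT; apply: contra RF => /sG'/GF.
- move=> A; rewrite !inE => /orP[-> //|]; rewrite mem_filter /= orbF => /andP[nRA /GF AF].
  by rewrite mem_filter nRA AF orbT.
- move=> R' j sR' R'j jr; rewrite /cnt [count _ _]/= -/(cnt G1 R' j).
  have le1 := cnt_sub R' j uG' sG'.
  case: eqP => [Rj|_] /=; last by apply: leq_trans le1 _; apply: bG.
  have lt : cnt F R' j < w ^ (j - size R').
    by apply: (nofc j (j - size R')) => //; lia.
  by have := cnt_sub R' j uG GF; case: (sub R' R); lia.
- exact: hits_hstep.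
apply: leq_trans le _; rewrite big_cons.
have zG (A : seq nat) : A \in G -> size A <= r by move/GF/zF; case/andP.
apply: leq_trans (wt_keep (P := [:: R]) (b := size R) bG zG _ _ _) _.
- by move=> B; rewrite inE => /eqP ->.
- lia.
- move=> A B AG; rewrite inE => /eqP -> RA; have := flower_sup wfF sR Rc fl (GF A AG) RA; done.
rewrite addnC leq_add2r mul1n /wt expnMn mulnC leq_mul2r leq_subr orbT //.
Qed.

Lemma pathinv_pstep F G t c R : pathinv F G t -> flower r w F = Some (c, R) ->
  ~~ hit S R -> exists G', pathinv (pstep c R F) G' t.+1.
Proof.
move=> [[wfF uG GF bG] [hF le]] E hR.
have [[sR _ Rc cr] [lec nofc nofj]] := flower_some wfF w0 E.
have [_ _ fl] := flower_cnt wfF w0 E; have [uF sF zF aF] := wfF.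
set P := petals c R F; set j := c - size R in lec nofj.
have hP (B : seq nat) : B \in P -> sorted ltn B /\ size B = j.
  by move/(petal_facts wfF sR) => [].
exists (P ++ [seq A <- G | ~~ has (fun B => sub B A) P]).
set G1 := [seq A <- G | _].
have sG' : {subset G1 <= G} by move=> A; rewrite mem_filter => /andP[].
have uG' : uniq G1 by rewrite filter_uniq.
have PF (B : seq nat) : B \in P -> B \notin F by move/(petal_facts wfF sR Rc fl) => [].
split; [split|split].
- exact: wf_pstep fl.
- rewrite cat_uniq (@uniq_petals r) // uG' andbT; apply/hasPn => A /sG'/GF AF.
  by apply/negP => /PF; rewrite AF.
- move=> A; rewrite !mem_cat => /orP[-> //|]; rewrite !mem_filter => /andP[-> /GF ->].
  by rewrite orbT.
- move=> R' j' sR' R'j jr; rewrite /cnt count_cat -/(cnt P R' j') -/(cnt G1 R' j').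
  have le1 := cnt_sub R' j' uG' sG'.
  have [jE|nj] := eqVneq j' j; last first.
    have -> : cnt P R' j' = 0.
      apply/eqP; rewrite -leqn0 leqNgt; apply/negP => /cnt_gt0[A [/hP[_ zA] zA' _]].
      by move: nj; rewrite -zA' zA eqxx.
    by apply: leq_trans le1 _; apply: bG.
  have leG : cnt G1 R' j' < w ^ (j' - size R').
    apply: leq_ltn_trans le1 _; apply: leq_ltn_trans (cnt_sub R' j' uG GF) _.
    by apply: nofc => //; rewrite /j in jE; lia.
  (* A petal containing [R'] misses [R], so it exists only if [R'] does, and it comes from a member
     of size [c] that contains the union [U] of the two. Since [c - |U| < j] and [j] is minimal,
     there are fewer than [w ^ (c - |U|)] such members. *)
  suff leP : cnt P R' j' <= w ^ (j' - size R') by lia.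
  have [/hasP[x xR' xR]|dis] := boolP (has (fun x => x \in R) R').
    rewrite (_ : cnt P R' j' = 0) //; apply/eqP; rewrite -leqn0 leqNgt.
    apply/negP => /cnt_gt0[A [/petal_sub[B [_ _ _ /hasPn nA]] _ /subP/(_ x xR') xA]].
    by have := nA x xA; rewrite xR.
  pose U := sort leq (R' ++ R).
  have zU : size U = size R' + size R by rewrite size_sort size_cat.
  have sU : sorted ltn U.
    rewrite ltn_sorted_uniq_leq sort_uniq cat_uniq !sorted_ltn_uniq //= andbT.
    rewrite sort_sorted ?andbT; last exact: leq_total.
    by apply: contra dis => /hasP[x xR xR']; apply/hasP; exists x.
  apply: (@leq_trans (cnt F U c)).
    rewrite /cnt count_map count_filter; apply: sub_count => A /=.
    move=> /andP[/andP[_ /subP R'A] /andP[-> RA]] /=.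
    apply/subP => x; rewrite mem_sort mem_cat => /orP[/R'A|/(subP _ _ RA) //].
    by rewrite mem_dif => /andP[].
  by apply/ltnW/nofj; rewrite ?zU // /j; lia.
- exact: hits_pstep.
rewrite big_cat /=.
have zG (A : seq nat) : A \in G -> size A <= r by move/GF/zF; case/andP.
have := wt_keep (P := P) (b := j) bG zG hP _ _.
have -> : \sum_(A <- P) wt r w A = size P * (w ^ (r - j) * 3 ^ (r - j)).
  rewrite big_seq (eq_bigr (fun=> w ^ (r - j) * 3 ^ (r - j))); last first.
    by move=> A /hP[_ zA]; rewrite /wt zA expnMn mulnC.
  by rewrite -big_seq big_const_seq count_predT iter_addn_0 mulnC.
rewrite -/G1; set x := 3 ^ (r - j); have : 0 < x by rewrite expn_gt0.
have -> : size P = cnt F R c by rewrite size_petals.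
(* There are at least [w ^ j] petals, and each has a net gain of [w ^ (r - j)] over the sets it
   displaces, which makes [w ^ r] in total. *)
set y := w ^ (r - j); have : w ^ r <= cnt F R c * y.
  apply: leq_trans (leq_mul lec (leqnn y)); rewrite -expnD leq_pexp2l //; rewrite /j; lia.
set n := cnt F R c; set u := \sum_(A <- G1) _; move=> h1 x0 /(_ _ _) h2.
have {}h2 : \sum_(A <- G) wt r w A <= u + n * (y * (x - 1)).
  apply: h2; first by rewrite /j; lia.
  move=> A B AG BP BA; have [_ <-] := hP _ BP; rewrite ltnNge; apply/negP => zA.
  have [sB _ nB] := petal_facts wfF sR Rc fl BP.
  by have E1 := sub_size_eq sB (sF A (GF A AG)) BA zA; rewrite E1 (GF A AG) in nB.
have : n * (y * x) = n * (y * (x - 1)) + n * y by rewrite -mulnDr mulnBr muln1 subnK // leq_pmulr.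
by rewrite mulSn; lia.
Qed.

(** The solution is the oracle of the branching: a heart step is followed while [S] hits the heart,
    and the first heart that it misses gives a petal step. Without such a heart [S] hits the end of
    the chain. *)
Lemma path_expand F G t : pathinv F G t ->
  hits S (chain r w F) \/ exists F1 G1, F1 \in expand r w F /\ pathinv F1 G1 t.+1.
Proof.
suff main n : forall F G, pathinv F G t -> size (flatten F) <= n ->
  hits S (iter n (heartS r w) F) \/ exists F1 G1,
    F1 \in flatten [seq petalS r w F' | F' <- traject (heartS r w) F n.+1] /\ pathinv F1 G1 t.+1.
  by move=> inv; exact: (main (size (flatten F)) F G inv (leqnn _)).
elim: n {F G} => [|n IHn] F G inv le; first by left; have [_ []] := inv.
have [wfF _ _ _] := inv.1; rewrite iterSr; case E: (flower r w F) => [[c R]|]; last first.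
  have H : heartS r w F = F by rewrite /heartS E.
  left; rewrite H; elim: n {IHn le} => [|n IHn]; first by have [_ []] := inv.
  by rewrite iterSr H.
have [sR R0 fl] := flower_cnt wfF w0 E.
have [hR|hR] := boolP (hit S R).
  have [G' inv'] := pathinv_hstep inv E hR.
  have H : heartS r w F = hstep R F by rewrite /heartS E.
  rewrite H; have [|h|[F1 [G1 [F1in inv1]]]] := IHn _ _ inv'.
  - by have := size_flatten_hstep wfF sR R0 fl; lia.
  - by left.
  right; exists F1, G1; split=> //; rewrite trajectS H map_cons.
  by rewrite [flatten (_ :: _)]/= mem_cat F1in orbT.
have [G' inv'] := pathinv_pstep inv E hR.
right; exists (pstep c R F), G'; split=> //; rewrite trajectS map_cons.
by rewrite [flatten (_ :: _)]/= mem_cat {1}/petalS E mem_head.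
Qed.

(** The weight [t * w ^ r] that has been gained is compared with [potential_bound], and [w ^ r.-1]
    cancels. With [k < w * l] this leaves at most [2 * 3 ^ r.-1 * l] petal steps. *)
Lemma pathinv_bound F G t : pathinv F G t -> t * w <= 2 * 3 ^ r.-1 * k.
Proof.
move=> [[wfF uG GF bG] [hF le]]; have [uF sF zF aF] := wfF.
have hG : hits S G by apply/allP => A /GF; move/allP: hF; apply.
have := potential_bound w0 uG bG r0 (fun A AG => sF A (GF A AG)) (fun A AG => zF A (GF A AG)) Sk hG.
move=> /(leq_trans le); rewrite -{1}(prednK r0) expnS.
set x := w ^ r.-1; have : 0 < x by rewrite expn_gt0 w0.
move=> x0 h; rewrite -(leq_pmul2r x0); lia.
Qed.

Fixpoint level t F : seq fam :=
  if t is t'.+1 then flatten [seq expand r w F' | F' <- level t' F] else [:: F].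

Lemma level_hits F T l : wf r F -> hits S F -> k < w * l -> 2 * 3 ^ r.-1 * l <= T ->
  exists t F', [/\ t <= T, F' \in level t F & hits S (chain r w F')].
Proof.
move=> wfF hF kl lT.
have inv0 : pathinv F [::] 0.
  split; split=> //; rewrite ?big_nil //.
suff main d t G F' : pathinv F' G t -> F' \in level t F -> T < t + d ->
    exists t F', [/\ t <= T, F' \in level t F & hits S (chain r w F')].
  by apply: (main T.+1 0 [::] F inv0); rewrite ?mem_head.
elim: d t G F' => [|d IHd] t G F' inv Ft Td.
  have := pathinv_bound inv; set n := 2 * _ in lT *; nia.
have [tT|Tt] := leqP t T; last first.
  have := pathinv_bound inv; set n := 2 * _ in lT *; nia.
have [h|[F1 [G1 [F1in inv1]]]] := path_expand inv; first by exists t, F'.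
apply: IHd inv1 _ _; last by lia.
by apply/flatten_mapP; exists F'.
Qed.

End Path.

Lemma level_spec r w t F F' : 0 < w -> wf r F -> F' \in level r w t F ->
  wf r F' /\ covers F F'.
Proof.
move=> w0 wfF; elim: t F' => [|t IHt] F'.
  by rewrite inE => /eqP ->; split=> //; exact: covers_refl.
move=> /flatten_mapP[F1 /IHt[wf1 c1] /(expand_spec w0 wf1)[wf2 c2]]; split=> //.
exact: (covers_trans c1).
Qed.

Section Clique.
Variables (r w : nat) (F : fam) (X : seq nat).
Hypotheses (wfF : wf r F) (w0 : 0 < w) (nof : flower r w F = None) (sX : sorted ltn X)
  (no1 : forall x, x \in X -> [:: x] \notin F)
  (XF : forall B, sorted ltn B -> sub B X -> size B = r -> has (fun A => sub A B) F).

Definition indep (I : seq nat) := ~~ has (fun A => sub A I) F.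

(* A maximal subset of [X] containing no set of [F] has less than [r] elements, and any
   other element of [X] completes one of its subsets to a set of [F]. *)
Lemma size_clique : size X <= r + 2 ^ r * w.
Proof.
pose I := foldr (fun x I => if indep (x :: I) then x :: I else I) [::] X.
have [uF sF zF aF] := wfF.
have E Y : foldr (fun x I => if indep (x :: I) then x :: I else I) [::] Y =
   (if Y is x :: Y' then let I := foldr (fun x I => if indep (x :: I) then x :: I else I) [::] Y' in
      if indep (x :: I) then x :: I else I else [::]) by case: Y.
have subI Y : subseq (foldr (fun x I => if indep (x :: I) then x :: I else I) [::] Y) Y.
  elim: Y => // x Y IHY; rewrite E /=; case: ifP => _; first by rewrite /= eqxx.
  exact: subseq_trans IHY (subseq_cons _ _).
have indI Y : indep (foldr (fun x I => if indep (x :: I) then x :: I else I) [::] Y).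
  elim: Y => [|x Y IHY]; last by rewrite E /=; case: ifP.
  rewrite /indep; apply/hasPn => A /zF; case: A => //.
have maxI Y x : x \in Y -> x \notin foldr (fun x I => if indep (x :: I) then x :: I else I) [::] Y ->
    ~~ indep (x :: foldr (fun x I => if indep (x :: I) then x :: I else I) [::] Y).
  elim: Y => // y Y IHY; rewrite inE E /=; case: ifP => [_|nind].
    rewrite inE negb_or; case: eqP => //= _ xY nx; have := IHY xY nx.
    apply: contra => /hasPn nA; apply/hasPn => A AF; apply: contra (nA A AF).
    move=> /subP AI; apply/subP => z /AI; rewrite !inE => /orP[->//|->]; rewrite !orbT //.
  by case: eqP => [-> _ _|_ /= xY nx]; [rewrite nind|exact: IHY].
have sI : sorted ltn I by apply: (subseq_sorted ltn_trans (subI X)).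
have zI : size I < r.
  rewrite ltnNge; apply/negP => le; have := indI X; rewrite -/I => /hasPn nA.
  have /hasP[A AF /subP AI] : has (fun A => sub A (take r I)) F.
    apply: XF; first exact: take_sorted.
      by apply/subP => x /mem_take; exact: mem_subseq (subI X) x.
    by rewrite size_take_min; apply/minn_idPl.
  have /negP[] := nA A AF; by apply/subP => x /AI /mem_take.
pose N := [seq x <- X | x \notin I].
have : size X <= size I + size N.
  rewrite -(count_predC (fun x => x \in I) X) size_filter leq_add2r -size_filter.
  apply: uniq_leq_size; first by rewrite filter_uniq // sorted_ltn_uniq.
  by move=> x; rewrite mem_filter => /andP[].
suff : size N <= 2 ^ r * w by lia.
(* [R] is the completed member without [x]. It is nonempty because no vertex of [X] forms a member
   alone, and only nonempty sets are tested as hearts. *)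
have hN x : x \in N -> exists2 R, R \in [seq R <- subs r I | 0 < size R] &
    has (fun A => (size A == (size R).+1) && sub R A && (x \in A)) [seq A <- F | sub A (x :: I)].
  rewrite mem_filter => /andP[xI xX].
  have := maxI X x xX xI; rewrite negbK -/I => /hasP[A AF AxI].
  have xA : x \in A.
    apply: contraTT (indI X) => xA; rewrite negbK -/I; apply/hasP; exists A => //.
    apply/subP => z zA; have := subP _ _ AxI z zA; rewrite inE => /orP[/eqP zx|//].
    by rewrite -zx zA in xA.
  have sA := sF A AF; have s1 : sorted ltn [:: x] by [].
  have szD : size (dif A [:: x]) = (size A).-1.
    by rewrite size_dif //= ?subn1 // xA.
  exists (dif A [:: x]).
    rewrite mem_filter szD; apply/andP; split.
      have := zF A AF; have : A != [:: x] by apply: contraNneq (no1 xX) => <-.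
      case: (A) xA => [|a [|b A']] //=; rewrite inE => /eqP ->; by rewrite eqxx.
    apply: mem_subs; first by move: zI; clear; move: (size I) => m; lia.
    rewrite -sorted_subseq_sub //; last exact: sorted_dif.
    apply/subP => z; rewrite mem_dif inE => /andP[zA zx].
    by have := subP _ _ AxI z zA; rewrite inE (negPf zx).
  apply/hasP; exists A; first by rewrite mem_filter AxI.
  rewrite xA andbT szD prednK ?eqxx /=; last by case/andP: (zF A AF).
  by apply/subP => z; rewrite mem_dif => /andP[].
pose ext R := [seq x <- N | has (fun A => (size A == (size R).+1) && sub R A && (x \in A))
                                [seq A <- F | sub A (x :: I)]].
(* Distinct [x] give distinct members, all with one element more than [R]. As [R] is no heart with
   [j = 1], there are fewer than [w ^ 1] of them; beyond size [r] there are none. *)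
have szext R : R \in [seq R <- subs r I | 0 < size R] -> size (ext R) <= w.
  rewrite mem_filter => /andP[R0 /subs_subseq RI].
  have sR : sorted ltn R by apply: (subseq_sorted ltn_trans RI).
  have RI' := mem_subseq RI.
  apply: (@leq_trans (cnt F R (size R).+1)); last first.
    have [R1|R1] := leqP (size R).+1 r.
      have j1 : 0 < 1 < (size R).+1 by [].
      have := flower_none wfF w0 nof j1 R1 sR R0 (addn1 _).
      by rewrite expn1 => /ltnW.
    rewrite /cnt (eq_in_count (a2 := pred0)) ?count_pred0 // => A /zF.
    by case: eqP => //= -> le; have := leq_ltn_trans le R1; rewrite ltnn.
  rewrite -[cnt _ _ _]size_filter -(size_map (fun A => head 0 (dif A R))).
  apply: uniq_leq_size; first by rewrite !filter_uniq // sorted_ltn_uniq.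
  move=> x; rewrite mem_filter => /andP[/hasP[A]].
  rewrite mem_filter => /andP[AxI AF] /andP[/andP[zA RA] xA]; rewrite mem_filter => /andP[xI xX].
  apply/mapP; exists A; first by rewrite mem_filter zA RA.
  have : size (dif A R) = 1 by rewrite (size_dif (sF A AF) sR RA) (eqP zA) subSnn.
  have : x \in dif A R by rewrite mem_dif xA; apply: contra xI => /RI'.
  by case: (dif A R) => [|y [|//]]; rewrite // inE => /eqP ->.
apply: (@leq_trans (\sum_(R <- [seq R <- subs r I | 0 < size R]) size (ext R))).
  rewrite (_ : size N = size (undup (flatten [seq ext R | R <- [seq R <- subs r I | 0 < size R]]))).
    apply: leq_trans (size_undup _) _; rewrite size_flatten /shape -map_comp sumnE big_map.
    by rewrite leqnn.
  apply/eqP; rewrite eqn_leq; apply/andP; split; apply: uniq_leq_size; rewrite ?undup_uniq //.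
  - by rewrite filter_uniq // sorted_ltn_uniq.
  - move=> x xN; rewrite mem_undup; have [R RI hR] := hN x xN.
    by apply/flatten_mapP; exists R => //; rewrite mem_filter hR.
  by move=> x; rewrite mem_undup => /flatten_mapP[R _]; rewrite mem_filter => /andP[].
apply: (@leq_trans (\sum_(R <- [seq R <- subs r I | 0 < size R]) w)).
  by rewrite !big_seq; apply: leq_sum => R /szext.
rewrite big_const_seq count_predT iter_addn_0 mulnC leq_mul2r; apply/orP; right.
rewrite size_filter; apply: leq_trans (count_size _ _) _.
elim: (r) (I) => [|n IHn] [|x Y] //=; first by rewrite expn_gt0.
by rewrite size_cat size_map expnS mul2n -addnn leq_add.
Qed.

End Clique.

(** * Dynamic programming along separator orders *)

Definition merge (A : seq nat) (B : fam) : fam :=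
  [seq b <- flatten [seq b <- B | hit A b] :: [seq b <- B | ~~ hit A b] | 0 < size b].
(** The connected components of [U] in the hypergraph [F]: starting from single vertices, each
    member merges the blocks that it meets. *)
Definition comps (F : fam) (U : seq nat) : fam :=
  foldl (fun B A => merge A B) [seq [:: x] | x <- U] F.
Definition balanced F U X := all (fun b => 2 * size b <= size U) (comps F (dif U X)).
Definition split_block F (W : fam) (U : seq nat) : fam :=
  if size U <= 1 then [:: U] else
  if ohead [seq X <- W | balanced F U X] is Some X then
    [seq [:: x] | x <- cap U X] ++ comps F (dif U X)
  else [:: U].
Definition split_all F W (B : fam) : fam := flatten [seq split_block F W U | U <- B].
(** Nested dissection: a balanced separator comes first, followed by the orders of the remaining
    components one after the other. Block sizes are halved, so [size V] rounds are more than
    enough. *)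
Definition dporder F W V := flatten (iter (size V) (split_all F W) [:: V]).

(** A state consists of the family still to be hit and the remaining budget. Partial solutions that
    agree on the current front leave literally the same list, so [undup] plays the role of the table
    of a dynamic program. *)
Definition branch x (s : fam * nat) : seq (fam * nat) :=
  (if 0 < s.2 then [:: ([seq A <- s.1 | x \notin A], s.2.-1)] else [::]) ++
  (if has (fun A => sub A [:: x]) s.1 then [::] else [:: ([seq dif A [:: x] | A <- s.1], s.2)]).
Definition dpstep x (st : seq (fam * nat)) := undup (flatten [seq branch x s | s <- st]).
Definition dpfold lim (st : option (seq (fam * nat))) x :=
  if st is Some st then
    if size (dpstep x st) <= lim then Some (dpstep x st) else None
  else None.
Definition dp lim F k (o : seq nat) : option bool :=
  if foldl (dpfold lim) (Some [:: (F, k)]) o is Some st then Some (has (fun s => nilp s.1) st)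
  else None.

Lemma dpfold_none lim o : foldl (dpfold lim) None o = None.
Proof. by elim: o. Qed.

Lemma hit_flatten A (B : fam) : hit A (flatten B) = has (hit A) B.
Proof. by elim: B => //= b B IHB; rewrite /hit has_cat -IHB. Qed.

Lemma flatten_nonempty (B : fam) : flatten [seq b <- B | 0 < size b] = flatten B.
Proof. by elim: B => //= b B IHB; case: b => [|x b] //=; rewrite IHB. Qed.

Lemma perm_merge A (B : fam) : perm_eq (flatten (merge A B)) (flatten B).
Proof.
rewrite flatten_nonempty /= -flatten_cat; apply: perm_flatten.
by apply/permPl; exact: perm_filterC.
Qed.

Lemma merge_flatten_nseq (U : seq nat) : flatten [seq [:: x] | x <- U] = U.
Proof. by elim: U => //= x U ->. Qed.

Lemma perm_comps F U : perm_eq (flatten (comps F U)) U.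
Proof.
rewrite /comps -{2}(merge_flatten_nseq U); elim: F [seq [:: x] | x <- U] => // A F IHF B /=.
exact: perm_trans (IHF _) (perm_merge A B).
Qed.

Lemma count_merge A A' (B : fam) : count (hit A') (merge A B) <= count (hit A') B.
Proof.
rewrite /merge; apply: leq_trans (leq_count_subseq _ (filter_subseq _ _)) _.
rewrite /= hit_flatten.
set T := [seq b <- B | hit A b].
have -> : count (hit A') B = count (hit A') T + count (hit A') [seq b <- B | ~~ hit A b].
  by rewrite -count_cat; apply/permP; rewrite perm_sym; apply/permPl; exact: perm_filterC.
by rewrite leq_add2r has_count; case: (count _ _).
Qed.

(** Once [A] has been processed it meets at most one block, and later merges never increase the
    number of blocks that it meets. *)
Lemma count_comps F U A : A \in F -> count (hit A) (comps F U) <= 1.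
Proof.
rewrite /comps; move: [seq [:: x] | x <- U]; elim: F => // A0 F IHF B.
rewrite inE => /orP[/eqP ->|/IHF] //=.
have le1 : count (hit A0) (merge A0 B) <= 1.
  rewrite /merge; apply: leq_trans (leq_count_subseq _ (filter_subseq _ _)) _.
  rewrite /= (_ : count _ [seq _ <- _ | _] = 0) ?addn0 ?leq_b1 //.
  by rewrite count_filter (eq_count (a2 := pred0)) ?count_pred0 // => b /=; rewrite andbN.
elim: F (merge A0 B) le1 {IHF} => //= D F IHF B' le1.
by apply: IHF; exact: leq_trans (count_merge _ _ _) le1.
Qed.

(** Components refine every labelling that is constant along members. A separator can therefore be
    certified by labels with small classes, without any reasoning about connectivity in the
    graph. *)
Lemma comps_const (kap : nat -> nat) (F : fam) (U : seq nat) :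
  (forall (A : seq nat) (x y : nat), A \in F -> x \in A -> y \in A -> x \in U -> y \in U -> kap x = kap y) ->
  forall (b : seq nat) (x y : nat), b \in comps F U -> x \in b -> y \in b -> kap x = kap y.
Proof.
move=> H.
suff main (G B : fam) : {subset G <= F} -> (forall (b : seq nat) x, b \in B -> x \in b -> x \in U) ->
   (forall (b : seq nat) x y, b \in B -> x \in b -> y \in b -> kap x = kap y) ->
   forall (b : seq nat) x y, b \in foldl (fun B A => merge A B) B G -> x \in b -> y \in b -> kap x = kap y.
  apply: main => // [b x|b x y] /mapP[z zU ->]; rewrite !inE; first by move/eqP->.
  by move=> /eqP -> /eqP ->.
elim: G B => //= A G IHG B GF BU cB; apply: IHG.
- by move=> D DG; apply: GF; rewrite inE DG orbT.
- move=> b x; rewrite mem_filter inE => /andP[_ /orP[/eqP ->|]]; last first.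
    by rewrite mem_filter => /andP[_]; exact: BU.
  by move=> /flattenP[b']; rewrite mem_filter => /andP[_]; exact: BU.
move=> b x y; rewrite mem_filter inE => /andP[_ /orP[/eqP ->|]]; last first.
  by rewrite mem_filter => /andP[_]; exact: cB.
move=> /flattenP[b1]; rewrite mem_filter => /andP[/hasP[a1 a1b1 a1A] b1B] xb1.
move=> /flattenP[b2]; rewrite mem_filter => /andP[/hasP[a2 a2b2 a2A] b2B] yb2.
rewrite (cB b1 x a1) // (cB b2 y a2) //; apply: (H A) => //.
- by apply: GF; rewrite mem_head.
- exact: BU a1b1.
- exact: BU a2b2.
Qed.

Lemma perm_split_block F W U : perm_eq (flatten (split_block F W U)) U.
Proof.
rewrite /split_block; case: ifP => _; first by rewrite /= cats0.
case: ohead => [X|]; last by rewrite /= cats0.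
rewrite flatten_cat merge_flatten_nseq.
apply: perm_trans (permEl (perm_filterC (fun x => x \in X) U)).
by rewrite perm_cat2l perm_comps.
Qed.

Lemma perm_split_all F W B : perm_eq (flatten (split_all F W B)) (flatten B).
Proof.
elim: B => // b B IHB; rewrite /split_all [flatten _]/= flatten_cat.
by apply: perm_cat => //; exact: perm_split_block.
Qed.

Lemma perm_iter_split F W n B : perm_eq (flatten (iter n (split_all F W) B)) (flatten B).
Proof.
elim: n => // n IHn; rewrite iterS; exact: perm_trans (perm_split_all _ _ _) IHn.
Qed.

Lemma perm_dporder F W V : perm_eq (dporder F W V) V.
Proof. by apply: perm_trans (perm_iter_split _ _ _ _) _; rewrite /= cats0. Qed.

Lemma iter_split_cat F W n B1 B2 :
  iter n (split_all F W) (B1 ++ B2) = iter n (split_all F W) B1 ++ iter n (split_all F W) B2.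
Proof. by elim: n => // n IHn; rewrite !iterS IHn /split_all map_cat flatten_cat. Qed.

Lemma iter_split_flat F W n B :
  iter n (split_all F W) B = flatten [seq iter n (split_all F W) [:: b] | b <- B].
Proof.
elim: B => [|b B IHB]; first by elim: n => //= n ->.
by rewrite -cat1s iter_split_cat IHB.
Qed.

Lemma iter_split_small F W n U : size U <= 1 -> iter n (split_all F W) [:: U] = [:: U].
Proof.
by move=> le1; elim: n => // n IHn; rewrite iterS IHn /split_all /= /split_block le1.
Qed.

Definition front (F : fam) (P L : seq nat) :=
  [seq x <- P | has (fun A => (x \in A) && hit L A) F].

Lemma size_front_cat F P1 P2 L : size (front F (P1 ++ P2) L) = size (front F P1 L) + size (front F P2 L).
Proof. by rewrite /front filter_cat size_cat. Qed.

Lemma size_front F P L : size (front F P L) <= size P.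
Proof. by rewrite size_filter count_size. Qed.

Lemma cat_splits (T : Type) (s1 s2 P L : seq T) : s1 ++ s2 = P ++ L ->
  (exists Q, s1 = P ++ Q /\ L = Q ++ s2) \/ (exists Q, P = s1 ++ Q /\ s2 = Q ++ L).
Proof.
elim: s1 P => [|x s1 IHs] [|y P] /=; try by move=> ->; [left; exists [::]|right; exists [::]] || idtac.
- by move=> ->; right; exists [::].
- by move=> ->; right; exists (y :: P).
- by move=> <-; left; exists (x :: s1).
move=> [-> /IHs[[Q [-> ->]]|[Q [-> ->]]]]; [left|right]; by exists Q.
Qed.

Lemma flatten_splits (T : Type) (B : seq (seq T)) P L : flatten B = P ++ L ->
  (P = [::] \/ L = [::]) \/ exists B1 b1 b2 B2,
  [/\ B = B1 ++ (b1 ++ b2) :: B2, P = flatten B1 ++ b1 & L = b2 ++ flatten B2].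
Proof.
elim: B P => [|b B IHB] P /=; first by case: P => //=; left; left.
move=> /cat_splits[[Q [-> ->]]|[Q [-> E]]].
  by right; exists [::], P, Q, B.
case: (IHB _ E) => [[Q0|->]|[B1 [b1 [b2 [B2 [-> -> ->]]]]]].
- by rewrite Q0 in E *; right; exists [::], b, [::], B; split; rewrite ?cats0 ?E.
- by left; right.
by right; exists (b :: B1), b1, b2, B2; rewrite /= catA.
Qed.

Section Front.
Variables (F W : fam) (V : seq nat) (l : nat).
Hypotheses (Wl : forall X : seq nat, X \in W -> size X <= l)
 (sep : forall U : seq nat, uniq U -> {subset U <= V} -> exists2 X : seq nat, X \in W & exists kap : nat -> nat,
   (forall (A : seq nat) x y, A \in F -> x \in A -> y \in A -> x \in dif U X -> y \in dif U X -> kap x = kap y)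
   /\ forall c, 2 * count (fun x => kap x == c) (dif U X) <= size U).

(** Induction on the number of halvings. A prefix consists of at most [l] separator vertices, some
    complete components and a prefix of one further component. The complete ones share no member
    with what follows, and the last one is handled by induction. *)
Lemma front_bound d n U P L : d <= n -> size U < 2 ^ d.+1 -> uniq U -> {subset U <= V} ->
  flatten (iter n (split_all F W) [:: U]) = P ++ L -> size (front F P L) <= d * l.
Proof.
elim: d n U P L => [|d IHd] n U P L dn zU uU UV.
  rewrite iter_split_small /= ?cats0; last by rewrite -ltnS.
  move=> E; have : size P + size L <= 1 by rewrite -size_cat -E -ltnS.
  case: L E => [|y L] _; last by case: P => [|x P] //=; lia.
  by move=> _; rewrite /front (eq_filter (a2 := pred0)) ?filter_pred0 // => x /=; apply/hasPn => A _; rewrite /hit has_pred0 andbF || rewrite (eq_has (a2 := pred0)) ?has_pred0 ?andbF.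
have [U1|U1] := leqP (size U) 1.
  move: (IHd n.-1 U P L) => IH; rewrite iter_split_small // => E.
  apply: leq_trans (IH _ _ _ _ _) _ => //; first by lia.
  - by apply: leq_ltn_trans U1 _; rewrite -[1]/(2 ^ 0) ltn_exp2l.
  - by rewrite iter_split_small.
  by rewrite leq_mul2r leqnSn orbT.
case: n dn => // n dn; rewrite iterSr /split_all /= cats0 /split_block leqNgt U1 /=.
have [X XW [kap [Hk Hc]]] := sep uU UV.
have bX : balanced F U X.
  apply/allP => b bB; case: b bB => [|x b] bB; first by rewrite muln0.
  apply: leq_trans (Hc (kap x)); rewrite leq_mul2l /=.
  have := permP (perm_comps F (dif U X)) (fun y => kap y == kap x) => <-.
  apply: (@leq_trans (count (fun y => kap y == kap x) (x :: b))).
    rewrite (eq_in_count (a2 := predT)) ?count_predT // => y yb.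
    by rewrite (comps_const Hk bB yb (mem_head _ _)) eqxx.
  elim: (comps _ _) bB => // b' B IHB; rewrite inE [flatten _]/= count_cat.
  case/orP=> [/eqP <-|/IHB le]; first exact: leq_addr.
  exact: leq_trans le (leq_addl _ _).
(* The order takes the first balanced candidate of the list, which need not be the one that [sep]
   supplies. *)
have [Y [-> YW bY]] : exists Y : seq nat, [/\ ohead [seq X <- W | balanced F U X] = Some Y, Y \in W & balanced F U Y].
  have := mem_filter (balanced F U) X W; rewrite bX XW.
  case E : [seq X <- W | balanced F U X] => [|Y s]; rewrite // => _; exists Y.
  have : Y \in [seq X <- W | balanced F U X] by rewrite E mem_head.
  by rewrite mem_filter => /andP[? ?]; split.
rewrite iter_split_cat flatten_cat.
set o1 := flatten (iter n _ _); set o2 := flatten _ => E.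
have zo1 : size o1 <= l.
  rewrite (perm_size (perm_iter_split _ _ _ _)) merge_flatten_nseq.
  apply: leq_trans (Wl YW); apply: uniq_leq_size; first by rewrite filter_uniq.
  by move=> x; rewrite mem_filter => /andP[].
rewrite mulSn; case: (cat_splits E) => [[Q [E1 _]]|[Q [-> E2]]].
  apply: leq_trans (size_front _ _ _) _; apply: leq_trans (leq_trans _ zo1) (leq_addr _ _).
  by rewrite E1 size_cat leq_addr.
rewrite size_front_cat leq_add //; first exact: leq_trans (size_front _ _ _) zo1.
move: E2; rewrite /o2 iter_split_flat.
have -> : flatten (flatten [seq iter n (split_all F W) [:: b] | b <- comps F (dif U Y)]) =
  flatten [seq flatten (iter n (split_all F W) [:: b]) | b <- comps F (dif U Y)].
  by elim: (comps _ _) => //= b B <-; rewrite flatten_cat.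
move=> /flatten_splits[[->|->]|] //.
  by rewrite /front (eq_filter (a2 := pred0)) ?filter_pred0 // => x /=; apply/hasPn => A _; rewrite /hit (eq_has (a2 := pred0)) ?has_pred0 ?andbF.
(* The cut falls inside the order of one component [C], as [b1] and [b2]; the components before and
   after it must be shown to contribute nothing. *)
move=> [B1 [b1 [b2 [B2 [EB -> ->]]]]].
have [C1 [C [C2 [EC E1 E2 E3]]]] : exists (C1 : fam) (C : seq nat) (C2 : fam), [/\ comps F (dif U Y) = C1 ++ C :: C2,
   B1 = [seq flatten (iter n (split_all F W) [:: b]) | b <- C1],
   b1 ++ b2 = flatten (iter n (split_all F W) [:: C]) &
   B2 = [seq flatten (iter n (split_all F W) [:: b]) | b <- C2]].
  move: EB; set g := fun b => _; set B := comps _ _ => EB.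
  have zB : size B1 < size B by rewrite -(size_map g B) EB size_cat /= addnS ltnS leq_addr.
  exists (take (size B1) B), (nth [::] B (size B1)), (drop (size B1).+1 B).
  rewrite -drop_nth // cat_take_drop map_take map_drop EB take_size_cat //.
  have -> : flatten (iter n (split_all F W) [:: nth [::] B (size B1)]) = g (nth [::] B (size B1)) by [].
  rewrite -(nth_map [::] [::] g) // EB nth_cat ltnn subnn /=; split=> //.
  have -> : (size B1).+1 = size (rcons B1 (b1 ++ b2)) by rewrite size_rcons.
  by rewrite -cat_rcons drop_size_cat.
have EUC : perm_eq (C ++ flatten (C1 ++ C2)) (dif U Y).
  apply: perm_trans (perm_comps F (dif U Y)); rewrite EC !flatten_cat /= perm_sym.
  by rewrite perm_catCA.
have uC : uniq (C ++ flatten (C1 ++ C2)) by rewrite (perm_uniq EUC) filter_uniq.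
have mo D : flatten (iter n (split_all F W) [:: D]) =i D.
  by move=> x; rewrite (perm_mem (perm_iter_split _ _ _ _)) /= cats0.
have hitC (A : seq nat) x y (C' : seq nat) : A \in F -> x \in A -> y \in A -> C' \in C1 ++ C2 -> x \in C' -> y \in C -> False.
  move=> AF xA yA C'in xC' yC; have := @count_comps F (dif U Y) A AF.
  have p : perm_eq (C1 ++ C :: C2) (C :: (C1 ++ C2)) by rewrite -cat1s perm_catCA.
  rewrite EC (permP p) /=; have -> : hit A C by apply/hitP; exists y.
  have : has (hit A) (C1 ++ C2) by apply/hasP; exists C' => //; apply/hitP; exists x.
  by rewrite has_count; case: (count _ _).
have mB1 x : x \in flatten B1 -> exists2 C' : seq nat, C' \in C1 & x \in C'.
  by rewrite E1 => /flatten_mapP[C' C'1]; rewrite mo; exists C'.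
have mB2 x : x \in flatten B2 -> exists2 C' : seq nat, C' \in C2 & x \in C'.
  by rewrite E3 => /flatten_mapP[C' C'1]; rewrite mo; exists C'.
have mb x : x \in b1 ++ b2 -> x \in C by rewrite E2 mo.
have hitCC (A : seq nat) x y (C' C'' : seq nat) : A \in F -> x \in A -> y \in A -> C' \in C1 -> C'' \in C2 -> x \in C' -> y \in C'' -> False.
  move=> AF xA yA C'1 C''2 xC yC; have := @count_comps F (dif U Y) A AF.
  rewrite EC -cat_rcons count_cat.
  have : has (hit A) (rcons C1 C).
    by apply/hasP; exists C'; [rewrite mem_rcons inE C'1 orbT|apply/hitP; exists x].
  have : has (hit A) C2 by apply/hasP; exists C'' => //; apply/hitP; exists y.
  by rewrite !has_count; case: (count _ _) (count _ _) => [|m] // [|m'] //; rewrite addnS.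
rewrite size_front_cat (_ : size (front F (flatten B1) _) = 0) ?add0n; last first.
  apply/eqP; rewrite size_eq0 -(negbK (_ == _)) -has_filter; apply/hasPn => x /mB1[C' C'1 xC'].
  apply/hasPn => A AF; apply/negP => /andP[xA /hasP[y yA]]; rewrite mem_cat => /orP[yb|/mB2[C'' C''2 yC'']].
    apply: (hitC A x y C') => //; first by rewrite mem_cat C'1.
    by apply: mb; rewrite mem_cat yb orbT.
  exact: (hitCC A x y C' C'').
have ub : uniq (b1 ++ b2).
  rewrite E2 (perm_uniq (perm_iter_split _ _ _ _)) /= cats0; by move: uC; rewrite cat_uniq => /andP[].
apply: (@leq_trans (size (front F b1 b2))).
  rewrite /front !size_filter -!size_filter; apply: uniq_leq_size.
    by rewrite filter_uniq //; move: ub; rewrite cat_uniq => /andP[].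
  move=> x; rewrite !mem_filter => /andP[hx xb1]; rewrite xb1 andbT; move: hx.
  move=> /hasP[A AF /andP[xA /hasP[y yA]]]; rewrite mem_cat => /orP[yb|/mB2[C'' C''2 yC'']].
    by apply/hasP; exists A => //; rewrite xA; apply/hasP; exists y.
  exfalso; apply: (hitC A y x C'') => //; first by rewrite mem_cat C''2 orbT.
  by apply: mb; rewrite mem_cat xb1.
have CU x : x \in C -> x \in U.
  move=> xC; have : x \in dif U Y by rewrite -(perm_mem EUC) mem_cat xC.
  by rewrite mem_dif => /andP[].
apply: (IHd n C) => //.
- move/allP: bY => /(_ C); rewrite EC mem_cat mem_head orbT => /(_ isT) zC.
  by rewrite -(ltn_pmul2l (ltn0Sn 1)) -expnS; exact: leq_ltn_trans zC zU.
- by move: uC; rewrite cat_uniq => /andP[].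
- by move=> x /CU/UV.
Qed.

End Front.

Section DP.
Variables (F : fam) (k : nat).

(** Members inside [P] are left out even if [T] misses them. For the choices kept by [branch] they
    are hit anyway, and leaving them out makes the residual family depend only on the trace of [T]
    on [bd P]. *)
Definition resid (P T : seq nat) : fam := [seq dif A P | A <- F & ~~ sub A P && ~~ hit T A].
Definition bd (P : seq nat) := [seq x <- undup P | has (fun A => (x \in A) && ~~ sub A P) F].

Lemma resid_bd P T : {subset T <= P} -> resid P T = resid P (cap (bd P) T).
Proof.
move=> TP; congr map; apply: eq_in_filter => A AF; case: (boolP (sub A P)) => //= nAP.
congr (~~ _); apply/hitP/hitP => [[x xA xT]|[x xA xT]]; exists x => //; last first.
  by move: xT; rewrite mem_cap => /andP[].
rewrite mem_cap xT andbT mem_filter mem_undup TP // andbT.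
by apply/hasP; exists A; rewrite // xA.
Qed.

Definition reach (P : seq nat) (st : seq (fam * nat)) := forall s, s \in st ->
  s.2 <= k /\ exists2 T : seq nat, {subset T <= P} & s.1 = resid P T.

Lemma reach_step P st x : x \notin P -> reach P st -> reach (rcons P x) (dpstep x st).
Proof.
move=> xP H s; rewrite mem_undup => /flatten_mapP[[R b] /H[/= bk [T TP ->]]].
have xT : x \notin T by apply: contra xP => /TP.
have subr A : sub A (rcons P x) = all (fun y => (y \in P) || (y == x)) A.
  by apply: eq_all => y; rewrite mem_rcons inE orbC.
have dif_rcons A : dif A (rcons P x) = dif (dif A P) [:: x].
  rewrite /dif -filter_predI; apply: eq_filter => y /=.
  by rewrite mem_rcons !inE negb_or.
rewrite /branch mem_cat /= => /orP[].
  case: ifP => // b0; rewrite inE => /eqP ->; split=> /=; first by lia.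
  exists (x :: T).
    by move=> y; rewrite mem_rcons !inE => /orP[->//|/TP ->]; rewrite orbT.
  have nsub A : x \notin A -> sub A (rcons P x) = sub A P.
    move=> xA; rewrite subr; apply: eq_in_all => y yA.
    by case: eqP => [yx|_]; rewrite ?orbF // -yx yA in xA *.
  rewrite /resid filter_map -filter_predI.
  have -> : [seq A <- F | predI (preim (dif^~ P) (fun A => x \notin A))
       (fun A => ~~ sub A P && ~~ hit T A) A] =
     [seq A <- F | ~~ sub A (rcons P x) && ~~ hit (x :: T) A].
    apply: eq_filter => A /=; rewrite mem_dif xP andbT.
    have -> : hit (x :: T) A = (x \in A) || hit T A.
      apply/hitP/orP => [[y yA]|[xA|/hitP[y yA yT]]].
      - by rewrite inE => /orP[/eqP <-|yT]; [left|right; apply/hitP; exists y].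
      - by exists x; rewrite ?mem_head.
      - by exists y; rewrite // inE yT orbT.
    case xA: (x \in A) => /=; first by rewrite andbF.
    by rewrite nsub // xA.
  apply/eq_in_map => A; rewrite mem_filter => /andP[/andP[_ nh] _].
  rewrite dif_rcons; symmetry; apply/all_filterP/allP => y yA; rewrite inE.
  apply: contra nh => /eqP yx; apply/hitP; exists x; rewrite ?mem_head //.
  by move: yA; rewrite mem_dif yx => /andP[].
case: ifP => // /negbT /hasPn nh; rewrite inE => /eqP ->; split=> //=; exists T.
  by move=> y /TP yP; rewrite mem_rcons inE yP orbT.
have map2 (G : fam) : [seq dif A [:: x] | A <- [seq dif A P | A <- G]] = [seq dif A (rcons P x) | A <- G].
  by elim: G => //= A G ->; rewrite dif_rcons.
rewrite /resid map2; congr map; apply: eq_in_filter => A AF; case: (boolP (hit T A)) => [|nT]; first by rewrite !andbF.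
rewrite !andbT; congr negb; apply/idP/idP => [AP|]; last first.
  move=> Ax; case: (boolP (sub A P)) => // nAP.
  have AR : dif A P \in resid P T by apply: map_f; rewrite mem_filter nAP nT.
  case/negP: (nh _ AR); apply/subP => y; rewrite mem_dif inE => /andP[yA yP].
  by have := subP _ _ Ax y yA; rewrite mem_rcons inE (negPf yP) orbF.
by apply/subP => y /(subP _ _ AP) yP; rewrite mem_rcons inE yP orbT.
Qed.

Lemma size_subs n A : size (subs n A) <= 2 ^ size A.
Proof.
elim: n A => [|n IHn] [|x A] //=; first by rewrite expn_gt0.
by rewrite size_cat size_map expnS mul2n -addnn leq_add.
Qed.

Lemma size_reach P st : uniq st -> reach P st -> size st <= 2 ^ size (bd P) * k.+1.
Proof.
move=> ust H.
pose all := [seq (resid P T, b) | T <- subs (size (bd P)) (bd P), b <- iota 0 k.+1].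
apply: (@leq_trans (size all)); last first.
  by rewrite size_allpairs size_iota leq_mul2r size_subs orbT.
apply: uniq_leq_size => // -[R b] /H[/= bk [T TP ->]].
rewrite (resid_bd TP); apply: (allpairs_f (fun T b => (resid P T, b))).
  apply: mem_subs => //; exact: filter_subseq.
by rewrite mem_iota.
Qed.

Lemma dp_some lim o : uniq o -> (forall A : seq nat, A \in F -> 0 < size A) ->
  (forall P L, o = P ++ L -> 2 ^ size (bd P) * k.+1 <= lim) ->
  dp lim F k o != None.
Proof.
move=> uo F0 H.
rewrite /dp; suff [st ->] : exists st, foldl (dpfold lim) (Some [:: (F, k)]) o = Some st by [].
suff main P L st : o = P ++ L -> reach P st ->
    exists st', foldl (dpfold lim) (Some st) L = Some st'.
  apply: (main [::] o [:: (F, k)]) => // s; rewrite inE => /eqP -> /=; split=> //; exists [::] => //.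
  rewrite /resid (_ : [seq A <- F | _] = F); last first.
    by apply/all_filterP/allP => -[|a A] /F0 //= _; rewrite /hit (eq_has (a2 := pred0)) ?has_pred0.
  by elim: (F) => //= A G <-; congr cons; symmetry; apply/all_filterP/allP.
elim: L P st => [|x L IHL] P st oE rst; first by exists st.
rewrite /=.
have r' : reach (rcons P x) (dpstep x st).
  apply: reach_step => //; move: uo; rewrite oE cat_uniq => /and3P[_ /hasPn/(_ x)].
  by rewrite mem_head => /(_ isT).
have E : o = rcons P x ++ L by rewrite cat_rcons.
rewrite (leq_trans (size_reach (undup_uniq _) r') (H _ _ E)).
exact: IHL E r'.
Qed.

Lemma dp_true lim o : dp lim F k o = Some true -> exists2 S, size S <= k & hits S F.
Proof.
rewrite /dp; case E: foldl => [st|] // [/hasP[[R b] Rst /nilP/= R0]].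
suff main : forall st0 s, foldl (dpfold lim) (Some st0) o = Some st -> s \in st ->
   forall S, size S <= s.2 -> hits S s.1 ->
   exists s0, s0 \in st0 /\ exists2 S, size S <= s0.2 & hits S s0.1.
  have h0 : hits [::] R by rewrite R0.
  have [[F' k'] [/= st0 H]] := main [:: (F, k)] (R, b) E Rst [::] (leq0n _) h0.
  by move: st0 H; rewrite inE => /eqP[-> ->].
elim: o {E Rst R0 R b} => [|x o IHo] st0 s /=; first by move=> [->] sst S hs zs; exists s; split=> //; exists S.
case: ifP => _; last by rewrite dpfold_none.
move=> /IHo H /H{}H S zS hS; have [s1 [s1st [S1 z1 h1]]] := H S zS hS.
move: s1st; rewrite mem_undup => /flatten_mapP[[R b] Rst0].
rewrite /branch mem_cat /= => /orP[].
  case: ifP => // b0; rewrite inE => /eqP s1E; exists (R, b); split=> //; exists (x :: S1) => /=.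
    by move: z1; rewrite s1E /=; lia.
  apply/allP => A AR; case xA: (x \in A); first by apply/hitP; exists x; rewrite ?mem_head.
  move: h1; rewrite s1E => /allP/(_ A); rewrite mem_filter xA AR => /(_ isT)/hitP[y yA yS].
  by apply/hitP; exists y; rewrite // inE yS orbT.
case: ifP => // _; rewrite inE => /eqP s1E; exists (R, b); split=> //; exists S1; first by rewrite s1E in z1.
apply/allP => A AR; move: h1; rewrite s1E => /allP/(_ (dif A [:: x])).
rewrite (map_f (fun A => dif A [:: x]) AR) => /(_ isT)/hitP[y]; rewrite mem_dif => /andP[yA _] yS; by apply/hitP; exists y.

Qed.

Lemma dp_false lim o S : (forall A : seq nat, A \in F -> sub A o) ->
  dp lim F k o = Some false -> size S <= k -> ~~ hits S F.
Proof.
move=> Fo; rewrite /dp; case E: foldl => [st|] // [/hasPn nst] Sk; apply/negP => hS.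
suff main : forall st0 s0 S, foldl (dpfold lim) (Some st0) o = Some st -> s0 \in st0 ->
   size S <= s0.2 -> hits S s0.1 -> (forall A : seq nat, A \in s0.1 -> sub A o) ->
   exists2 s, s \in st & nilp s.1.
  have [s /nst/negP nn sst] := main _ _ S E (mem_head _ _) Sk hS Fo; exact: nn.
elim: o {E Fo hS Sk S nst} => [|x o IHo] st0 [R b] S /=.
  move=> [->] sst _ hS So; exists (R, b) => //=; case: (R) hS So => // A R' /= /andP[hA _] So.
  have := So A (mem_head _ _); case: (A) hA => // y A' _ /subP/(_ y); by rewrite mem_head in_nil => /(_ isT).
case: ifP => _; last by rewrite dpfold_none.
move=> E Rst zS hS So; have [xS|xS] := boolP (x \in S).
  have b0 : 0 < b by case: (S) xS zS => //= *; lia.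
  apply: (IHo _ ([seq A <- R | x \notin A], b.-1) (dif S [:: x]) E) => /=.
  - rewrite mem_undup; apply/flatten_mapP; exists (R, b) => //.
    by rewrite /branch /= b0 mem_cat mem_head.
  - have : size (dif S [:: x]) < size S.
      rewrite size_filter -(count_predC (fun y => y \notin [:: x]) S) -addn1 leq_add2l -has_count.
      by apply/hasP; exists x; rewrite //= inE eqxx.
    by move: zS; rewrite /=; move: (size S) (size _) => n m; lia.
  - apply/allP => A; rewrite mem_filter => /andP[xA AR].
    have /hitP[y yA yS] := allP hS A AR; apply/hitP; exists y => //.
    by rewrite mem_dif yS inE; apply: contraNneq xA => <-.
  move=> A; rewrite mem_filter => /andP[xA AR]; apply/subP => y yA.
  have := subP _ _ (So A AR) y yA; rewrite inE => /orP[/eqP yx|//].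
  by rewrite -yx yA in xA.
apply: (IHo _ ([seq dif A [:: x] | A <- R], b) S E) => //=.
- rewrite mem_undup; apply/flatten_mapP; exists (R, b) => //.
  rewrite /branch mem_cat /= (_ : has _ R = false) ?mem_head ?orbT //.
  apply/negbTE/hasPn => A AR; have /hitP[y yA yS] := allP hS A AR.
  apply/negP => /subP/(_ y yA); rewrite inE => /eqP yx; by rewrite -yx yS in xS.
- apply/allP => _ /mapP[A AR ->]; have /hitP[y yA yS] := allP hS A AR.
  apply/hitP; exists y => //; rewrite mem_dif yA inE.
  by apply: contraNneq xS => <-.
move=> _ /mapP[A AR ->]; apply/subP => y; rewrite mem_dif inE => /andP[yA yx].
by have := subP _ _ (So A AR) y yA; rewrite inE (negPf yx).
Qed.

End DP.

(** With [d] the integer part of the binary logarithm of [size V], fronts have at most [d * l]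
    vertices, and [2 ^ (d * l)] is at most [(size V).+1 ^ l]. The factor [k.+1] counts the
    budgets. *)
Lemma dp_ok (F W : fam) V k l lim : uniq V ->
  (forall A : seq nat, A \in F -> 0 < size A) -> (forall A : seq nat, A \in F -> sub A V) ->
  (forall X : seq nat, X \in W -> size X <= l) ->
  (forall U : seq nat, uniq U -> {subset U <= V} -> exists2 X : seq nat, X \in W &
    exists kap : nat -> nat,
   (forall (A : seq nat) x y, A \in F -> x \in A -> y \in A -> x \in dif U X -> y \in dif U X -> kap x = kap y)
   /\ forall c, 2 * count (fun x => kap x == c) (dif U X) <= size U) ->
  (size V).+1 ^ l * k.+1 <= lim ->
  dp lim F k (dporder F W V) != None.
Proof.
move=> uV F0 FV Wl sep le; have pV := perm_dporder F W V.
have uo : uniq (dporder F W V) by rewrite (perm_uniq pV).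
apply: dp_some => // P L oE; apply: leq_trans le; rewrite leq_mul2r; apply/orP; right.
have [d [V2 d2]] : exists d, size V < 2 ^ d.+1 /\ 2 ^ d <= (size V).+1.
  exists (trunc_log 2 (size V)); split; first exact: trunc_log_ltn.
  by case: (posnP (size V)) => [->|V0] //; apply: leqW; exact: trunc_logP.
apply: (@leq_trans (2 ^ (d * l))); last first.
  by rewrite expnM; case: (l) => // l'; rewrite leq_exp2r.
rewrite leq_exp2l //; apply: (@leq_trans (size (front F P L))); last first.
  have dn : d <= size V.
    case: (d) d2 => // d' d2; rewrite -ltnS; apply: leq_trans d2; exact: ltn_expl.
  exact: (front_bound Wl sep dn V2 uV _ oE).
apply: uniq_leq_size; first by rewrite filter_uniq // undup_uniq.
move=> x; rewrite !mem_filter mem_undup => /andP[/hasP[A AF /andP[xA nAP]] ->]; rewrite andbT.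
apply/hasP; exists A => //; rewrite xA /=.
case/allPn: nAP => y yA yP; apply/hitP; exists y => //.
have := subP _ _ (FV A AF) y yA; rewrite -(perm_mem pV) oE mem_cat (negPf yP) //.
Qed.

(** * Balanced separators from tree decompositions *)

Section Tree.
Variable T : sgraph.
Hypothesis treeT : is_tree T.

Definition avoid (t : 'I_(order T)) := [rel a b : 'I_(order T) | [&& adj a b, a != t & b != t]].

Lemma avoid_sym t : connect_sym (avoid t).
Proof.
apply: sym_connect_sym => a b /=; rewrite adj_sym; congr (_ && _); exact: andbC.
Qed.

Lemma avoid_neq t x y : connect (avoid t) x y -> x != t -> y != t.
Proof.
move=> /connectP[p pth ->] {y}; elim: p x pth => //= y p IHp x /andP[/and3P[_ _ yt] pth] _.
exact: IHp.
Qed.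

(** A walk between the ends of an edge that does not use the edge contains a path, which the edge
    closes to a cycle. *)
Lemma bridge (t t' : 'I_(order T)) : adj t t' ->
  ~~ connect [rel a b : 'I_(order T) | adj a b && ~~ (((a == t) && (b == t')) || ((a == t') && (b == t)))] t t'.
Proof.
move=> att; have [_ _ nocyc] := treeT; apply/negP => /connectP[p0 pth0].
have tt' : t != t' by apply: contraTneq att => <-; rewrite adj_irr.
case: (shortenP pth0) => p pth up _ E; apply: (nocyc (t :: p)).
  case: p pth E {up} => [|x [|y p]] //=; first by move=> _ E; rewrite E eqxx in tt'.
  by move=> /andP[/andP[_ h] _] E; move: h; rewrite -E !eqxx.
rewrite /ucycle up andbT /cycle rcons_path -E adj_sym att andbT.
by apply: sub_path pth => a b /andP[].
Qed.

(* In a tree with a heavy component at every node, going from a node to its heavy component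
   would shrink that component for ever. *)
Lemma heavy_exclusion (h : 'I_(order T) -> 'I_(order T)) :
  (forall t, h t != t) ->
  (forall t t', exists s, connect (avoid t) s (h t) && connect (avoid t') s (h t')) -> False.
Proof.
move=> ht hh; have [T0 con _] := treeT.
pose C t := [set s | connect (avoid t) s (h t)].
pose t := [arg min_(t < Ordinal T0) #|C t|].
have tmin t' : #|C t| <= #|C t'| by rewrite /t; case: arg_minnP => // u _; apply.
have /connectP[p0 pth0] := con t (h t).
case: (shortenP pth0) => p pth up _ E.
case: p pth up E => [|t' p] /=; first by move=> _ _ E; have := ht t; rewrite E eqxx.
move=> /andP[att' pth] /and3P[tp _ _] E.
have ct' : connect (avoid t) t' (h t).
  apply/connectP; exists p => //; move: tp; rewrite inE negb_or => /andP[].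
  elim: p t' pth {att' E} => //= b p IHp a /andP[ab pth] ta; rewrite inE negb_or => /andP[tb tp].
  by rewrite ab eq_sym ta eq_sym tb /= IHp.
have t't : t' != t by move: tp; rewrite inE negb_or eq_sym => /andP[].
have [s /andP[sh sh']] := hh t t'.
(* Otherwise [t] reaches [s] while avoiding [t'], and [s] reaches [t'] while avoiding [t]. Neither
   walk uses the edge between [t] and [t'], which contradicts [bridge]. *)
have tC' : t \notin C t'.
  rewrite inE; apply/negP => th'; case/negP: (bridge att').
  apply: (connect_trans (y := s)); [have : connect (avoid t') t s|have : connect (avoid t) s t'].
  - by apply: connect_trans th' _; rewrite avoid_sym.
  - apply: connect_sub => a b /and3P[ab a1 b1]; apply: connect1 => /=.
    by rewrite ab (negPf a1) (negPf b1) andbF.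
  - by apply: connect_trans sh _; rewrite avoid_sym.
  apply: connect_sub => a b /and3P[ab a1 b1]; apply: connect1 => /=.
  by rewrite ab (negPf a1) (negPf b1) andbF.
have : C t' \proper C t.
  apply/properP; split; last first.
    exists t'; rewrite inE //; apply/negP; rewrite avoid_sym => /avoid_neq/(_ (ht t')).
    by rewrite eqxx.
  apply/fintype.subsetP => x; rewrite !inE => xh'.
  apply: connect_trans sh.
  have /connectP[q] : connect (avoid t') x s by apply: connect_trans xh' _; rewrite avoid_sym.
  elim: q x xh' => [|y q IHq] x xh' /=; first by move=> _ ->.
  move=> /andP[xy pth'] sE.
  have yh' : connect (avoid t') y (h t').
    by apply: connect_trans xh'; apply: connect1; move: xy => /=; rewrite adj_sym => /and3P[-> -> ->].
  apply: connect_trans (IHq y yh' pth' sE); apply: connect1.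
  have nt z : connect (avoid t') z (h t') -> z != t.
    by move=> zh; apply: contraNneq tC' => <-; rewrite inE.
  by move: xy => /= /and3P[-> _ _]; rewrite !nt.
by move/proper_card; rewrite ltnNge tmin.
Qed.

End Tree.

Lemma heavy_meet n i a b u : n + i = a + b -> n <= u -> u < 2 * a -> u < 2 * b -> 0 < i.
Proof. lia. Qed.

(** Outside the bag of [t], a vertex is labelled by the component of the tree without [t] that
    contains its bags. If every node had a label carried by more than half of [U], any two of these
    majorities would share a vertex, and [heavy_exclusion] would apply. *)
Lemma balanced_bag (G T : sgraph) (bag : 'I_(order T) -> {set 'I_(order G)}) (U : {set 'I_(order G)}) :
  tree_decomposition bag -> exists t (kap : 'I_(order G) -> nat),
  (forall u v, adj u v -> u \notin bag t -> v \notin bag t -> kap u = kap v) /\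
  forall c, 2 * #|[set u in U | (u \notin bag t) && (kap u == c)]| <= #|U|.
Proof.
move=> [treeT bagV bagE bagC].
have bagV' v : exists t, v \in bag t by exact: bagV.
pose s v := xchoose (bagV' v); have sP v : v \in bag (s v) by exact: xchooseP (bagV' v).
pose kap t v : nat := fingraph.root (avoid t) (s v).
have kapC t v a : v \notin bag t -> v \in bag a -> connect (avoid t) (s v) a.
  move=> vt va; apply: connect_sub (bagC v _ _ (sP v) va) => x y /and3P[xy vx vy].
  apply: connect1; rewrite /= xy /=; apply/andP; split; by apply: contraNneq vt => <-.
have kapE t u v : adj u v -> u \notin bag t -> v \notin bag t -> kap t u = kap t v.
  move=> /bagE[a /andP[ua va]] ut vt; rewrite /kap; congr nat_of_ord.
  apply/(fingraph.rootP (@avoid_sym T t)); apply: connect_trans (kapC _ _ _ ut ua) _.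
  by rewrite avoid_sym; exact: kapC.
pose cl t c := [set u in U | (u \notin bag t) && (kap t u == c)].
case: (pickP (fun t => [forall c : 'I_(order T), 2 * #|cl t c| <= #|U|])) => [t /forallP H|H].
  exists t, (kap t); split; first exact: kapE.
  move=> c; have [lt|ge] := ltnP c (order T); first exact: (H (Ordinal lt)).
  rewrite (_ : [set _ in _ | _] = finset.set0) ?cards0 //; apply/setP => u; rewrite !inE.
  by apply/negbTE/negP => /and3P[_ _ /eqP E]; move: ge; rewrite -E leqNgt ltn_ord.
have H' t : exists c : 'I_(order T), ~~ (2 * #|cl t c| <= #|U|).
  by apply/existsP; rewrite -negb_forall H.
pose h t := xchoose (H' t).
have hP t : #|U| < 2 * #|cl t (h t)| by rewrite ltnNge; exact: xchooseP (H' t).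
have clh t u : u \in cl t (h t) -> [/\ u \in U, u \notin bag t & connect (avoid t) (s u) (h t)].
  rewrite inE => /and3P[uU ut /eqP/val_inj <-]; split=> //; exact: connect_root.
exfalso; apply: (@heavy_exclusion T treeT h) => [t|t t'].
  have /card_gt0P[u /clh[_ ut]] : 0 < #|cl t (h t)|.
    by have := hP t; case: #|cl t (h t)|.
  by move/avoid_neq; apply; apply: contraNneq ut => <-.
suff /finset.set0Pn[u] : cl t (h t) :&: cl t' (h t') != finset.set0.
  by rewrite inE => /andP[/clh[_ _ a] /clh[_ _ b]]; exists (s u); rewrite a.
rewrite -card_gt0; apply: (heavy_meet (finset.cardsUI (cl t (h t)) (cl t' (h t'))) _ (hP t) (hP t')).
by apply: subset_leq_card; apply/fintype.subsetP => u; rewrite inE => /orP[|] /clh[].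
Qed.

(** * Cliques as increasing lists, and induced subgraphs *)

Definition radj (rows : seq (seq bool)) (x y : nat) := nth false (nth [::] rows x) y.
Definition clq (e : rel nat) (A : seq nat) := all (fun x => all (fun y => (x == y) || e x y) A) A.
(** Only vertices smaller than the whole clique are put in front, so each clique arises exactly once
    and is an increasing list. *)
Definition extend_clq (e : rel nat) n (L : fam) : fam :=
  flatten [seq [seq x :: A | x <- [seq x <- iota 0 n | all (fun y => (x < y) && e x y) A]] | A <- L].
Definition kcl e n r : fam := iter r (extend_clq e n) [:: [::]].

(** The candidate separators are lists with possible repetitions rather than subsets: the next [l]
    then needs a single product with [V], which the main loop can afford. *)
Definition Wseq (V : seq nat) l : fam :=
  iter l (fun W => [::] :: [seq v :: z | v <- V, z <- W]) [:: [::]].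

Lemma mem_Wseq V l z : (z \in Wseq V l) = (size z <= l) && all (fun x => x \in V) z.
Proof.
elim: l z => [|l IHl] [|x z] //=; rewrite inE /=.
apply/allpairsP/idP => [[[v z'] /= [vV]]|/and3P[zl xV zV]].
  by rewrite IHl => /andP[zl zV] [-> ->]; rewrite ltnS zl vV.
by exists (x, z); rewrite /= IHl zV andbT -ltnS.
Qed.

Lemma size_Wseq V l : size (Wseq V l) <= (size V).+1 ^ l.
Proof.
elim: l => // l IHl; rewrite /= size_allpairs expnS mulSn.
have le1 : 0 < (size V).+1 ^ l by rewrite expn_gt0.
by rewrite -add1n leq_add // leq_mul2l IHl orbT.
Qed.

Section Cliques.
Variables (e : rel nat) (n : nat).
Hypothesis esym : symmetric e.

Lemma clqP A : reflect {in A &, forall x y, x != y -> e x y} (clq e A).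
Proof.
apply: (iffP allP) => [H x y xA yA xy|H x xA].
  by have /allP/(_ y yA) := H x xA; rewrite (negPf xy).
by apply/allP => y yA; case: eqP => //= /eqP; exact: H.
Qed.

Lemma clq_sub A B : sub A B -> clq e B -> clq e A.
Proof. by move=> /subP AB /clqP H; apply/clqP => x y /AB xB /AB yB; exact: H. Qed.

Lemma clq_cons x A : clq e (x :: A) = clq e A && all (fun y => (x == y) || e x y) A.
Proof.
apply/clqP/andP => [H|[/clqP H /allP Hx] u v].
  split; first by apply/clqP => u v uA vA; apply: H; rewrite inE ?uA ?vA orbT.
  by apply/allP => y yA; case: eqP => //= /eqP; apply: H; rewrite ?mem_head // inE yA orbT.
rewrite !inE => /orP[/eqP ->|uA] /orP[/eqP ->|vA]; first by rewrite eqxx.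
- by move=> /negPf xv; have := Hx v vA; rewrite xv.
- by move=> /negPf ux; have := Hx u uA; rewrite eq_sym ux esym.
exact: H.
Qed.

Lemma mem_kcl r A : (A \in kcl e n r) =
  [&& size A == r, sorted ltn A, all (fun x => x < n) A & clq e A].
Proof.
elim: r A => [|r IHr] A; first by rewrite inE; case: A.
apply/flatten_mapP/idP => [[B BL /mapP[x]]|].
  rewrite mem_filter mem_iota leq0n add0n => /andP[/allP xB /= xn] ->.
  move: BL; rewrite -/(kcl e n r) IHr => /and4P[/eqP <- sB nB cB].
  rewrite [all _ _]/= (eqxx (size (x :: B))) /= xn nB clq_cons cB /= path_sortedE; last exact: ltn_trans.
  rewrite sB andbT; apply/andP; split; first by apply/allP => y /xB/andP[].
  by apply/allP => y /xB/andP[_ ->]; rewrite orbT.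
case: A => [|x B] //=.
rewrite eqSS path_sortedE; last exact: ltn_trans.
rewrite clq_cons => /and4P[zB /andP[/allP xB sB] /andP[xn nB] /andP[cB /allP xcB]].
exists B; first by rewrite -/(kcl e n r) IHr zB sB nB.
apply: map_f; rewrite mem_filter mem_iota leq0n add0n xn !andbT; apply/allP => y yB.
have := xcB y yB; have xy : x < y := xB y yB; rewrite xy /=.
by case: eqP => // yx; move: xy; rewrite yx ltnn.
Qed.

Lemma kcl_uniq r : uniq (kcl e n r).
Proof.
elim: r => // r IHr; rewrite /kcl iterS -/(kcl e n r) /extend_clq.
elim: (kcl e n r) IHr => //= A L IHL /andP[AL uL]; rewrite cat_uniq IHL // andbT.
rewrite map_inj_uniq ?filter_uniq ?iota_uniq //=; last by move=> x y [].
apply/hasPn => B /flatten_mapP[A' A'L /mapP[x _ ->]]; apply/negP => /mapP[y _ [_ E]].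
by rewrite -E A'L in AL.
Qed.

Lemma wf_kcl r : 0 < r -> wf r (kcl e n r).
Proof.
move=> r0; split; first exact: kcl_uniq.
- by move=> A; rewrite mem_kcl => /and4P[].
- by move=> A; rewrite mem_kcl => /and4P[/eqP -> _ _ _]; rewrite r0 leqnn.
move=> A B; rewrite !mem_kcl => /and4P[/eqP zA sA _ _] /and4P[/eqP zB sB _ _] AB.
by apply: sub_size_eq => //; rewrite zA zB.
Qed.

End Cliques.

Section Graph.
Variable G : sgraph.
Let n := order G.
Let e := radj (adjacency_rows G).

Lemma size_rows : size (adjacency_rows G) = n.
Proof. by rewrite size_map size_enum_ord. Qed.

Lemma radjE (i j : 'I_(order G)) : e i j = adj i j.
Proof.
rewrite /e /radj /adjacency_rows (nth_map i) ?size_enum_ord // (nth_map j) ?size_enum_ord //.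
by rewrite !nth_ord_enum.
Qed.

Lemma radj_lt x y : e x y -> x < n /\ y < n.
Proof.
rewrite /e /radj; case: (ltnP x n) => xn; last first.
  by rewrite (@nth_default _ [::]) ?size_rows // nth_nil.
rewrite (nth_map (Ordinal xn)) ?size_enum_ord //; case: (ltnP y n) => // yn.
by rewrite nth_default // size_map size_enum_ord.
Qed.

Lemma radj_sym : symmetric e.
Proof.
suff H x y : e x y -> e y x by move=> x y; apply/idP/idP; exact: H.
move=> xy; have [xn yn] := radj_lt xy; move: xy.
by rewrite (radjE (Ordinal xn) (Ordinal yn)) (radjE (Ordinal yn) (Ordinal xn)) adj_sym.
Qed.

Lemma radj_irr : irreflexive e.
Proof.
move=> x; apply/negbTE/negP => xx; have [xn _] := radj_lt xx; move: xx.
by rewrite (radjE (Ordinal xn) (Ordinal xn)) adj_irr.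
Qed.

Definition verts (A : {set 'I_(order G)}) : seq nat := [seq val i | i <- enum A].

Lemma sorted_verts A : sorted ltn (verts A).
Proof.
have : sorted ltn [seq val i | i <- enum 'I_(order G)] by rewrite val_enum_ord iota_ltn_sorted.
apply: (subseq_sorted ltn_trans); apply: map_subseq.
by rewrite enumT; exact: filter_subseq.
Qed.

Lemma mem_verts A (i : 'I_(order G)) : (val i \in verts A) = (i \in A).
Proof. by rewrite mem_map ?mem_enum //; exact: val_inj. Qed.

Lemma verts_clq A : clique A -> clq e (verts A).
Proof.
move=> /forall_inP cA; apply/(clqP) => _ _ /mapP[i iA ->] /mapP[j jA ->] ij.
rewrite mem_enum in iA; rewrite mem_enum in jA.
by rewrite radjE; move/forall_inP: (cA i iA) => /(_ j jA) /implyP; apply; apply: contraNneq ij => ->.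
Qed.

Lemma coverableP r k : reflect (exists2 S, size S <= k & hits S (kcl e n r)) (Kr_coverable r G k).
Proof.
apply: (iffP existsP) => [[S /andP[Sk /forallP H]]|[S Sk /allP hS]].
  exists (verts S); first by rewrite size_map -cardE.
  apply/allP => A; rewrite mem_kcl; last exact: radj_sym.
  move=> /and4P[/eqP zA sA /allP An cA]; rewrite -[hit _ _]negbK; apply/negP => nh.
  pose A' := [set i : 'I_(order G) | val i \in A].
  have vA : verts A' = A.
    apply: sorted_eq_mem => //; first exact: sorted_verts.
    move=> x; apply/mapP/idP => [[i]|xA]; first by rewrite mem_enum inE => iA ->.
    by exists (Ordinal (An x xA)); rewrite ?mem_enum ?inE.
  have := H A'; rewrite -(size_map val) -cardE || idtac.
  have -> : #|A'| = r by rewrite cardE -(size_map val) -/(verts A') vA.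
  rewrite eqxx implybF negb_and => /orP[/negP[]|/negP[]].
    apply/forall_inP => i iA; apply/forall_inP => j jA; apply/implyP => ij.
    rewrite -radjE; move/clqP: cA; apply; rewrite -?vA ?mem_verts //.
  rewrite -setI_eq0; apply/eqP/setP => i; rewrite !inE; apply/negbTE/negP => /andP[iA iS].
  by case/negP: nh; apply/hitP; exists (val i); rewrite ?mem_verts.
exists [set i : 'I_(order G) | val i \in S]; apply/andP; split.
  apply: leq_trans Sk; rewrite cardE -(size_map val); apply: uniq_leq_size.
    by rewrite map_inj_uniq ?enum_uniq //; exact: val_inj.
  by move=> x /mapP[i]; rewrite mem_enum inE => iS ->.
apply/forallP => A; apply/implyP => /andP[cA dA]; apply/eqP => zA.
have : verts A \in kcl e n r.
  rewrite mem_kcl; last exact: radj_sym.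
  rewrite sorted_verts verts_clq // size_map -cardE zA eqxx /= andbT.
  by apply/allP => _ /mapP[i _ ->]; exact: ltn_ord.
move=> /hS/hitP[_ /mapP[i iA ->] iS]; rewrite mem_enum in iA.
by move/pred0P: dA => /(_ i); rewrite /= iA inE iS.
Qed.

(** The vertices of G[V] are the positions in [V], since graphs are labelled by ordinals. *)
Definition iadj (V : seq nat) : rel 'I_(size V) := [rel i j : 'I_(size V) | e (nth 0 V i) (nth 0 V j)].

Lemma iadj_sym V : symmetric (@iadj V). Proof. by move=> i j; exact: radj_sym. Qed.
Lemma iadj_irr V : irreflexive (@iadj V). Proof. by move=> i; exact: radj_irr. Qed.
Definition isub V := SGraph (@iadj_sym V) (@iadj_irr V).

Lemma isub_induced V : uniq V -> all (fun x => x < n) V -> induced_in (isub V) G.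
Proof.
move=> uV /allP Vn; have lt (i : 'I_(size V)) : nth 0 V i < n by apply/Vn/mem_nth.
exists (fun i => Ordinal (lt i)) => [i j /(congr1 val)/= /eqP|i j]; last by rewrite -radjE.
by rewrite nth_uniq // => /eqP/val_inj.
Qed.

Definition pull (V T : seq nat) : {set 'I_(order (isub V))} := [set i : 'I_(size V) | nth 0 V i \in T].

Lemma card_pull V T : uniq V -> uniq T -> {subset T <= V} -> #|pull V T| = size T.
Proof.
move=> uV uT TV; rewrite cardE -(size_map (fun i : 'I_(size V) => nth 0 V i)).
apply/perm_size/uniq_perm => //.
  rewrite map_inj_uniq ?enum_uniq // => i j /eqP; rewrite nth_uniq // => /eqP.
  exact: val_inj.
move=> x; apply/mapP/idP => [[i]|xT]; first by rewrite mem_enum inE => ? ->.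
have xV := TV x xT; have lt : index x V < size V by rewrite index_mem.
by exists (Ordinal lt); rewrite ?mem_enum ?inE /= nth_index.
Qed.

Lemma pull_clique V T : uniq V -> clq e T -> clique (pull V T).
Proof.
move=> uV /clqP cT; apply/forall_inP => i; rewrite inE => iT; apply/forall_inP => j; rewrite inE => jT.
apply/implyP => ij; apply: (cT _ _ iT jT); by rewrite nth_uniq.
Qed.

Lemma pull_inj V T T' : {subset T <= V} -> {subset T' <= V} -> sorted ltn T -> sorted ltn T' ->
  pull V T = pull V T' -> T = T'.
Proof.
move=> TV TV' sT sT' E; apply: sorted_eq_mem => // x.
have H (U : seq nat) : {subset U <= V} -> (x \in U) = (x \in V) && (nth 0 V (index x V) \in U).
  by move=> UV; case: (boolP (x \in V)) => [xV|]; [rewrite nth_index|apply: contraNF; exact: UV].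
rewrite (H T TV) (H T' TV'); case: (boolP (x \in V)) => //= xV.
have lt : index x V < size V by rewrite index_mem.
by move/setP: E => /(_ (Ordinal lt)); rewrite !inE.
Qed.

Lemma num_cliques_isub r V (L : fam) : uniq V -> uniq L ->
  (forall T : seq nat, T \in L -> [/\ sorted ltn T, 0 < size T < r, sub T V & clq e T]) ->
  size L <= num_cliques_lt (isub V) r.
Proof.
move=> uV uL HL; rewrite /num_cliques_lt cardE -(size_map (pull V) L).
apply: uniq_leq_size.
  rewrite map_inj_in_uniq // => T T' /HL[sT _ /subP TV _] /HL[sT' _ /subP TV' _].
  exact: pull_inj.
move=> _ /mapP[T /HL[sT /andP[T0 Tr] /subP TV cT] ->]; rewrite mem_enum inE pull_clique //.
have zT : #|pull V T| = size T by apply: card_pull => //; exact: sorted_ltn_uniq.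
by rewrite -card_gt0 zT T0.
Qed.

Lemma clique_number_isub V q : uniq V ->
  (forall X : seq nat, sorted ltn X -> sub X V -> clq e X -> size X <= q) ->
  clique_number (isub V) <= q.
Proof.
move=> uV H; apply/bigmax_leqP => A /forall_inP cA.
pose X := sort leq [seq nth 0 V (nat_of_ord i) | i <- enum A].
have mX x : x \in X -> exists2 i : 'I_(size V), i \in A & x = nth 0 V i.
  by rewrite mem_sort => /mapP[i]; rewrite mem_enum; exists i.
have <- : size X = #|A| by rewrite size_sort size_map -cardE.
apply: H.
- rewrite ltn_sorted_uniq_leq sort_uniq sort_sorted ?andbT; last exact: leq_total.
  rewrite map_inj_uniq ?enum_uniq // => i j /eqP; rewrite nth_uniq // => /eqP; exact: val_inj.
- by apply/subP => x /mX[i _ ->]; exact: mem_nth.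
apply/clqP => x y /mX[i iA ->] /mX[j jA ->] ij.
by move/forall_inP: (cA i iA) => /(_ j jA)/implyP; apply; apply: contraNneq ij => ->.
Qed.

Lemma treewidthP (H : sgraph) : has_width H (treewidth H).
Proof. by rewrite /treewidth; case: ex_minnP => w /asboolP. Qed.

(** A bag of an optimal tree decomposition has at most [l] vertices when the treewidth is below [l].
    If [V] itself has at most [l] vertices, it separates everything. *)
Lemma isub_separator V (F W : fam) l : uniq V ->
  (forall z, size z <= l -> {subset z <= V} -> z \in W) ->
  (forall A : seq nat, A \in F -> clq e A /\ sub A V) ->
  size V <= l \/ treewidth (isub V) < l ->
  forall U : seq nat, uniq U -> {subset U <= V} -> exists2 X : seq nat, X \in W &
    exists kap : nat -> nat,
   (forall (A : seq nat) x y, A \in F -> x \in A -> y \in A -> x \in dif U X -> y \in dif U X -> kap x = kap y)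
   /\ forall c, 2 * count (fun x => kap x == c) (dif U X) <= size U.
Proof.
move=> uV HW FV [Vl|tl] U uU UV.
  have E : dif U V = [::].
    by apply/eqP; rewrite -size_eq0 size_filter -leqn0 leqNgt -has_count; apply/hasPn => x /UV ->.
  exists V; first exact: HW.
  by exists (fun=> 0); rewrite E; split=> // c; rewrite muln0.
have [T [bag [td wd]]] := treewidthP (isub V).
have [t [kap [Hk Hc]]] := balanced_bag (pull V U) td.
pose X := [seq nth 0 V (nat_of_ord i) | i <- enum (bag t)].
have mX (i : 'I_(size V)) : (nth 0 V i \in X) = (i \in bag t).
  apply/mapP/idP => [[j]|ib]; last by exists i; rewrite ?mem_enum.
  by rewrite mem_enum => jb /eqP; rewrite nth_uniq // => /eqP/val_inj ->.
have ix x : x \in V -> exists2 i : 'I_(size V), x = nth 0 V i & index x V = i.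
  by move=> xV; have lt : index x V < size V by [rewrite index_mem]; exists (Ordinal lt); rewrite //= nth_index.
pose kap' x := if insub (index x V) is Some i then kap i else 0.
have kapE (i : 'I_(size V)) : kap' (nth 0 V i) = kap i.
  by rewrite /kap' index_uniq // valK.
exists X.
  apply: HW => [|_ /mapP[i _ ->]]; last exact: mem_nth.
  by rewrite size_map -cardE (leq_trans (wd t) tl).
exists kap'; split=> [A x y AF xA yA|c].
  have [cA _] := FV A AF; rewrite !mem_dif => /andP[/UV/ix[i xE _] nx] /andP[/UV/ix[j yE _] ny].
  rewrite xE yE in xA yA nx ny *; rewrite !kapE; rewrite !mX in nx ny.
  have [->//|ij] := eqVneq i j; apply: Hk => //.
  by move/clqP: cA; apply; rewrite ?nth_uniq.
have -> : size U = #|pull V U| by rewrite card_pull.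
apply: leq_trans (Hc c); rewrite leq_mul2l /=.
rewrite -size_filter cardE -(size_map (fun i : 'I_(size V) => nth 0 V i)).
apply: uniq_leq_size; first by rewrite !filter_uniq.
move=> x; rewrite mem_filter mem_dif => /and3P[/eqP kx xU nX].
have [i xE _] := ix x (UV x xU); rewrite xE; apply: map_f.
by rewrite mem_enum !inE -xE xU -mX -xE nX -kx xE kapE eqxx.
Qed.

End Graph.

(** * Families of sparse graphs *)

Definition pack (L : fam) : fam := foldr (fun A P => if hit (flatten P) A then P else A :: P) [::] L.

Lemma pack_sub L : {subset pack L <= L}.
Proof.
elim: L => //= A L IHL B; case: ifP => _; rewrite !inE; first by move/IHL ->; rewrite orbT.
by case/orP=> [->//|/IHL ->]; rewrite orbT.
Qed.

Lemma pack_uniq (L : fam) : (forall A : seq nat, A \in L -> uniq A) -> uniq (flatten (pack L)).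
Proof.
elim: L => //= A L IHL uL; have uP : uniq (flatten (pack L)).
  by apply: IHL => B BL; apply: uL; rewrite inE BL orbT.
case: ifP => //= nh; rewrite cat_uniq uP uL ?mem_head //= andbT.
apply/hasPn => x xP; apply/negP => xA; move/negP: nh; apply; apply/hitP; by exists x.
Qed.

Lemma pack_max (L : fam) A : A \in L -> 0 < size A -> hit (flatten (pack L)) A.
Proof.
elim: L => //= B L IHL; rewrite inE => /orP[/eqP <- A0|AL A0].
  case: ifP => //= _; case: (A) A0 => // a A' _; apply/hitP; exists a; rewrite ?mem_head //.
case: ifP => _; first exact: IHL.
have /hitP[x xA xP] := IHL AL A0; apply/hitP; exists x => //=.
by rewrite mem_cat xP orbT.
Qed.

Lemma disjoint_hit (Q : fam) X : uniq (flatten Q) -> all (hit X) Q -> size Q <= size (cap (undup X) (flatten Q)).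
Proof.
move=> uQ hQ; apply: (@leq_trans (size (cap (flatten Q) X))); last first.
  apply: uniq_leq_size; first exact: filter_uniq.
  by move=> x; rewrite !mem_cap mem_undup andbC.
elim: Q uQ hQ => //= A Q IHQ; rewrite cat_uniq => /and3P[_ _ uQ] /andP[/hitP[x xA xX] hQ].
rewrite /cap filter_cat size_cat -add1n leq_add ?IHQ //.
by rewrite size_filter -has_count; apply/hasP; exists x.
Qed.

Lemma size_flatten_le (Q : fam) r : (forall A : seq nat, A \in Q -> size A <= r) -> size (flatten Q) <= size Q * r.
Proof.
elim: Q => //= A Q IHQ H; rewrite size_cat mulSn leq_add //; first by apply: H; rewrite mem_head.
by apply: IHQ => B BQ; apply: H; rewrite inE BQ orbT.
Qed.

Section Sparse.
Variables (r : nat) (F : fam) (yl : seq nat).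

Definition pet (T M : seq nat) : fam := [seq dif A T | A <- F & sub T A && ~~ hit M (dif A T)].
Definition nu T M := size (pack (pet T M)).
Definition thr j := nth 0 yl j.
(** A state is the pair of the current set [M] and of the list of trusted traces. A member is
    settled if it lies inside [M] or contains a trusted trace. *)
Definition unsettled (s : seq nat * fam) : fam :=
  [seq A <- F | ~~ sub A s.1 && ~~ has (fun T => sub T A) s.2].
Definition traces (s : seq nat * fam) : fam := undup [seq cap A s.1 | A <- unsettled s].
Definition grow (M : seq nat) (L : fam) := undup (M ++ flatten (flatten [seq pack (pet T M) | T <- L])).
(** A trace is trusted at [4 * r * thr] disjoint petals, but revised only below [thr]. The gap
    ensures that at least [3 * r * thr] of its petals have been eaten by [M] in between. *)
Definition round (s : seq nat * fam) : seq nat * fam :=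
  (grow s.1 [seq T <- traces s | nu T s.1 < 4 * r * thr (size T)],
   undup ([seq T <- traces s | 4 * r * thr (size T) <= nu T s.1] ++ s.2)).
Definition late i (s : seq nat * fam) : fam :=
  [seq T <- s.2 | (size T == i) && (nu T s.1 < thr i)].
(** The late traces lose their trust and give their remaining packed petals to [M]; [r] rounds then
    settle the members that they leave behind. *)
Definition event i (s : seq nat * fam) : seq nat * fam :=
  iter r round (grow s.1 (late i s), [seq T <- s.2 | T \notin late i s]).
Definition start : seq nat * fam := iter r round (flatten (pack F), [::]).

Hypothesis wfF : wf r F.
Let uF : uniq F. Proof. by case: wfF. Qed.
Let sF (A : seq nat) : A \in F -> sorted ltn A. Proof. by case: wfF => _ H _ _; exact: H. Qed.
Let zF (A : seq nat) : A \in F -> 0 < size A <= r. Proof. by case: wfF => _ _ H _; exact: H. Qed.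

Lemma pet_size T M P : P \in pet T M -> size P <= r.
Proof.
move=> /mapP[A]; rewrite mem_filter => /andP[_ /zF/andP[_ zA]] ->.
by apply: leq_trans zA; rewrite size_filter count_size.
Qed.

Lemma pet_uniq T M P : P \in pet T M -> uniq P.
Proof.
move=> /mapP[A]; rewrite mem_filter => /andP[_ AF] ->.
exact/filter_uniq/sorted_ltn_uniq/sF.
Qed.

Lemma pack_pet_size T M : size (flatten (pack (pet T M))) <= nu T M * r.
Proof. by apply: size_flatten_le => A /pack_sub; exact: pet_size. Qed.

Lemma grow_sub M L : {subset M <= grow M L}.
Proof. by move=> x xM; rewrite mem_undup mem_cat xM. Qed.

Lemma mem_grow M L x : x \in grow M L -> x \in M \/ exists2 T : seq nat, T \in L & x \in flatten (pack (pet T M)).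
Proof.
rewrite mem_undup mem_cat => /orP[|/flattenP[P /flatten_mapP[T TL PT] xP]]; first by left.
by right; exists T => //; apply/flattenP; exists P.
Qed.

Lemma grow_pack M (L : fam) T x : T \in L -> x \in flatten (pack (pet T M)) -> x \in grow M L.
Proof.
move=> TL /flattenP[P PP xP]; rewrite mem_undup mem_cat; apply/orP; right.
by apply/flattenP; exists P => //; apply/flatten_mapP; exists T.
Qed.

Lemma grow_F M L x : x \in grow M L -> x \in M \/ x \in flatten F.
Proof.
move=> /mem_grow[|[T _ /flattenP[P /pack_sub/mapP[A]]]]; first by left.
rewrite mem_filter => /andP[_ AF] -> ; rewrite mem_dif => /andP[xA _].
by right; apply/flattenP; exists A.
Qed.

(** Either [M] already meets [A] outside [T], or that part of [A] is a petal, and a maximal packing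
    of petals meets it. *)
Lemma grow_meets M (L : fam) T A : T \in L -> A \in F -> sub T A -> sub T M -> ~~ sub A T -> uniq T ->
  size T < size (cap A (grow M L)).
Proof.
move=> TL AF TA TM nAT uT.
have [x] : exists2 x, x \in dif A T & x \in grow M L.
  have [/hitP[x xA xM]|nh] := boolP (hit M (dif A T)); first by exists x => //; exact: grow_sub.
  have PP : dif A T \in pet T M by apply: map_f; rewrite mem_filter TA nh.
  have [|x xA xP] := hitP _ _ (pack_max PP _).
    case/allPn: nAT => x xA xT; have : x \in dif A T by rewrite mem_dif xA.
    by case: (dif A T).
  by exists x => //; exact: grow_pack xP.
rewrite mem_dif => /andP[xA xT] xG; apply: (@leq_trans (size (x :: T))) => //.
apply: uniq_leq_size; first by rewrite /= xT.
move=> y; rewrite inE mem_cap => /orP[/eqP ->|yT]; first by rewrite xA.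
by rewrite (subP _ _ TA) // grow_sub // (subP _ _ TM).
Qed.

Lemma size_grow M L c : (forall T : seq nat, T \in L -> nu T M <= c) ->
  size (grow M L) <= size M + size L * (c * r).
Proof.
move=> H; apply: leq_trans (size_undup _) _; rewrite size_cat leq_add2l.
elim: L H => //= T L IHL H; rewrite flatten_cat size_cat mulSn leq_add //.
  by apply: leq_trans (pack_pet_size _ _) _; rewrite leq_mul2r H ?mem_head ?orbT.
by apply: IHL => U UL; apply: H; rewrite inE UL orbT.
Qed.

(** [MT] is the current set at the time when [T] became trusted, and [T] was then the trace of the
    member [A]. *)
Definition inv (s : seq nat * fam) :=
  [/\ uniq s.1, {subset s.1 <= flatten F}, forall A : seq nat, A \in F -> hit s.1 A, uniq s.2
    & forall T : seq nat, T \in s.2 -> exists MT (A : seq nat),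
      [/\ {subset MT <= s.1}, 4 * r * thr (size T) <= nu T MT, A \in F, ~~ sub A MT & T = cap A MT /\ 0 < size T]].

Definition settled s := unsettled s = [::].

Lemma traceP s T : T \in traces s -> exists A : seq nat, [/\ A \in F, ~~ sub A s.1,
  ~~ has (fun T => sub T A) s.2 & T = cap A s.1].
Proof.
rewrite mem_undup => /mapP[A]; rewrite mem_filter => /andP[/andP[nA nh] AF] ->.
by exists A.
Qed.

Lemma cap_pos (A M : seq nat) : hit M A -> 0 < size (cap A M).
Proof. by move=> /hitP[x xA xM]; rewrite size_filter -has_count; apply/hasP; exists x. Qed.

Lemma inv_round s : inv s -> inv (round s).
Proof.
move=> [uM MF hM uZ HZ]; split=> /=; rewrite ?undup_uniq //.
- by move=> x /grow_F[/MF|].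
- by move=> A /hM/hitP[x xA xM]; apply/hitP; exists x => //; exact: grow_sub.
move=> T; rewrite mem_undup mem_cat mem_filter => /orP[/andP[le /traceP[A [AF nA _ TE]]]|].
  by exists s.1, A; split=> //; [exact: grow_sub|split=> //; rewrite TE cap_pos // hM].
by move=> /HZ[MT [A [MTM le AF nA TE]]]; exists MT, A; split=> // x /MTM; exact: grow_sub.
Qed.

Lemma inv_iter n s : inv s -> inv (iter n round s).
Proof. by move=> H; elim: n => // n; exact: inv_round. Qed.

Lemma inv_start : inv start.
Proof.
apply: inv_iter; split=> //=.
- by apply: pack_uniq => A /sF; exact: sorted_ltn_uniq.
- by move=> x /flattenP[A /pack_sub AF xA]; apply/flattenP; exists A.
- by move=> A AF; apply: pack_max => //; case/andP: (zF AF).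
Qed.

Lemma inv_drop i s : inv s -> inv (grow s.1 (late i s), [seq T <- s.2 | T \notin late i s]).
Proof.
move=> [uM MF hM uZ HZ]; split=> /=; rewrite ?undup_uniq ?filter_uniq //.
- by move=> x /grow_F[/MF|].
- by move=> A /hM/hitP[x xA xM]; apply/hitP; exists x => //; exact: grow_sub.
move=> T; rewrite mem_filter => /andP[_ /HZ[MT [A [MTM le AF nA TE]]]].
by exists MT, A; split=> // x /MTM; exact: grow_sub.
Qed.

Lemma inv_event i s : inv s -> inv (event i s).
Proof. by move=> H; exact: inv_iter (inv_drop i H). Qed.

Lemma round_sub n s : {subset s.1 <= (iter n round s).1} /\ {subset s.2 <= (iter n round s).2}.
Proof.
elim: n => [|n [IH1 IH2]]; first by split.
split=> x /=; first by move/IH1; exact: grow_sub.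
by move/IH2 => xZ; rewrite mem_undup mem_cat xZ orbT.
Qed.

(* Every round enlarges the trace on [M] of the sets which are still not settled. *)
Definition deep c s := forall A : seq nat, A \in unsettled s -> c <= size (cap A s.1).

Lemma deep_round c s : deep c s -> deep c.+1 (round s).
Proof.
move=> H A; rewrite mem_filter /= => /andP[/andP[nA nh] AF].
have nh2 : ~~ has (fun T => sub T A) s.2.
  by apply: contra nh => /hasP[T TZ TA]; apply/hasP; exists T => //; rewrite mem_undup mem_cat TZ orbT.
have nA2 : ~~ sub A s.1.
  by apply: contra nA => /subP AM; apply/subP => x /AM; exact: grow_sub.
have Au : A \in unsettled s by rewrite mem_filter nA2 nh2.
have Tt : cap A s.1 \in traces s by rewrite mem_undup; apply: map_f.
have TA : sub (cap A s.1) A by apply/subP => x; rewrite mem_cap => /andP[].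
apply: leq_ltn_trans (H A Au) _; apply: (@grow_meets _ _ (cap A s.1)) => //.
- rewrite mem_filter Tt andbT ltnNge; apply: contra nh => le; apply/hasP; exists (cap A s.1) => //.
  by rewrite mem_undup mem_cat mem_filter Tt le.
- by apply/subP => x; rewrite mem_cap => /andP[].
- apply: contra nA2 => /subP AT; apply/subP => x /AT; by rewrite mem_cap => /andP[].
exact/filter_uniq/sorted_ltn_uniq/sF.
Qed.

Lemma deep_iter c n s : deep c s -> deep (c + n) (iter n round s).
Proof.
by move=> H; elim: n => [|n IHn]; rewrite ?addn0 // addnS; exact: deep_round.
Qed.

Lemma deep_settled s : deep r s -> settled s.
Proof.
move=> H; rewrite /settled; case E: (unsettled s) => [|A L] //.
have Au : A \in unsettled s by rewrite E mem_head.
have := H A Au; move: Au; rewrite mem_filter => /andP[/andP[nA _] AF].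
have /andP[_ zA] := zF AF; move=> /(leq_trans zA); rewrite /cap size_filter => le.
case/negP: nA; rewrite /sub all_count eqn_leq count_size; exact: le.
Qed.

Lemma settled_rounds s : settled (iter r round s).
Proof. by apply: deep_settled; rewrite -[r in deep r _]add0n; apply: deep_iter. Qed.

Lemma settledP s A : settled s -> A \in F -> sub A s.1 || has (fun T => sub T A) s.2.
Proof.
move=> H AF; rewrite -[_ || _]negbK negb_or; apply/negP => nA.
have : A \in unsettled s by rewrite mem_filter nA.
by rewrite H.
Qed.

Lemma fz_facts s T : inv s -> T \in s.2 -> exists2 A : seq nat, A \in F &
  [/\ sorted ltn T, 0 < size T < r, sub T s.1 & sub T A].
Proof.
move=> [_ _ _ _ HZ] /HZ[MT [A [MTM _ AF nA [-> T0]]]]; exists A => //; split.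
- exact/sorted_cap/sF.
- rewrite T0 /= ltnNge; apply: contra nA => le; have /andP[_ zA] := zF AF.
  by rewrite /sub all_count eqn_leq count_size -size_filter (leq_trans zA le).
- by apply/subP => x; rewrite mem_cap => /andP[_ /MTM].
by apply/subP => x; rewrite mem_cap => /andP[].
Qed.

(** Members that become unsettled contain a dropped trace of size [i], and the added petals extend
    their trace on [M]. The rounds that follow thus only involve the threshold of [i.+1], which is
    far below that of [i]. *)
Lemma deep_drop i s : inv s -> settled s ->
  deep i.+1 (grow s.1 (late i s), [seq T <- s.2 | T \notin late i s]).
Proof.
move=> invs st A; rewrite mem_filter /= => /andP[/andP[nA nh] AF].
have /orP[/subP AM|/hasP[T TZ TA]] := settledP st AF.
  by case/negP: nA; apply/subP => x /AM; exact: grow_sub.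
have Tl : T \in late i s.
  apply: contraR nh => nl; apply/hasP; exists T => //; by rewrite mem_filter nl.
have [A' _ [sT _ TM _]] := fz_facts invs TZ.
have iE : i = size T by move: Tl; rewrite mem_filter => /andP[/andP[/eqP ->]].
subst i.
apply: grow_meets => //; last exact: sorted_ltn_uniq.
apply: contra nA => /subP AT; apply/subP => x /AT/(subP _ _ TM); exact: grow_sub.
Qed.

Section Count.
Variables (e : rel nat) (c : nat).
Hypotheses (r3 : 2 < r) (esym : symmetric e) (cF : forall A : seq nat, A \in F -> clq e A)
  (few : forall (U : seq nat) (L : fam), uniq U -> {subset U <= flatten F} -> uniq L ->
    (forall T : seq nat, T \in L -> [/\ sorted ltn T, 0 < size T < r, sub T U & clq e T]) ->
    size L <= c * size U)
  (c0 : 0 < c) (thr_mono : forall i j, i <= j -> thr j <= thr i).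

(** The traces are cliques with fewer than [r] vertices inside [M], so [few] bounds their number by
    [c * size M]. Each one that grows adds fewer than [4 * r * thr j] petals. *)
Lemma round_growth s j : inv s -> deep j s ->
  size (round s).1 <= size s.1 * (1 + c * (4 * r * thr j * r)).
Proof.
move=> invs dj; have [uM MF hM uZ HZ] := invs; rewrite mulnDr muln1.
apply: leq_trans (@size_grow _ _ (4 * r * thr j) _) _.
  move=> T; rewrite mem_filter => /andP[/ltnW le]; rewrite mem_undup => /mapP[A /dj jA TE].
  by apply: leq_trans le _; rewrite leq_mul2l thr_mono ?orbT // TE.
rewrite leq_add2l [X in _ <= X]mulnA leq_mul2r [_ * c]mulnC; apply/orP; right; apply: few => //.
  by rewrite filter_uniq // undup_uniq.
move=> T; rewrite mem_filter => /andP[_ /traceP[A [AF nA _ ->]]]; split.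
- exact/sorted_cap/sF.
- rewrite cap_pos ?hM //= ltnNge; apply: contra nA => le; have /andP[_ zA] := zF AF.
  by rewrite /sub all_count eqn_leq count_size -size_filter (leq_trans zA le).
- by apply/subP => x; rewrite mem_cap => /andP[].
by apply: clq_sub (cF AF); apply/subP => x; rewrite mem_cap => /andP[].
Qed.

Lemma rounds_growth n s j : inv s -> deep j s ->
  size (iter n round s).1 <= size s.1 * (1 + c * (4 * r * thr j * r)) ^ n.
Proof.
move=> invs dj; elim: n => [|n IHn]; first by rewrite muln1.
have dn : deep j (iter n round s).
  by move=> A /(deep_iter (n := n) dj); apply: leq_trans; exact: leq_addr.
rewrite iterS; apply: leq_trans (round_growth (inv_iter n invs) dn) _.
by rewrite expnSr [X in _ <= X]mulnA leq_mul2r IHn orbT.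
Qed.

End Count.
End Sparse.

Lemma late_arith r t c y m l : 3 * r * t * y <= 2 * (c * m) -> l <= c * y -> l * (t * r) <= c * c * m.
Proof.
move=> h1 h2; have : r * t * y <= c * m by nia.
move=> h3; apply: leq_trans (leq_mul h2 (leqnn _)) _.
by rewrite -mulnA -mulnA leq_mul2l; apply/orP; right; apply: leq_trans h3; rewrite leq_eqVlt; apply/orP; left; apply/eqP; ring.
Qed.

Lemma unhit_arith r c d t y a s : 0 < c -> 0 < d -> t = 4 * r * (c * c) * d -> 0 < r ->
  t * y <= 2 * (c * (y + a)) -> a <= d * s -> r * c * y <= s.
Proof.
move=> c0 d0 -> r0 h1 h2.
have h3 : 4 * r * (c * c) * d * y <= 2 * (c * y) + 2 * (c * (d * s)).
  apply: leq_trans h1 _; rewrite -mulnDr leq_mul2l -mulnDr leq_mul2l leq_add2l h2.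
  by rewrite !orbT.
have h4 : 2 * (c * y) <= 2 * r * (c * c) * d * y.
  have -> : 2 * r * (c * c) * d * y = (r * c * d) * (2 * (c * y)) by ring.
  by rewrite leq_pmull // !muln_gt0 r0 c0.
have h5 : 2 * r * (c * c) * d * y <= 2 * (c * (d * s)).
  have E : 4 * r * (c * c) * d * y = 2 * r * (c * c) * d * y + 2 * r * (c * c) * d * y by ring.
  by move: h3; rewrite E; move: h4; set u := 2 * r * _ * _ * _; set v := 2 * (c * y); lia.
move: h5; have -> : 2 * r * (c * c) * d * y = (2 * c * d) * (r * c * y) by ring.
have -> : 2 * (c * (d * s)) = 2 * c * d * s by ring.
by rewrite leq_pmul2l // !muln_gt0 c0.
Qed.

(** * Degree counting with few cliques *)

Section Degrees.
Variables (r : nat) (F : fam) (e : rel nat) (c : nat).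
Hypotheses (r3 : 2 < r) (esym : symmetric e)
  (few : forall (U : seq nat) (L : fam), uniq U -> {subset U <= flatten F} -> uniq L ->
    (forall T : seq nat, T \in L -> [/\ sorted ltn T, 0 < size T < r, sub T U & clq e T]) ->
    size L <= c * size U).

(** As [2 < r], edges are among the cliques counted by [few], so [U] spans at most [c * size U] of
    them. An edge occurs at most twice among the pairs, once in each direction. *)
Lemma deg_count Y Z U m : uniq Y -> uniq Z -> uniq U -> {subset U <= flatten F} ->
  {subset Y <= U} -> {subset Z <= U} ->
  (forall x, x \in Y -> m <= size [seq z <- Z | (x != z) && e x z]) ->
  m * size Y <= 2 * (c * size U).
Proof.
move=> uY uZ uU UF YU ZU H.
pose P := [seq p <- [seq (x, z) | x <- Y, z <- Z] | (p.1 != p.2) && e p.1 p.2].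
have uP : uniq P by rewrite filter_uniq // allpairs_uniq // => -[? ?] [? ?].
have mP p : p \in P -> [/\ p.1 \in U, p.2 \in U, p.1 != p.2 & e p.1 p.2].
  rewrite mem_filter => /andP[/andP[ne ep] /allpairsP[q [qY qZ pE]]].
  by rewrite pE in ne ep *; rewrite /= YU // ZU.
apply: (@leq_trans (size P)).
  rewrite /P; elim: Y H {uY YU P uP mP} => [|x Y IHY] H; first by rewrite muln0.
  rewrite /= filter_cat size_cat mulnS leq_add //.
    by rewrite filter_map size_map; exact: H (mem_head _ _).
  by apply: IHY => y yY; apply: H; rewrite inE yY orbT.
have half (f : nat * nat -> seq nat) (lt : pred (nat * nat)) :
    {in lt &, injective f} -> (forall p, p \in P -> lt p ->
      [/\ sorted ltn (f p), size (f p) = 2 & perm_eq (f p) [:: p.1; p.2]]) ->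
    count lt P <= c * size U.
  move=> fi Hf; rewrite -size_filter -(size_map f).
  apply: few => //.
    rewrite map_inj_in_uniq ?(filter_uniq _ uP) // => p q; rewrite !mem_filter => /andP[lp _] /andP[lq _].
    exact: fi.
  move=> T /mapP[p]; rewrite mem_filter => /andP[ltp pP] ->.
  have [sf zf pf] := Hf p pP ltp; have [p1 p2 ne ep] := mP p pP; rewrite zf; split=> //.
    by apply/subP => x; rewrite (perm_mem pf) !inE => /orP[|] /eqP ->.
  apply/clqP => x y; rewrite !(perm_mem pf) !inE => /orP[|] /eqP -> /orP[|] /eqP ->; rewrite ?eqxx //.
  by rewrite esym.
have := count_predC (fun p => p.1 < p.2) P; move=> <-.
rewrite mul2n -addnn leq_add //.
  apply: (half (fun p => [:: p.1; p.2])) => [[? ?] [? ?] _ _ [-> ->] //|p _ lt].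
  by rewrite /= andbT; split.
have := half (fun p => [:: p.2; p.1]) (fun p => p.2 < p.1) _ _.
rewrite (@eq_in_count _ (predC (fun p => p.1 < p.2)) (fun p => p.2 < p.1) P); last first.
  by move=> p /mP[_ _ ne _] /=; rewrite -leqNgt leq_eqVlt eq_sym (negPf ne).
apply=> [[? ?] [? ?] _ _ [-> ->] //|p _ lt]; rewrite /= andbT; split=> //.
by rewrite -[[:: p.2; p.1]]/([:: p.2] ++ [:: p.1]) perm_catC.
Qed.

End Degrees.

Section Events.
Variables (r : nat) (F : fam) (yl : seq nat).
Hypothesis wfF : wf r F.
Let sF (A : seq nat) : A \in F -> sorted ltn A. Proof. by case: wfF => _ H _ _; exact: H. Qed.
Let zF (A : seq nat) : A \in F -> 0 < size A <= r. Proof. by case: wfF => _ _ H _; exact: H. Qed.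
Variables (e : rel nat) (c : nat).
Hypotheses (r3 : 2 < r) (esym : symmetric e) (cF : forall A : seq nat, A \in F -> clq e A)
  (few : forall (U : seq nat) (L : fam), uniq U -> {subset U <= flatten F} -> uniq L ->
    (forall T : seq nat, T \in L -> [/\ sorted ltn T, 0 < size T < r, sub T U & clq e T]) ->
    size L <= c * size U)
  (c0 : 0 < c) (thr_mono : forall i j, i <= j -> thr yl j <= thr yl i).

Lemma fz_clq s T : inv r F yl s -> T \in s.2 -> [/\ sorted ltn T, 0 < size T < r, sub T s.1 & clq e T].
Proof.
move=> invs TZ; have [A AF [sT T0 TM TA]] := fz_facts wfF invs TZ; split=> //.
exact: clq_sub TA (cF AF).
Qed.

Lemma petal_pos s T M P : inv r F yl s -> T \in s.2 -> P \in pet F T M -> 0 < size P.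
Proof.
move=> [_ _ _ _ HZ] /HZ[MT [A [_ _ AF nA [TE _]]]] /mapP[B].
rewrite mem_filter => /andP[/andP[TB _] BF] ->; rewrite lt0n; apply/eqP => B0.
have BT : sub B T.
  apply/subP => x xB; apply: contraT => xT; have : x \in dif B T by rewrite mem_dif xB.
  by move/eqP: B0; rewrite size_eq0 => /eqP ->.
have BA : sub B A by apply/subP => x /(subP _ _ BT); rewrite TE mem_cap => /andP[].
have [_ _ _ aF] := wfF; have E := aF _ _ BF AF BA; subst B.
by case/negP: nA; apply/subP => x /(subP _ _ BT); rewrite TE mem_cap => /andP[].
Qed.

Lemma petal_nb T M X (Q : fam) x : {subset Q <= pack (pet F T M)} -> subseq Q (pack (pet F T M)) ->
  all (hit X) Q -> x \in T -> size Q <= size [seq z <- undup X | (x != z) && e x z].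
Proof.
move=> QP sQ hQ xT.
have uQ : uniq (flatten Q).
  have : uniq (flatten (pack (pet F T M))) by apply: pack_uniq => A; exact: (pet_uniq wfF).
  apply: subseq_uniq; elim: (pack _) Q sQ {QP hQ} => [|B P IHP] [|A Q] //=; first by rewrite sub0seq.
  case: eqP => [-> /IHP|_ /IHP h]; first exact: cat_subseq.
  exact: subseq_trans h (suffix_subseq _ _).
apply: leq_trans (disjoint_hit uQ hQ) _; apply: uniq_leq_size.
  by rewrite filter_uniq // undup_uniq.
move=> z; rewrite mem_cap mem_filter => /andP[-> /flattenP[P /QP/pack_sub/mapP[A]]]; rewrite andbT.
rewrite mem_filter => /andP[/andP[TA _] AF] ->; rewrite mem_dif => /andP[zA zT].
have xz : x != z by apply: contraNneq zT => <-.
rewrite xz /=; move/clqP: (cF AF); apply=> //; exact: (subP _ _ TA).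
Qed.

(** Of the [4 * r * thr] disjoint petals that made [T] trusted, those missing [M] number at most
    [thr * r]: they all meet a maximal packing of fewer than [thr] petals. The others are hit in
    distinct vertices of [M], and these are neighbours of every vertex of [T]. *)
Lemma late_deg i s T x : inv r F yl s -> T \in late F yl i s -> x \in T ->
  3 * r * thr yl i <= size [seq z <- s.1 | (x != z) && e x z].
Proof.
move=> invs; rewrite mem_filter => /andP[/andP[/eqP zT lt] TZ] xT.
have [uM _ _ _ HZ] := invs; have [MT [A [MTM le AF nA _]]] := HZ T TZ; rewrite zT in le.
set P := pack (pet F T MT); pose Q := [seq B <- P | hit s.1 B].
have zQ' : size [seq B <- P | ~~ hit s.1 B] <= thr yl i * r.
  apply: (@leq_trans (nu F T s.1 * r)); last by rewrite leq_mul2r ltnW ?orbT.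
  apply: leq_trans (pack_pet_size wfF T s.1).
  have uP : uniq (flatten [seq B <- P | ~~ hit s.1 B]).
    have : uniq (flatten P) by apply: pack_uniq => D; exact: (pet_uniq wfF).
    apply: subseq_uniq; elim: (P) => //= B P' IHP; case: ifP => _ /=; first exact: cat_subseq.
    exact: subseq_trans IHP (suffix_subseq _ _).
  have hP : all (hit (flatten (pack (pet F T s.1)))) [seq B <- P | ~~ hit s.1 B].
    apply/allP => B; rewrite mem_filter => /andP[nh /pack_sub BP].
    apply: pack_max; last exact: (petal_pos invs TZ BP).
    move: BP => /mapP[D]; rewrite mem_filter => /andP[/andP[TD _] DF] BE.
    by rewrite BE; apply: map_f; rewrite mem_filter TD -BE nh.
  apply: leq_trans (disjoint_hit uP hP) _; apply: leq_trans (size_subseq (filter_subseq _ _)) _.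
  exact: size_undup.
have sQ : 3 * r * thr yl i <= size Q.
  have : size Q + size [seq B <- P | ~~ hit s.1 B] = size P.
    by rewrite -size_cat; apply: perm_size; apply/permPl; exact: perm_filterC.
  move: le zQ'; rewrite /nu -/P; move: (size P) (size Q) (size _) (thr yl i) => p q q' t.
  by rewrite -(mulnA 4) -(mulnA 3) [t * r]mulnC; move: (r * t) => u; lia.
apply: (leq_trans sQ); rewrite -(undup_id uM).
apply: (@petal_nb T MT) => //; last by apply/allP => B; rewrite mem_filter => /andP[].
  by move=> B; rewrite mem_filter => /andP[].
exact: filter_subseq.
Qed.

(** By [late_deg] and [deg_count] the vertices of late traces are fewer than those of [M] by a
    factor of order [r * thr], and the late traces number at most [c] times these vertices. Their
    remaining petals thus enlarge [M] by a factor that does not involve the threshold. *)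
Lemma late_few i s : inv r F yl s -> size (late F yl i s) * (thr yl i * r) <= c * c * size s.1.
Proof.
move=> invs; have [uM MF _ uZ HZ] := invs.
pose Y := undup (flatten (late F yl i s)).
have YM : {subset Y <= s.1}.
  move=> x; rewrite mem_undup => /flattenP[T]; rewrite mem_filter => /andP[_ TZ].
  by have [_ _ /subP TM _] := fz_clq invs TZ; exact: TM.
apply: (@late_arith r (thr yl i) c (size Y)).
  apply: (deg_count r3 esym few (Z := s.1)) => //; first exact: undup_uniq.
  move=> x; rewrite mem_undup => /flattenP[T Tl xT]; exact: late_deg Tl xT.
apply: few => //; first exact: undup_uniq.
- by move=> x /YM/MF.
- by rewrite filter_uniq.
move=> T Tl; have : T \in s.2 by move: Tl; rewrite mem_filter => /andP[].
move=> /(fz_clq invs)[sT T0 _ cT]; split=> //; apply/subP => x xT.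
by rewrite mem_undup; apply/flattenP; exists T.
Qed.

Lemma event_growth i s : inv r F yl s -> settled F s ->
  size (event r F yl i s).1 <=
    size s.1 * ((1 + c * c) * (1 + c * (4 * r * thr yl i.+1 * r)) ^ r).
Proof.
move=> invs st; have inv1 := inv_drop i invs.
apply: leq_trans (rounds_growth wfF cF few thr_mono r inv1 (deep_drop wfF invs st)) _.
rewrite [X in _ <= X]mulnA leq_mul2r /=; apply/orP; right.
apply: leq_trans (@size_grow r F wfF s.1 (late F yl i s) (thr yl i) _) _.
  by move=> T; rewrite mem_filter => /andP[/andP[_ /ltnW]].
by rewrite mulnDr muln1 leq_add2l mulnC [X in _ <= X]mulnC mulnC; exact: late_few.
Qed.

Variables (S : seq nat).
Hypotheses (uS : uniq S) (SF : {subset S <= flatten F}) (hS : hits S F).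

(** A solution missing [T] hits each of its packed petals, so all vertices of [T] have at least
    [thr] neighbours in [S] outside [R]. By [deg_count] such vertices are rare. The value
    [4 * r * (c * c) * d] of the threshold makes the traces of size [j] missed by [S] number at most
    a fraction [1 / r] of the solution vertices outside the current set. *)
Lemma unhit_few j d s R : 0 < d -> thr yl j = 4 * r * (c * c) * d -> inv r F yl s ->
  (forall T : seq nat, T \in s.2 -> size T = j -> exists2 M, {subset R <= M} & thr yl j <= nu F T M) ->
  size (dif S R) <= d * size (dif S s.1) ->
  r * size [seq T <- s.2 | (size T == j) && ~~ hit S T] <= size (dif S s.1).
Proof.
move=> d0 tE invs HR le; have [uM MF _ uZ HZ] := invs.
set N := [seq T <- s.2 | _]; pose Y := undup (flatten N).
have NZ T : T \in N -> [/\ T \in s.2, size T = j & ~~ hit S T].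
  by rewrite mem_filter => /andP[/andP[/eqP ? ?] ?].
have YF : {subset Y <= flatten F}.
  move=> x; rewrite mem_undup => /flattenP[T /NZ[TZ _ _]].
  by have [_ _ /subP TM _] := fz_clq invs TZ => /TM/MF.
have le1 : thr yl j * size Y <= 2 * (c * (size Y + size (dif S R))).
  apply: (@leq_trans (2 * (c * size (undup (Y ++ dif S R))))); last first.
    by rewrite !leq_mul2l -size_cat size_undup !orbT.
  apply: (deg_count r3 esym few (Z := dif S R)); rewrite ?undup_uniq ?filter_uniq //.
  - by move=> x; rewrite mem_undup mem_cat mem_dif => /orP[/YF|/andP[/SF]].
  - by move=> x xY; rewrite mem_undup mem_cat xY.
  - by move=> x xS; rewrite mem_undup mem_cat xS orbT.
  move=> x; rewrite mem_undup => /flattenP[T /NZ[TZ zT nh] xT].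
  have [M RM leM] := HR T TZ zT; apply: (leq_trans leM).
  have uD : uniq (dif S R) by rewrite filter_uniq.
  rewrite -(undup_id uD); apply: (@petal_nb T M) => //.
  apply/allP => P /pack_sub/mapP[A]; rewrite mem_filter => /andP[/andP[TA nM] AF] ->.
  have /hitP[z zA zS] := allP hS A AF.
  have zT' : z \notin T by apply: contra nh => zT'; apply/hitP; exists z.
  have zP : z \in dif A T by rewrite mem_dif zA.
  apply/hitP; exists z => //; rewrite mem_dif zS; apply: contra nM => zR.
  by apply/hitP; exists z => //; exact: RM.
have le2 : size N <= c * size Y.
  apply: few => //; rewrite ?undup_uniq ?filter_uniq // => T TN.
  have [TZ _ _] := NZ T TN; have [sT T0 _ cT] := fz_clq invs TZ; split=> //.
  by apply/subP => x xT; rewrite mem_undup; apply/flattenP; exists T.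
have r0 : 0 < r by apply: leq_trans r3.
apply: leq_trans (unhit_arith c0 d0 tE r0 le1 le).
by rewrite -mulnA leq_mul2l le2 orbT.
Qed.

End Events.

(* Each event of index [i] divides by [b ^ expo r i] the bound [k] on the number of vertices of
   the solution outside the current set. As [expo r i * ratio r ^ i] does not depend on [i] and
   [k <= b ^ (ratio r ^ r.-1) * l], at most [ratio r ^ i] of them leave more than [l] vertices. *)
Definition ratio r := r * r.+1.
Definition expo r j := ratio r ^ (r.-1 - j).
Definition thresholds r c b := [seq 4 * r * (c * c) * b ^ expo r j | j <- iota 0 r].

Lemma thrE r c b j : thr (thresholds r c b) j = if j < r then 4 * r * (c * c) * b ^ expo r j else 0.
Proof.
rewrite /thr /thresholds; case: ltnP => jr; last by rewrite nth_default // size_map size_iota.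
by rewrite (nth_map 0) ?size_iota // nth_iota.
Qed.

Lemma ratio_gt0 r : 0 < r -> 0 < ratio r. Proof. by rewrite /ratio; lia. Qed.

Lemma thr_antimono r c b i j : 0 < r -> 0 < b -> i <= j ->
  thr (thresholds r c b) j <= thr (thresholds r c b) i.
Proof.
move=> r0 b0 ij; rewrite !thrE; case: (ltnP j r) => // jr; rewrite (leq_ltn_trans ij jr).
rewrite leq_mul2l; apply/orP; right; apply: leq_pexp2l => //.
by apply: leq_pexp2l; [exact: ratio_gt0|lia].
Qed.

Fixpoint paths r F yl n s : seq (seq nat * fam) :=
  if n is n'.+1 then s :: flatten [seq paths r F yl n' (event r F yl i s) | i <- iota 1 r.-1]
  else [:: s].

(** Growth of the current set in an event of index [i]: the first factor is for the petals of the
    late traces, the power for the [r] rounds after them. *)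
Definition gfac r c b i := (1 + c * c) * (1 + c * (4 * r * thr (thresholds r c b) i.+1 * r)) ^ r.
Definition gbase r c := 1 + 16 * (r * r * r) * (c * c * c).

Lemma round_fac r c b j : 0 < b ->
  1 + c * (4 * r * thr (thresholds r c b) j * r) <= gbase r c * b ^ expo r j.
Proof.
move=> b0; rewrite thrE /gbase; have : 0 < b ^ expo r j by rewrite expn_gt0 b0.
move: (b ^ _) => x x0; case: ifP => _; last first.
  by rewrite !(muln0, mul0n) addn0 muln_gt0 x0 addn_gt0.
have -> : c * (4 * r * (4 * r * (c * c) * x) * r) = 16 * (r * r * r) * (c * c * c) * x by ring.
by rewrite mulnDl mul1n leq_add2r.
Qed.

Lemma expo_mul r i : i < r -> expo r i * ratio r ^ i = ratio r ^ r.-1.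
Proof. by move=> ir; rewrite /expo -expnD; congr expn; lia. Qed.

(** The product of [ratio r ^ i] and [expo r i.+1] is [ratio r ^ r.-2] for every [i] with
    [i.+1 < r], so all indices contribute the same power of [b]. For the last index the next
    threshold is 0 and only the constant remains. *)
Lemma gfac_le r c b i : 1 < r -> 0 < b -> 0 < i < r ->
  gfac r c b i ^ (ratio r ^ i) <= ((1 + c * c) * gbase r c ^ r) ^ (ratio r ^ i) * b ^ (r * ratio r ^ r.-2).
Proof.
move=> r1 b0 ir; rewrite /gfac.
have [ir'|ir'] := ltnP i.+1 r; last first.
  rewrite [thr _ _](_ : _ = 0); last by rewrite thrE ltnNge ir'.
  rewrite !(muln0, mul0n) addn0 exp1n muln1.
  apply: (@leq_trans (((1 + c * c) * gbase r c ^ r) ^ ratio r ^ i)); last first.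
    by rewrite leq_pmulr // expn_gt0 b0.
  rewrite leq_exp2r ?leq_pmulr ?expn_gt0 ?ratio_gt0 //; lia.
have -> : b ^ (r * ratio r ^ r.-2) = (b ^ (r * expo r i.+1)) ^ (ratio r ^ i).
  by rewrite -expnM -mulnA /expo -expnD; congr (_ ^ (_ * _ ^ _)); lia.
rewrite -expnMn leq_exp2r; last by rewrite expn_gt0 ratio_gt0 //; lia.
have E x : (1 + c * c) * gbase r c ^ r * b ^ (r * x) = (1 + c * c) * (gbase r c * b ^ x) ^ r.
  by rewrite expnMn -expnM [x * r]mulnC mulnA.
rewrite E leq_mul2l; apply/orP; right.
by case: (r) r1 => // r' _; rewrite leq_exp2r // round_fac.
Qed.

(** The last factor pays for rounding [b] up to an integer, see [beta_le]; the others collect the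
    constants of the start and of all events. *)
Definition sparse_factor r c := r * gbase r c ^ r * ((1 + c * c) * gbase r c ^ r) ^ (\sum_(1 <= i < r) ratio r ^ i)
  * 2 ^ (ratio r ^ r.-1).

Section Path.
Variables (r : nat) (F : fam) (b : nat) (e : rel nat) (c k l : nat).
Let yl := thresholds r c b.
Hypotheses (wfF : wf r F) (r3 : 2 < r) (esym : symmetric e)
  (cF : forall A : seq nat, A \in F -> clq e A)
  (few : forall (U : seq nat) (L : fam), uniq U -> {subset U <= flatten F} -> uniq L ->
    (forall T : seq nat, T \in L -> [/\ sorted ltn T, 0 < size T < r, sub T U & clq e T]) ->
    size L <= c * size U)
  (c0 : 0 < c) (b0 : 0 < b) (l0 : 0 < l) (kb : k <= b ^ (ratio r ^ r.-1) * l).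
Variable S : seq nat.
Hypotheses (uS : uniq S) (SF : {subset S <= flatten F}) (hS : hits S F) (Sk : size S <= k).

Let r0 : 0 < r. Proof. by apply: leq_trans r3. Qed.

Lemma iter_new n s T : T \in (iter n (round r F yl) s).2 -> T \in s.2 \/
  exists2 M, {subset s.1 <= M} & 4 * r * thr yl (size T) <= nu F T M.
Proof.
elim: n => [|n IHn]; first by left.
rewrite iterS mem_undup mem_cat mem_filter => /orP[/andP[le _]|/IHn //].
right; exists (iter n (round r F yl) s).1 => //; exact: (round_sub r F yl n s).1.
Qed.

(** [R i] is the current set just before the last event of index [i], or empty if there was none,
    and [n i] counts these events. A trusted trace of size [j] either survived the last event of
    index [j] or became trusted later, so it has [thr yl j] disjoint petals outside some set
    containing [R j]. *)
Definition rec_inv B0 (s : seq nat * fam) (R : nat -> seq nat) (n : nat -> nat) :=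
  [/\ inv r F yl s, settled F s,
    forall T : seq nat, T \in s.2 -> exists2 M, {subset R (size T) <= M} & thr yl (size T) <= nu F T M,
    forall i, 0 < i < r -> {subset R i <= s.1} /\ size (dif S (R i)) * b ^ (expo r i * n i) <= k
  & (forall i, n i <= ratio r ^ i) /\
    size s.1 <= B0 * \prod_(1 <= i < r) gfac r c b i ^ n i].

Definition final (s : seq nat * fam) :=
  size (dif S s.1) <= l \/ size [seq T <- s.2 | ~~ hit S T] <= size (dif S s.1).

(** For each of the [r - 1] possible sizes, [unhit_few] allows a fraction [1 / r] of the solution
    vertices outside the current set. *)
Lemma final_unhit s R n B0 : rec_inv B0 s R n ->
  (forall j, 0 < j < r -> size (dif S (R j)) <= b ^ expo r j * size (dif S s.1)) -> final s.
Proof.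
move=> [invs st HR Hk _] H; right.
rewrite -(leq_pmul2l r0); set N := [seq T <- s.2 | _].
have NE : size N = \sum_(1 <= j < r) size [seq T <- s.2 | (size T == j) && ~~ hit S T].
  rewrite size_filter; under eq_bigr do rewrite size_filter -sum1_count big_mkcond /=.
  rewrite -sum1_count big_mkcond exchange_big /= !big_seq; apply: eq_bigr => T TZ.
  case: (hit S T) => /=; first by under eq_bigr do rewrite andbF; rewrite big1_eq.
  have [_ /andP[T0 Tr] _ _] := fz_clq wfF cF invs TZ.
  rewrite (bigD1_seq (size T)) ?iota_uniq //= ?mem_index_iota ?T0 ?Tr //.
  rewrite eqxx big1 // => j /negPf; by rewrite eq_sym => ->.
rewrite NE big_distrr /=; apply: (@leq_trans (\sum_(1 <= j < r) size (dif S s.1))); last first.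
  rewrite big_const_nat iter_addn_0 mulnC leq_mul2r; apply/orP; right; lia.
rewrite !big_nat; apply: leq_sum => j jr.
have tE : thr yl j = 4 * r * (c * c) * b ^ expo r j by rewrite thrE; case/andP: jr => _ ->.
apply: (unhit_few wfF r3 esym cF few c0 uS SF hS _ tE invs _ (H j jr)).
  by rewrite expn_gt0 b0.
by move=> T TZ zT; rewrite -zT; exact: HR.
Qed.

(** As long as the state is not final, [final_unhit] yields an index [i] for which the part of [S]
    outside the current set has shrunk by more than [b ^ expo r i] since [R i] was recorded. An
    event of this index is taken; the algorithm does not know [S] and therefore enumerates all
    sequences of indices. *)
Lemma path_main B0 d s R n : rec_inv B0 s R n ->
  \sum_(1 <= i < r) ratio r ^ i < \sum_(1 <= i < r) n i + d ->
  exists s', [/\ s' \in paths r F yl d s, inv r F yl s', settled F s', final s'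
   & size s'.1 <= B0 * \prod_(1 <= i < r) gfac r c b i ^ (ratio r ^ i)].
Proof.
elim: d s R n => [|d IHd] s R n I.
  have [_ _ _ _ [nE _]] := I; rewrite addn0 ltnNge => /negP[].
  by apply: leq_sum.
move=> lt; have [invs st HR Hk [nE zs]] := I.
have fin : size s.1 <= B0 * \prod_(1 <= i < r) gfac r c b i ^ (ratio r ^ i).
  apply: leq_trans zs _; rewrite leq_mul2l; apply/orP; right.
  apply: leq_prod => i _; apply: leq_pexp2l => //.
  by rewrite /gfac muln_gt0 expn_gt0 !addn_gt0.
have [f|nf] := pselect (final s); first by exists s; rewrite mem_head.
have sl : l < size (dif S s.1) by rewrite ltnNge; apply/negP => le; apply: nf; left.
have [i [ir lti]] : exists i, 0 < i < r /\ b ^ expo r i * size (dif S s.1) < size (dif S (R i)).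
  have [//|H] := pselect (exists i, 0 < i < r /\ b ^ expo r i * size (dif S s.1) < size (dif S (R i))).
  case: nf; apply: (final_unhit I) => j jr; rewrite leqNgt; apply/negP => lt'.
  by case: H; exists j.
have [Ri lek] := Hk i ir.
have le2 : size (dif S s.1) * b ^ (expo r i * (n i).+1) <= k.
  apply: leq_trans lek; rewrite mulnS expnD mulnA leq_mul2r; apply/orP; right.
  by rewrite mulnC; exact: ltnW.
have nlt : n i < ratio r ^ i.
  rewrite ltnNge; apply/negP => ge; move: le2; rewrite leqNgt => /negP; apply.
  apply: leq_ltn_trans kb _; rewrite mulnC.
  apply: (@leq_ltn_trans (l * b ^ (expo r i * (n i).+1))).
    rewrite leq_mul2l; apply/orP; right; apply: leq_pexp2l => //.
    rewrite -(expo_mul (i := i)); last by case/andP: ir.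
    by rewrite leq_mul2l; apply/orP; right; apply: leqW.
  by rewrite ltn_pmul2r // expn_gt0 b0.
pose R' j := if j == i then s.1 else R j.
pose n' j := if j == i then (n i).+1 else n j.
have sumE : \sum_(1 <= j < r) n' j = (\sum_(1 <= j < r) n j).+1.
  rewrite !(bigD1_seq i) ?iota_uniq ?mem_index_iota //= /n' eqxx addSn; congr (_ + _).+1.
  by apply: eq_bigr => j /negPf ->.
have prodE : \prod_(1 <= j < r) gfac r c b j ^ n' j = \prod_(1 <= j < r) gfac r c b j ^ n j * gfac r c b i.
  have E1 : \prod_(1 <= j < r | j != i) gfac r c b j ^ n' j = \prod_(1 <= j < r | j != i) gfac r c b j ^ n j.
    by apply: eq_bigr => j; rewrite /n' => /negPf ->.
  rewrite !(bigD1_seq i) ?iota_uniq ?mem_index_iota //= E1 /n' eqxx expnSr.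
  exact: mulnAC.
have sub1 : {subset s.1 <= (event r F yl i s).1}.
  move=> x xs; apply: (round_sub r F yl r _).1; exact: grow_sub.
have I' : rec_inv B0 (event r F yl i s) R' n'.
  split.
  - exact: inv_event.
  - exact: settled_rounds.
  - move=> T TE; have [_ /andP[T0 Tr] _ _] := fz_clq wfF cF (inv_event i invs) TE.
    have [|[M sM le]] := iter_new TE.
      rewrite mem_filter => /andP[nl TZ]; rewrite /R'; case: eqP => [zT|_]; last exact: HR.
      exists s.1 => //; rewrite leqNgt; apply: contra nl => lt'; rewrite mem_filter TZ -zT eqxx.
      by rewrite lt'.
    exists M; last first.
      by apply: leq_trans le; rewrite leq_pmull // muln_gt0 r0.
    have TP : 0 < size T < r by rewrite T0.
    rewrite /R'; case: eqP => [_|_] x xR; apply: sM; apply: grow_sub => //.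
    exact: (Hk _ TP).1.
  - move=> j jr; rewrite /R' /n'; case: eqP => [->|_]; first by split.
    have [Rj lekj] := Hk j jr; split=> // x /Rj; exact: sub1.
  split; first by move=> j; rewrite /n'; case: eqP => [->|_].
  apply: leq_trans (event_growth wfF r3 esym cF few c0 _ i invs st) _.
    by move=> p q; apply: thr_antimono.
  by rewrite prodE [X in _ <= X]mulnA leq_mul2r zs orbT.
have [|s' [s'in a1 a2 a3 a4]] := IHd _ _ _ I'; first by rewrite sumE addSnnS.
exists s'; split=> //; rewrite inE; apply/orP; right; apply/flatten_mapP; exists i => //.
by rewrite mem_iota; case/andP: ir => -> ir; rewrite add1n prednK.
Qed.

End Path.

(** For positive [q] and [l], the least positive [b] with [k <= b ^ q * l], that is the [q]-th root
    of [k / l] rounded up, found by counting. In particular [beta 1 k.+1 l] is the least positive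
    [w] with [k < w * l]. *)
Definition beta q k l := (count (fun b => b ^ q * l < k) (iota 1 k.+1)).+1.

Lemma betaP q k l : 0 < q -> 0 < l ->
  k <= beta q k l ^ q * l /\ (0 < (beta q k l).-1 -> (beta q k l).-1 ^ q * l < k).
Proof.
move=> q0 l0; rewrite /beta; set p := fun b => _; set m := count _ _ => /=.
have mk : m <= k.+1 by have := count_size p (iota 1 k.+1); rewrite size_iota.
have mono b b' : b <= b' -> p b' -> p b.
  by move=> bb' /=; apply: leq_ltn_trans; rewrite leq_mul2r leq_exp2r ?bb' ?orbT.
split; last first.
  case mE : m => [|m'] // _; rewrite -[_ < k]/(p m'.+1) -[p _]negbK.
  apply/negP => np; have : m'.+1 <= m'; last by rewrite ltnn.
  rewrite -{1}mE /m; have [le|lt] := leqP m' k.+1; last first.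
    by rewrite -(size_iota 1 k.+1) in lt; apply: leq_trans (count_size _ _) (ltnW lt).
  rewrite -(subnK le) addnC iotaD count_cat.
  rewrite (_ : count p (iota (1 + m') _) = 0) ?addn0.
    by rewrite -[X in _ <= X](size_iota 1); exact: count_size.
  apply/eqP; rewrite -leqn0 leqNgt -has_count; apply/hasPn => b; rewrite mem_iota => /andP[mb _].
  by apply: contra np; apply: mono.
rewrite leqNgt; apply/negP => pm; have : m.+1 <= m; last by rewrite ltnn.
have mk' : m.+1 <= k.+1.
  rewrite ltnS leqNgt; apply/negP => km; move: pm; rewrite ltnNge => /negP; apply.
  apply: leq_trans (ltnW km) _; apply: (@leq_trans m.+1) => //.
  by rewrite -[m.+1 in X in X <= _]muln1 leq_mul // -{1}[m.+1]expn1 leq_pexp2l.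
rewrite {2}/m -(subnK mk') addnC iotaD count_cat; apply: leq_trans (leq_addr _ _).
rewrite -[X in X <= _](size_iota 1) -all_count || rewrite (eq_in_count (a2 := predT)) ?count_predT ?size_iota //.
by move=> b; rewrite mem_iota add1n ltnS => /andP[_ bm]; exact: (mono b m.+1).
Qed.

Lemma beta_le q k l w : 0 < q -> 0 < l -> k <= w * l -> 0 < w -> beta q k l ^ q <= 2 ^ q * w.
Proof.
move=> q0 l0 kw w0; have [_] := betaP k q0 l0.
case: (beta q k l) (isT : 0 < beta q k l) => [|[|b]] // _ /=.
  by move=> _; rewrite exp1n muln_gt0 expn_gt0 w0.
move=> /(_ isT) lt; apply: (@leq_trans ((2 * b.+1) ^ q)); first by rewrite leq_exp2r //; lia.
rewrite expnMn leq_mul2l; apply/orP; right.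
by apply: ltnW; rewrite -(ltn_pmul2r l0); exact: leq_trans lt kw.
Qed.

(** * The instances produced for sparse classes *)

Definition inst := (fam * nat * seq nat)%type.
Definition solvable (I : inst) := exists2 S, size S <= I.1.2 & hits S I.1.1.
Definition ok_inst (e : rel nat) (V0 : seq nat) N (I : inst) :=
  [/\ uniq I.2, {subset I.2 <= V0}, size I.2 <= N
    & forall A : seq nat, A \in I.1.1 -> [/\ 0 < size A, clq e A & sub A I.2]].

(** One kind of instance for each alternative of [final]: the trusted traces have to be hit as well,
    or the part [Z] of the solution outside the current set is guessed and the members that it
    misses are cut down to their traces. *)
Definition leaf_insts (F : fam) k (W : fam) N (s : seq nat * fam) : seq inst :=
  if size s.1 <= N then
    (s.2 ++ [seq A <- F | sub A s.1], k, s.1) ::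
    [seq ([seq cap A s.1 | A <- [seq A <- F | ~~ hit Z A]], k - size (undup Z), s.1)
    | Z <- [seq Z <- W | size (undup Z) <= k]]
  else [::].

Definition sparse_bound r c k w := k * (sparse_factor r c * w).
Definition sparse_depth r := (\sum_(1 <= i < r) ratio r ^ i).+1.
Definition sparse_insts r c (F : fam) k l (W : fam) : seq inst :=
  if size (pack F) <= k then
    flatten [seq leaf_insts F k W (sparse_bound r c k (beta 1 k.+1 l)) s
            | s <- paths r F (thresholds r c (beta (ratio r ^ r.-1) k l)) (sparse_depth r)
                     (start r F (thresholds r c (beta (ratio r ^ r.-1) k l)))]
  else [::].

Lemma paths_inv r F yl n s s' : wf r F -> inv r F yl s -> settled F s ->
  s' \in paths r F yl n s -> inv r F yl s' /\ settled F s'.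
Proof.
move=> wfF; elim: n s => [|n IHn] s invs st; first by rewrite inE => /eqP ->.
rewrite inE => /orP[/eqP ->//|/flatten_mapP[i _]]; apply: IHn; first exact: inv_event.
exact: settled_rounds.
Qed.

Section Insts.
Variables (r : nat) (F : fam) (e : rel nat) (c k l : nat).
Hypotheses (wfF : wf r F) (r3 : 2 < r) (esym : symmetric e)
  (cF : forall A : seq nat, A \in F -> clq e A)
  (few : forall (U : seq nat) (L : fam), uniq U -> {subset U <= flatten F} -> uniq L ->
    (forall T : seq nat, T \in L -> [/\ sorted ltn T, 0 < size T < r, sub T U & clq e T]) ->
    size L <= c * size U)
  (c0 : 0 < c) (l0 : 0 < l).
Let W := Wseq (undup (flatten F)) l.
Let w := beta 1 k.+1 l.
Let b := beta (ratio r ^ r.-1) k l.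
Let yl := thresholds r c b.
Let r0 : 0 < r. Proof. by apply: leq_trans r3. Qed.

Lemma sparse_sound I : I \in sparse_insts r c F k l W ->
  ok_inst e (undup (flatten F)) (sparse_bound r c k w) I /\
  (solvable I -> exists2 S, size S <= k & hits S F).
Proof.
rewrite /sparse_insts; case: ifP => // _ /flatten_mapP[s sin].
have [invs st] := paths_inv wfF (inv_start yl wfF) (settled_rounds yl wfF _) sin.
have [uM MF hM uZ HZ] := invs.
rewrite /leaf_insts; case: ifP => // zM; rewrite inE => /orP[/eqP ->|/mapP[Z]].
  split.
    split=> //= [x /MF|A]; first by rewrite mem_undup.
    rewrite mem_cat mem_filter => /orP[TZ|/andP[AM AF]].
      by have [_ /andP[T0 _] TM cT] := fz_clq wfF cF invs TZ.
    by split=> //; [case: wfF => _ _ /(_ A AF)/andP[]|exact: cF].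
  move=> [S /= Sk hS]; exists S => //; apply: covers_hits hS => A AF.
  have /orP[AM|/hasP[T TZ TA]] := settledP st AF.
    by exists A; rewrite ?sub_refl // mem_cat mem_filter AM AF orbT.
  by exists T; rewrite // mem_cat TZ.
rewrite mem_filter => /andP[Zk ZW] ->; split.
  split=> //= [x /MF|A /mapP[B]]; first by rewrite mem_undup.
  rewrite mem_filter => /andP[_ BF] ->; rewrite cap_pos ?hM //; split=> //.
    by apply: clq_sub (cF BF); apply/subP => x; rewrite mem_cap => /andP[].
  by apply/subP => x; rewrite mem_cap => /andP[].
move=> [S /= Sk hS]; exists (S ++ undup Z); first by rewrite size_cat -(subnK Zk) leq_add2r.
apply/allP => A AF; have [/hitP[x xA xZ]|nh] := boolP (hit Z A).
  by apply/hitP; exists x; rewrite // mem_cat mem_undup xZ orbT.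
have /hitP[x] : hit S (cap A s.1) by apply: (allP hS); apply: map_f; rewrite mem_filter nh.
by rewrite mem_cap => /andP[xA _] xS; apply/hitP; exists x; rewrite // mem_cat xS.
Qed.

Lemma sparse_complete S : size S <= k -> hits S F ->
  exists2 I, I \in sparse_insts r c F k l W & solvable I.
Proof.
move=> Sk0 hS0; pose S1 := undup [seq x <- S | x \in flatten F].
have Sk : size S1 <= k.
  by apply: leq_trans (size_undup _) _; apply: leq_trans Sk0; rewrite size_filter count_size.
have uS : uniq S1 by exact: undup_uniq.
have SF : {subset S1 <= flatten F} by move=> x; rewrite mem_undup mem_filter => /andP[].
have hS : hits S1 F.
  apply/allP => A AF; have /hitP[x xA xS] := allP hS0 A AF; apply/hitP; exists x => //.
  by rewrite mem_undup mem_filter xS andbT; apply/flattenP; exists A.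
move: (S1) Sk uS SF hS => {S1 Sk0 hS0}S Sk uS SF hS.
have pk : size (pack F) <= k.
  have uP : uniq (flatten (pack F)).
    by apply: pack_uniq => A AF; apply: sorted_ltn_uniq; case: wfF => _ /(_ A AF).
  have hP : all (hit S) (pack F) by apply/allP => A /pack_sub; exact: (allP hS).
  apply: leq_trans (disjoint_hit uP hP) _; apply: leq_trans Sk.
  by rewrite size_filter; apply: leq_trans (count_size _ _) (size_undup _).
rewrite /sparse_insts pk.
have q0 : 0 < ratio r ^ r.-1 by rewrite expn_gt0 ratio_gt0.
have [kb _] := betaP k q0 l0; have [kw _] := @betaP 1 k.+1 l isT l0.
rewrite -/b in kb; rewrite -/w expn1 in kw; have b0 : 0 < b by [].
have mono : forall i j, i <= j -> thr yl j <= thr yl i by move=> i j; exact: thr_antimono.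
set s0 := start r F yl.
have inv0 : inv r F yl s0 by exact: inv_start.
have [s [sin invs st fs zs]] : exists s, [/\ s \in paths r F yl (sparse_depth r) s0, inv r F yl s,
    settled F s, final l S s & size s.1 <= size s0.1 * \prod_(1 <= i < r) gfac r c b i ^ (ratio r ^ i)].
  apply: (@path_main _ F b e c k l wfF r3 esym cF few c0 b0 l0 kb S uS SF hS Sk _ _ _ (fun=> [::]) (fun=> 0)).
    split=> //; first exact: settled_rounds.
    - move=> T TZ; have [_ _ _ _ HZ] := inv0; have [MT [A [_ le _ _ _]]] := HZ T TZ.
      by exists MT => //; apply: leq_trans le; rewrite leq_pmull // muln_gt0 r0.
    - by move=> i _; split=> //; rewrite muln0 muln1; apply: leq_trans Sk; rewrite size_filter count_size.
    by split=> //; rewrite big1 ?muln1.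
  by rewrite [X in _ < X + _]big1_eq add0n.
have zs0 : size s0.1 <= k * r * (gbase r c * b ^ expo r 1) ^ r.
  have d1 : deep F 1 (flatten (pack F), [::]).
    move=> A; rewrite mem_filter => /andP[_ AF]; apply: cap_pos; apply: pack_max => //.
    by case: wfF => _ _ /(_ A AF)/andP[].
  have invp : inv r F yl (flatten (pack F), [::]).
    split=> //=.
    - by apply: pack_uniq => A AF; apply: sorted_ltn_uniq; case: wfF => _ /(_ A AF).
    - by move=> x /flattenP[A /pack_sub AF xA]; apply/flattenP; exists A.
    - by move=> A AF; apply: pack_max => //; case: wfF => _ _ /(_ A AF)/andP[].
  apply: leq_trans (rounds_growth wfF cF few mono r invp d1) _; apply: leq_mul.
    apply: (@leq_trans (size (pack F) * r)); last by rewrite leq_mul2r pk orbT.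
    by apply: size_flatten_le => A /pack_sub AF; case: wfF => _ _ /(_ A AF)/andP[].
  by rewrite leq_exp2r // /yl round_fac.
have zM : size s.1 <= sparse_bound r c k w.
  apply: (leq_trans zs); apply: leq_trans (leq_mul zs0 (leqnn _)) _.
  have : \prod_(1 <= i < r) gfac r c b i ^ (ratio r ^ i) <=
     \prod_(1 <= i < r) (((1 + c * c) * gbase r c ^ r) ^ (ratio r ^ i) * b ^ (r * ratio r ^ r.-2)).
    rewrite !big_nat; apply: leq_prod => i ir; apply: gfac_le => //; exact: ltnW.
  rewrite big_split /= -expn_sum || rewrite big_split /=.
  rewrite prod_nat_const_nat -expnM => hprod.
  apply: leq_trans (leq_mul (leqnn _) hprod) _.
  rewrite /sparse_bound /sparse_factor -/(expo r 1) expnMn.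
  have exE : ratio r ^ r.-2 = expo r 1 by rewrite /expo subn1.
  rewrite exE -(expnM b); set g := gbase r c ^ r.
  set Pi := _ ^ (\sum_(1 <= i < r) _).
  (* The start contributes the exponent [r * expo r 1] and each of the [r - 1] indices as much
     again. The sum [r * r * expo r 1] is at most [ratio r * expo r 1], which is [ratio r ^ r.-1];
     this is the reason for the choice of [ratio]. *)
  have bb : b ^ (expo r 1 * r) * b ^ (r * expo r 1 * (r - 1)) <= 2 ^ (ratio r ^ r.-1) * w.
    apply: (@leq_trans (b ^ (ratio r ^ r.-1))); last first.
      by apply: beta_le => //; exact: ltnW kw.
    rewrite -expnD; apply: leq_pexp2l => //.
    have -> : r.-1 = r.-2.+1 by case: (r) r3 => [|[|]].
    rewrite expnS exE /ratio; have : 0 < expo r 1 by rewrite expn_gt0 ratio_gt0.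
    move: (expo r 1) => x x0; clear -r0; nia.
  move: bb; set u := b ^ _; set v := b ^ _; set t := 2 ^ _ => bb.
  have -> : k * r * (g * u) * (Pi * v) = k * (r * g * Pi) * (u * v) by ring.
  have -> : k * (r * g * Pi * t * w) = k * (r * g * Pi) * (t * w) by ring.
  by rewrite leq_mul2l bb orbT.
have [le|le] := fs.
  pose Z := dif S s.1.
  have uZ : uniq Z by rewrite filter_uniq.
  exists ([seq cap A s.1 | A <- [seq A <- F | ~~ hit Z A]], k - size (undup Z), s.1).
    apply/flatten_mapP; exists s => //; rewrite /leaf_insts zM inE; apply/orP; right.
    apply/mapP; exists Z => //; rewrite mem_filter undup_id //; apply/andP; split.
      by apply: leq_trans Sk; rewrite size_filter count_size.
    rewrite /W mem_Wseq le; apply/allP => x; rewrite mem_dif mem_undup => /andP[xS _]; exact: SF.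
  exists (cap S s.1) => /=.
    have : size (cap S s.1) + size Z = size S by rewrite !size_filter count_predC.
    by rewrite undup_id //; move: Sk; move: (size S) (size Z) (size (cap _ _)) => p q q'; lia.
  apply/allP => B /mapP[A]; rewrite mem_filter => /andP[nh AF] ->.
  have /hitP[x xA xS] := allP hS A AF; apply/hitP; exists x; rewrite mem_cap ?xA ?xS //=.
    apply: contraR nh => xM; apply/hitP; exists x => //; by rewrite mem_dif xS.
  apply: contraR nh => xM; apply/hitP; exists x => //; by rewrite mem_dif xS.
exists (s.2 ++ [seq A <- F | sub A s.1], k, s.1).
  by apply/flatten_mapP; exists s => //; rewrite /leaf_insts zM mem_head.
(* The vertices of [S] outside the current set are traded for one vertex of each trusted trace that
   [S] misses; by the second alternative of [final] this costs no more. *)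
exists (cap S s.1 ++ [seq head 0 T | T <- [seq T <- s.2 | ~~ hit S T]]) => /=.
  rewrite size_cat size_map; apply: leq_trans Sk.
  have <- : size (cap S s.1) + size (dif S s.1) = size S by rewrite !size_filter count_predC.
  by rewrite leq_add2l.
apply/allP => A; rewrite mem_cat mem_filter => /orP[TZ|/andP[/subP AM AF]].
  have [/hitP[x xT xS]|nh] := boolP (hit S A).
    have [_ _ /subP TM _] := fz_clq wfF cF invs TZ.
    by apply/hitP; exists x; rewrite // mem_cat mem_cap xS TM.
  apply/hitP; exists (head 0 A).
    have [_ /andP[T0 _] _ _] := fz_clq wfF cF invs TZ; by case: (A) T0 => //= *; rewrite mem_head.
  by rewrite mem_cat; apply/orP; right; apply: map_f; rewrite mem_filter nh.
have /hitP[x xA xS] := allP hS A AF; apply/hitP; exists x => //.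
by rewrite mem_cat mem_cap xS AM.
Qed.

End Insts.

(** * Size bounds along the branching, and the dense case *)

Lemma flower_hearts r w F c R : flower r w F = Some (c, R) -> R \in hearts r F.
Proof.
rewrite /flower => H; have : (c, R) \in flowers r w F.
  by case: (flowers r w F) H => //= p s [->]; rewrite mem_head.
move=> /flatten_mapP[c' _ /flatten_mapP[j _ /mapP[R']]].
by rewrite mem_filter => /andP[_ RF] [_ ->].
Qed.

Section Sums.
Variable f : seq nat -> nat.
Hypothesis fmono : forall A B, subseq A B -> f A <= f B.

(** A heart is paid for by one member above it. The weight [f] is left general because the number of
    elements and the length of the encoding are both needed. *)
Lemma sum_hstep r F R : R \in hearts r F -> \sum_(A <- hstep R F) f A <= \sum_(A <- F) f A.
Proof.
rewrite mem_undup => /flatten_mapP[A AF /subs_subseq RA].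
rewrite big_cons [X in _ <= X](bigID (sub R)) /= leq_add //; last by rewrite big_filter.
have RA' : sub R A by apply/subP; exact: mem_subseq.
by rewrite (big_rem A) //= RA' (leq_trans (fmono RA)) ?leq_addr.
Qed.

Lemma sum_pstep c R F : \sum_(A <- pstep c R F) f A <= \sum_(A <- F) f A.
Proof.
rewrite big_cat [X in _ <= X](bigID (fun A => (size A == c) && sub R A)) /= leq_add //.
  rewrite big_map big_filter; apply: leq_sum => A _; apply: fmono; exact: filter_subseq.
rewrite big_filter [X in X <= _]big_mkcond [X in _ <= X]big_mkcond.
rewrite !big_seq; apply: leq_sum => A AF; case: ifP => // /hasPn H.
case: ifP => // /negbFE p; exfalso; have : dif A R \in petals c R F.
  by apply: map_f; rewrite mem_filter p.
by move/H => /negP; apply; apply/subP => x; rewrite mem_dif => /andP[].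
Qed.

Lemma sum_heartS r w F : \sum_(A <- heartS r w F) f A <= \sum_(A <- F) f A.
Proof.
by rewrite /heartS; case E: flower => [[c R]|] //; exact: sum_hstep (flower_hearts E).
Qed.

Lemma sum_iter r w n F : \sum_(A <- iter n (heartS r w) F) f A <= \sum_(A <- F) f A.
Proof. by elim: n => // n IHn; apply: leq_trans (sum_heartS _ _ _) IHn. Qed.

Lemma sum_petalS r w F F' : F' \in petalS r w F -> \sum_(A <- F') f A <= \sum_(A <- F) f A.
Proof.
by rewrite /petalS; case: flower => // cR; rewrite inE => /eqP ->; exact: sum_pstep.
Qed.

Lemma sum_expand r w F F' : F' \in expand r w F -> \sum_(A <- F') f A <= \sum_(A <- F) f A.
Proof.
by move=> /flatten_mapP[F1 /trajectP[n _ ->]] /sum_petalS/leq_trans; apply; exact: sum_iter.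
Qed.

Lemma sum_level r w t F F' : F' \in level r w t F -> \sum_(A <- F') f A <= \sum_(A <- F) f A.
Proof.
elim: t F' => [|t IHt] F'; first by rewrite inE => /eqP ->.
by move=> /flatten_mapP[F1 /IHt le /sum_expand le']; exact: leq_trans le' le.
Qed.

End Sums.

Lemma sum_size (F : fam) : \sum_(A <- F) size A = size (flatten F).
Proof. by rewrite size_flatten sumnE big_map. Qed.

(** A family has at most one petal step after each number of heart steps, and at most as many heart
    steps as elements. No step increases the total size, so the same factor serves for all
    levels. *)
Lemma size_level r w t F : size (level r w t F) <= (size (flatten F)).+1 ^ t.
Proof.
elim: t => // t IHt; rewrite [level _ _ _ _]/= expnSr.
have : forall F', F' \in level r w t F -> size (expand r w F') <= (size (flatten F)).+1.
  move=> F' F'in; rewrite /expand size_flatten /shape -map_comp.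
  have le1 F1 : size (petalS r w F1) <= 1 by rewrite /petalS; case: flower.
  apply: (@leq_trans (size (flatten F')).+1).
    rewrite -{2}(size_traject (heartS r w) F' (size (flatten F')).+1).
    elim: (traject _ _ _) => //= F1 s IHs; rewrite -add1n leq_add //; exact: le1.
  rewrite ltnS -!sum_size; apply: sum_level F'in; exact: size_subseq.
move=> H; apply: leq_trans (leq_mul IHt (leqnn _)).
elim: (level r w t F) H => //= F1 L IHL H; rewrite size_cat mulSn leq_add ?H ?mem_head //.
by apply: IHL => F' F'L; apply: H; rewrite inE F'L orbT.
Qed.

(** The cutoff makes the enumeration polynomial in its arguments, [lim] being a unary number.
    Earlier levels are kept, since a solution may end its path at any level. *)
Definition level_step r w lim (o : option (seq fam * seq fam)) :=
  if o is Some p then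
    if size (flatten [seq expand r w F | F <- p.2]) <= lim then
      Some (p.1 ++ p.2, flatten [seq expand r w F | F <- p.2])
    else None
  else None.
Definition levels r w lim T F := iter T (level_step r w lim) (Some ([::], [:: F])).

Lemma levels_some r w lim T F p : levels r w lim T F = Some p ->
  p.2 = level r w T F /\ forall F', (F' \in p.1) <-> exists2 t, t < T & F' \in level r w t F.
Proof.
elim: T p => [|T IHT] p; first by move=> [<-]; split=> // F'; split=> // -[].
rewrite /levels iterS -/(levels r w lim T F); case: (levels _ _ _ _ _) IHT => // q /(_ q erefl)[E H] /=.
case: ifP => // _ [<-] /=; rewrite E; split=> // F'; rewrite mem_cat; split.
  move=> /orP[/H[t tT tl]|Tl]; first by exists t => //; exact: ltnW.
  by exists T; rewrite // -E.
move=> [t]; rewrite ltnS leq_eqVlt => /orP[/eqP ->|tT] tl; apply/orP; [right|left] => //.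
by apply/H; exists t.
Qed.

Lemma levels_ok r w lim T F : (size (flatten F)).+1 ^ T <= lim -> levels r w lim T F != None.
Proof.
move=> le; suff H t : t <= T -> levels r w lim t F != None by exact: H.
elim: t => // t IHt tT; have := IHt (ltnW tT).
rewrite /levels iterS -/(levels r w lim t F); case E: (levels _ _ _ _ _) => [p|] // _ /=.
have [-> _] := levels_some E; rewrite (leq_trans _ le) //.
by apply: leq_trans (size_level r w t.+1 F) _; rewrite leq_pexp2l.
Qed.

Definition singles (F : fam) : seq nat := flatten [seq A <- F | size A == 1].
(** Too large a family has no solution by [noflower_size]. Singletons force their vertex; without
    them the clique bound of [size_clique] becomes applicable. *)
Definition leaf1 r w k (F : fam) : seq inst :=
  if (size F <= k * (r * w ^ r.-1)) && (size (singles F) <= k) then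
    [:: ([seq A <- F | size A != 1], k - size (singles F),
         undup (flatten [seq A <- F | size A != 1]))]
  else [::].
Definition dense_depth r l := 2 * 3 ^ r.-1 * l.
Definition dense_insts r lim (F : fam) k l : option (seq inst) :=
  if levels r (beta 1 k.+1 l) lim (dense_depth r l) F is Some p then
    Some (flatten [seq leaf1 r (beta 1 k.+1 l) k (chain r (beta 1 k.+1 l) F') | F' <- p.1 ++ p.2])
  else None.

Lemma mem_singles F x : (x \in singles F) = ([:: x] \in F).
Proof.
apply/flattenP/idP => [[A]|xF]; last by exists [:: x]; rewrite ?mem_head // mem_filter.
rewrite mem_filter => /andP[]; case: A => [|y [|z A]] // _ yF; by rewrite inE => /eqP ->.
Qed.

Lemma uniq_singles r F : wf r F -> uniq (singles F).
Proof.
move=> [uF _ _ _]; have : uniq [seq A <- F | size A == 1] by rewrite filter_uniq.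
rewrite /singles; have : all (fun A : seq nat => size A == 1) [seq A <- F | size A == 1] by exact: filter_all.
elim: [seq A <- F | _] => //= A L IHL /andP[A1 AL] /andP[nA uL]; rewrite cat_uniq IHL // andbT.
case: A A1 nA => [|x [|? ?]] //= _ nA; apply/hasPn => y /flattenP[B BL yB]; rewrite inE.
apply: contra nA => /eqP yx; have := allP AL B BL; case: B BL yB => [|z [|? ?]] // BL.
by rewrite inE yx => /eqP ->.
Qed.

Section Dense.
Variables (r : nat) (F : fam) (e : rel nat) (V0 : seq nat) (k l lim : nat).
Hypotheses (wfF : wf r F) (r0 : 0 < r)
  (cF : forall A : seq nat, A \in F -> clq e A) (FV : forall A : seq nat, A \in F -> sub A V0)
  (allF : forall B, sorted ltn B -> size B = r -> clq e B -> sub B V0 -> has (fun A => sub A B) F)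
  (l0 : 0 < l).
Let w := beta 1 k.+1 l.

Lemma good_pstep c R G : (forall A : seq nat, A \in G -> clq e A /\ sub A V0) ->
  forall A : seq nat, A \in pstep c R G -> clq e A /\ sub A V0.
Proof.
move=> H A; rewrite mem_cat mem_filter => /orP[/mapP[B]|/andP[_ /H]] //.
rewrite mem_filter => /andP[_ /H[cB BV]] ->.
have s : sub (dif B R) B by apply/subP => x; rewrite mem_dif => /andP[].
by split; [exact: clq_sub s cB|exact: sub_trans s BV].
Qed.

Lemma good_heartS G : (forall A : seq nat, A \in G -> clq e A /\ sub A V0) ->
  forall A : seq nat, A \in heartS r w G -> clq e A /\ sub A V0.
Proof.
rewrite /heartS => H A; case E: flower => [[c R]|]; last exact: H.
rewrite inE => /orP[/eqP ->|]; last by rewrite mem_filter => /andP[_ /H].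
have := flower_hearts E; rewrite mem_undup => /flatten_mapP[B /H[cB BV] /subs_subseq/mem_subseq RB].
have s : sub R B by exact/subP.
by split; [exact: clq_sub s cB|exact: sub_trans s BV].
Qed.

Lemma good_iter n G : (forall A : seq nat, A \in G -> clq e A /\ sub A V0) ->
  forall A : seq nat, A \in iter n (heartS r w) G -> clq e A /\ sub A V0.
Proof. by move=> H; elim: n => // n; exact: good_heartS. Qed.

Lemma good_level t G : G \in level r w t F -> forall A : seq nat, A \in G -> clq e A /\ sub A V0.
Proof.
elim: t G => [|t IHt] G; first by rewrite inE => /eqP -> A AF; split; [exact: cF|exact: FV].
move=> /flatten_mapP[G1 /IHt H /expandP[n [c [R [_ ->]]]]].
by apply: good_pstep; exact: good_iter.
Qed.

Lemma leaf1_spec G I : wf r G -> covers F G -> (forall A : seq nat, A \in G -> clq e A /\ sub A V0) ->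
  flower r w G = None -> I \in leaf1 r w k G ->
  [/\ ok_inst e V0 (k * (r * w ^ r.-1) * r) I, solvable I -> exists2 S, size S <= k & hits S F
    & forall X, sorted ltn X -> sub X I.2 -> clq e X -> size X <= r + 2 ^ r * w].
Proof.
move=> wfG cFG gG nof; rewrite /leaf1; case: ifP => // /andP[zG zs]; rewrite inE => /eqP ->.
have [uG sG zG' aG] := wfG; split=> /=.
- split=> /=; first exact: undup_uniq.
  + move=> x; rewrite mem_undup => /flattenP[A]; rewrite mem_filter => /andP[_ /gG[_ /subP AV]].
    exact: AV.
  + apply: leq_trans (size_undup _) _; apply: (@leq_trans (size G * r)); last by rewrite leq_mul2r zG orbT.
    apply: leq_trans (size_flatten_le (r := r) _) _.
      by move=> A; rewrite mem_filter => /andP[_ /zG'/andP[]].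
    by rewrite leq_mul2r size_filter count_size orbT.
  move=> A; rewrite mem_filter => /andP[A1 AG]; have [cA _] := gG A AG; split=> //.
    by case/andP: (zG' A AG).
  by apply/subP => x xA; rewrite mem_undup; apply/flattenP; exists A; rewrite // mem_filter A1.
- move=> [S /= Sk hS]; exists (S ++ singles G); first by rewrite size_cat -(subnK zs) leq_add2r.
  apply: covers_hits cFG _; apply/allP => A AG; case A1: (size A == 1); last first.
    have /hitP[x xA xS] : hit S A by apply: (allP hS); rewrite mem_filter A1.
    by apply/hitP; exists x; rewrite // mem_cat xS.
  case: A A1 AG => [|x [|? ?]] // _ xG; apply/hitP; exists x; rewrite ?mem_head //.
  by rewrite mem_cat mem_singles xG orbT.
move=> X sX XI cX.
have XV : sub X V0.
  apply/subP => x /(subP _ _ XI); rewrite mem_undup => /flattenP[A]; rewrite mem_filter.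
  by move=> /andP[_ /gG[_ /subP AV]]; exact: AV.
apply: (size_clique wfG _ nof sX) => // [x /(subP _ _ XI)|B sB BX zB].
  rewrite mem_undup => /flattenP[A]; rewrite mem_filter => /andP[A1 AG] xA.
  apply: contra A1 => xG; have E := aG _ _ xG AG; rewrite -E //.
  by apply/subP => y; rewrite inE => /eqP ->.
have /hasP[A AF AB] := allF sB zB (clq_sub BX cX) (sub_trans BX XV).
have [D DG DA] := cFG A AF; apply/hasP; exists D => //; exact: sub_trans DA AB.
Qed.

Lemma dense_sound L I : dense_insts r lim F k l = Some L -> I \in L ->
  [/\ ok_inst e V0 (k * (r * w ^ r.-1) * r) I, solvable I -> exists2 S, size S <= k & hits S F
    & forall X, sorted ltn X -> sub X I.2 -> clq e X -> size X <= r + 2 ^ r * w].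
Proof.
rewrite /dense_insts -/w; case E: levels => [p|] // [<-] /flatten_mapP[G Gp].
have [t Gt] : exists t, G \in level r w t F.
  have [E2 H] := levels_some E; move: Gp; rewrite mem_cat => /orP[/H[t _]|].
    by exists t.
  by rewrite E2; exists (dense_depth r l).
have w0 : 0 < w by [].
have [wfG cFG] := level_spec w0 wfF Gt.
apply: leaf1_spec; first exact: wf_chain.
- exact: covers_trans cFG (@covers_chain _ _ _).
- exact: good_iter (good_level Gt).
exact: chain_noflower.
Qed.

Lemma dense_complete L S : dense_insts r lim F k l = Some L -> size S <= k -> hits S F ->
  exists2 I, I \in L & solvable I.
Proof.
move=> E Sk hS; have w0 : 0 < w by [].
have [kw _] := @betaP 1 k.+1 l isT l0; rewrite -/w expn1 in kw.
have [t [G [tT Gt hG]]] := level_hits r0 w0 Sk wfF hS kw (leqnn (dense_depth r l)).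
move: E; rewrite /dense_insts -/w; case E: levels => [p|] // [<-].
have Gp : G \in p.1 ++ p.2.
  have [E2 H] := levels_some E; rewrite mem_cat; move: tT; rewrite leq_eqVlt => /orP[/eqP tE|lt].
    by rewrite E2 -tE Gt orbT.
  by apply/orP; left; apply/H; exists t.
have [wfG cFG] := level_spec w0 wfF Gt.
set G1 := chain r w G in hG; have wf1 : wf r G1 by exact: wf_chain.
have [u1 s1 z1 a1] := wf1; pose S' := undup S.
have uS' : uniq S' by exact: undup_uniq.
have sS : {subset singles G1 <= S'}.
  by move=> x; rewrite mem_singles mem_undup => /(allP hG); rewrite /hit /= orbF.
have zs : size (singles G1) + size (dif S' (singles G1)) = size S'.
  rewrite -(count_predC (fun x => x \in singles G1) S') size_filter; congr addn.
  rewrite -size_filter; apply: perm_size; apply: uniq_perm; rewrite ?(uniq_singles wf1) ?filter_uniq //.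
  by move=> x; rewrite mem_filter; case: (boolP (x \in singles G1)) => // /sS ->.
have S'k : size S' <= k by apply: leq_trans (size_undup _) Sk.
exists ([seq A <- G1 | size A != 1], k - size (singles G1), undup (flatten [seq A <- G1 | size A != 1])).
  apply/flatten_mapP; exists G => //; rewrite /leaf1 -/G1.
  rewrite (noflower_size wf1 w0 (chain_noflower w0 wfG) Sk hG) /=.
  rewrite (leq_trans _ S'k) ?mem_head // -zs; exact: leq_addr.
exists (dif S' (singles G1)) => /=.
  have sk : size (singles G1) <= k by apply: leq_trans S'k; rewrite -zs leq_addr.
  by rewrite -(leq_add2l (size (singles G1))) subnKC // zs.
apply/allP => A; rewrite mem_filter => /andP[A1 AG]; have /hitP[x xA xS] := allP hG A AG.
apply/hitP; exists x => //; rewrite mem_dif mem_undup xS mem_singles /=.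
apply: contra A1 => xG; rewrite -(a1 _ _ xG AG) //.
by apply/subP => y; rewrite inE => /eqP ->.
Qed.

End Dense.

(** * The kernel and a single attempt *)

Definition kernel r k (F : fam) : fam :=
  if size (chain r k.+1 F) <= k * (r * k.+1 ^ r.-1) then chain r k.+1 F else [:: [::]].

Definition solve1 lim W (I : inst) := dp lim I.1.1 I.1.2 (dporder I.1.1 W I.2).
Definition is_yes (o : option bool) := if o is Some b then b else false.
Definition is_fail (o : option bool) := if o is Some b then false else true.
(** One positive instance suffices even if others gave up, whereas a negative answer needs them
    all. *)
Definition combine (R : seq (option bool)) : option bool :=
  if has is_yes R then Some true else if has is_fail R then None else Some false.

(* [dense] selects the branching; [P] bounds the number of objects that an attempt enumerates. *)
Definition insts (dense : bool) r c (F : fam) k l (W : fam) P : option (seq inst) :=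
  if dense then dense_insts r (P ^ (2 * 3 ^ r.-1)) F k l else Some (sparse_insts r c F k l W).
Definition attempt dense r c (F : fam) k l (W : fam) P : option bool :=
  if [::] \in F then Some false else
  if insts dense r c F k l W P is Some L then combine (map (solve1 (P ^ 2) W) L) else None.

(** A padding argument: with this number at hand in unary, all enumerations of an attempt are
    polynomial in the size of its input. *)
Definition padding (F : fam) k l := (size (flatten F) + k + 2) ^ l.

Lemma insts_budget dense r c F k l W P L I :
  insts dense r c F k l W P = Some L -> I \in L -> I.1.2 <= k.
Proof.
rewrite /insts; case: dense.
  rewrite /dense_insts; case: levels => // p [<-] /flatten_mapP[F' _].
  by rewrite /leaf1; case: ifP => // _; rewrite inE => /eqP -> /=; exact: leq_subr.
move=> [<-]; rewrite /sparse_insts; case: ifP => // _ /flatten_mapP[s _].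
rewrite /leaf_insts; case: ifP => // _; rewrite inE => /orP[/eqP -> //|/mapP[Z _ ->]].
exact: leq_subr.
Qed.

(** Hearts for [w = k + 1] are forced, so the chain keeps all solutions of size at most [k]. If it
    ends with too many sets there is no solution, which is expressed by the family whose only member
    is empty and cannot be hit. *)
Lemma kernelP r k F S : wf r F -> size S <= k -> hits S F = hits S (kernel r k F).
Proof.
move=> wfF Sk; rewrite /kernel; case: leqP => le; last first.
  rewrite [RHS]/= ; apply/negbTE/negP => hS; move: le; rewrite ltnNge => /negP; apply.
  by apply: (noflower_size (wf_chain _ wfF) _ (chain_noflower _ wfF) Sk) => //; exact: hits_chain.
by apply/idP/idP => [/(hits_chain wfF Sk)|]; [|apply: covers_hits; exact: covers_chain].
Qed.

Lemma kernel_size r k F : wf r F -> size (flatten (kernel r k F)) <= k * (r * k.+1 ^ r.-1) * r.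
Proof.
move=> wfF; rewrite /kernel; case: ifP => // le.
have [_ _ z _] := wf_chain (ltn0Sn k) wfF.
apply: (leq_trans (size_flatten_le (r := r) _)) => [A /z/andP[] //|].
by rewrite leq_mul2r le orbT.
Qed.

Lemma wf_kernel r k F : wf r F -> [::] \notin kernel r k F -> wf r (kernel r k F).
Proof. by move=> wfF; rewrite /kernel; case: leqP => // _ _; exact: wf_chain. Qed.

Section Attempt.
Variables (G : sgraph) (dense : bool) (r c k l : nat) (F : fam).
Let e := radj (adjacency_rows G).
Let V0 := undup (flatten F).
Let w := beta 1 k.+1 l.
Hypotheses (r0 : 0 < r) (l0 : 0 < l) (wfF : [::] \notin F -> wf r F)
  (cF : forall A : seq nat, A \in F -> clq e A)
  (allF : forall B, sorted ltn B -> size B = r -> clq e B -> sub B V0 -> has (fun A => sub A B) F)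
  (few : ~~ dense -> 2 < r /\ 0 < c /\
    forall (U : seq nat) (L : fam), uniq U -> {subset U <= flatten F} -> uniq L ->
    (forall T : seq nat, T \in L -> [/\ sorted ltn T, 0 < size T < r, sub T U & clq e T]) ->
    size L <= c * size U).
Let W := Wseq V0 l.
Let P := padding F k l.

Definition size_bound := if dense then k * (r * w ^ r.-1) * r else sparse_bound r c k w.

Lemma insts_sound L I : [::] \notin F -> insts dense r c F k l W P = Some L -> I \in L ->
  [/\ ok_inst e V0 size_bound I, solvable I -> exists2 S, size S <= k & hits S F
   & dense -> forall X, sorted ltn X -> sub X I.2 -> clq e X -> size X <= r + 2 ^ r * w].
Proof.
move=> nF; rewrite /insts /size_bound; move: few; case: dense => [_|/(_ isT)[r3 [c0 few']]].
  move=> /dense_sound/[apply]; move/(_ e V0 (wfF nF) cF).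
  case=> // A AF; apply/subP => x xA; rewrite mem_undup; apply/flattenP; by exists A.
move=> [<-] Iin; have [a b] := sparse_sound (wfF nF) cF Iin.
by split.
Qed.

Lemma insts_complete L S : [::] \notin F -> insts dense r c F k l W P = Some L ->
  size S <= k -> hits S F -> exists2 I, I \in L & solvable I.
Proof.
move=> nF; rewrite /insts; move: few; case: dense => [_|/(_ isT)[r3 [c0 few']] [<-]].
  by apply: dense_complete => //; exact: wfF.
by apply: (sparse_complete (e := e)) => //; [exact: wfF|exact: radj_sym].
Qed.

Lemma solve1_sound lim I N b : ok_inst e V0 N I -> solve1 lim W I = Some b -> b <-> solvable I.
Proof.
move=> [uV VV0 zV HI]; rewrite /solve1; case: b => E; split=> //.
  by move=> _; exact: dp_true E.
move=> [S Sk hS]; have := dp_false _ E Sk; rewrite hS => /(_ _)/negP; case=> // A /HI[_ _ /subP AV].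
by apply/subP => x /AV; rewrite (perm_mem (perm_dporder _ _ _)).
Qed.

Lemma attempt_sound b : attempt dense r c F k l W P = Some b ->
  b <-> exists2 S, size S <= k & hits S F.
Proof.
rewrite /attempt; case: ifP => [nil [<-]|/negbT nF].
  by split=> // -[S _ /allP/(_ _ nil)].
case E: insts => [L|] //; rewrite /combine; case: ifP => [/hasP[x /mapP[I IL ->] y] [<-]|/negbT ny].
  split=> // _; have [ok H _] := insts_sound nF E IL; apply: H.
  case E1: solve1 y => [[]|] // _; by apply/(solve1_sound ok E1).
case: ifP => // /negbT nf [<-]; split=> // -[S Sk hS].
have [I IL sI] := insts_complete nF E Sk hS; have [ok _ _] := insts_sound nF E IL.
have nyI := hasPn ny _ (map_f (solve1 (P ^ 2) W) IL).
have nfI := hasPn nf _ (map_f (solve1 (P ^ 2) W) IL).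
case E1: solve1 nyI nfI => [[]|] // _ _; have := solve1_sound ok E1.
by case=> _ /(_ sI).
Qed.

(** The cutoffs fit: a level has at most [(size (flatten F)).+1 ^ dense_depth r l] families, and
    [dense_depth] is [2 * 3 ^ r.-1 * l], which gives the power [2 * 3 ^ r.-1] of [P]. In [P ^ 2],
    one factor is for the choices on a front and one for the budgets. *)
Lemma attempt_ok :
  (forall V, uniq V -> {subset V <= V0} -> size V <= size_bound ->
    (dense -> forall X, sorted ltn X -> sub X V -> clq e X -> size X <= r + 2 ^ r * w) ->
    size V <= l \/ treewidth (isub G V) < l) ->
  attempt dense r c F k l W P != None.
Proof.
move=> H; rewrite /attempt; case: ifP => // /negbT nF.
have P0 : (size V0).+1 <= size (flatten F) + k + 2.
  rewrite -addnA; apply: leq_ltn_trans (size_undup _) _.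
  by rewrite -[X in X < _]addn0 ltn_add2l addn2.
have [L E] : exists L, insts dense r c F k l W P = Some L.
  rewrite /insts; case: dense; last by exists (sparse_insts r c F k l W).
  rewrite /dense_insts; case E: levels => [p|]; first by exists (flatten [seq leaf1 r (beta 1 k.+1 l) k (chain r (beta 1 k.+1 l) F') | F' <- p.1 ++ p.2]).
  have : levels r (beta 1 k.+1 l) (P ^ (2 * 3 ^ r.-1)) (dense_depth r l) F != None.
    apply: levels_ok; rewrite /P /padding /dense_depth -expnM mulnC.
    have : 0 < l * (2 * 3 ^ r.-1) by rewrite !muln_gt0 l0 expn_gt0.
    by case: (l * _) => // m _; rewrite leq_exp2r //; lia.
  by rewrite E.
rewrite E /combine; case: ifP => // _; case: ifP => // /hasP[x /mapP[I IL ->]].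
have [[uV VV0 zV HI] _ Hd] := insts_sound nF E IL.
suff : solve1 (P ^ 2) W I != None by case: solve1.
have HW z : z \in W = (size z <= l) && all (fun x => x \in V0) z by exact: mem_Wseq.
apply: (dp_ok (l := l)) => //.
- by move=> A /HI[].
- by move=> A /HI[].
- by move=> X; rewrite HW => /andP[].
- apply: (isub_separator (G := G)) => //.
  + by move=> z zl zV'; rewrite HW zl; apply/allP => y /zV'/VV0.
  + by move=> A /HI[].
  exact: H.
have le1 : (size I.2).+1 ^ l <= P.
  rewrite /P /padding; case: (l) l0 => // l' _; rewrite leq_exp2r //.
  by apply: leq_trans P0; rewrite ltnS; exact: uniq_leq_size.
have le2 : k.+1 <= P.
  rewrite /P /padding; case: (l) l0 => // l' _; apply: (@leq_trans ((size (flatten F) + k + 2) ^ 1)).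
    by rewrite expn1; lia.
  by rewrite leq_pexp2l //; lia.
have le3 : I.1.2 <= k by exact: insts_budget E IL.
by rewrite -mulnn leq_mul //; apply: leq_trans le2.
Qed.

End Attempt.

(** * Running time *)

Lemma PT_flatmapc {C} {EC : Enc C} I X {EX : Enc X} (l : seq I) (g : C -> I -> seq X) :
  (forall i, PT (fun c => g c i)) -> PT (fun c => flatten [seq g c i | i <- l]).
Proof.
move=> H; elim: l => [|i l IHl]; first exact: PT_const.
by apply: (PT_ext (f := fun c => g c i ++ flatten [seq g c i | i <- l])) => //; exact: PT_cat.
Qed.

Lemma PT_mapc {C} {EC : Enc C} I X {EX : Enc X} (l : seq I) (g : C -> I -> X) :
  (forall i, PT (fun c => g c i)) -> PT (fun c => [seq g c i | i <- l]).
Proof.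
move=> H; elim: l => [|i l IHl]; first exact: PT_const.
by apply: (PT_ext (f := fun c => g c i :: [seq g c i | i <- l])) => //; exact: PT_cons.
Qed.

Lemma PT_iterc {C} {EC : Enc C} Z {EZ : Enc Z} n (h : C -> Z -> Z) (z : C -> Z) :
  PT (fun p : C * Z => h p.1 p.2) -> PT z -> PT (fun c => iter n (h c) (z c)).
Proof.
move=> ph pz; elim: n => // n IHn.
exact: (PT_comp ph (PT_pair PT_id IHn)).
Qed.

(** Extension point of [pt], which proves polynomial time by recursion on the body of a function;
    every function treated below is added here. *)
Ltac pt_user := fail.
Ltac pt_var :=
  match goal with
  | |- PT (fun x => x) => exact: PT_id
  | |- PT fst => exact: (PT_fst PT_id)
  | |- PT snd => exact: (PT_snd PT_id)
  | H : PT ?f |- PT ?g => first [constr_eq f g; exact: H | change (PT f); exact H]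
  | H : PT ?f |- PT (fun x => ?f (@?g x)) => refine (PT_comp H _)
  end.
Ltac pt_step :=
  cbv beta;
  first [ lazymatch goal with |- PT (fun _ => ?b) => exact: PT_const end | pt_var | pt_user |
  lazymatch goal with
  | |- PT (fun c => fst (@?f c)) => refine (@PT_fst _ _ _ _ _ _ f _)
  | |- PT (fun c => snd (@?f c)) => refine (@PT_snd _ _ _ _ _ _ f _)
  | |- PT (fun c => (@?f c, @?g c)) => refine (@PT_pair _ _ _ _ _ _ f g _ _)
  | |- PT (fun c => negb (@?f c)) => refine (@PT_not _ _ f _)
  | |- PT (fun c => andb (@?f c) (@?g c)) => refine (@PT_and _ _ f g _ _)
  | |- PT (fun c => orb (@?f c) (@?g c)) => refine (@PT_or _ _ f g _ _)
  | |- PT (fun c => eq_op (@?f c) (@?g c)) => refine (@PT_eq _ _ _ _ _ f g _ _)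
  | |- PT (fun c => in_mem (@?f c) (mem (@?g c))) => refine (@PT_mem _ _ _ _ _ f g _ _)
  | |- PT (fun c => leq (@?f c) (@?g c)) => refine (@PT_leq _ _ f g _ _)
  | |- PT (fun c => cons (@?f c) (@?g c)) => refine (@PT_cons _ _ _ _ f g _ _)
  | |- PT (fun c => Some (@?f c)) => refine (@PT_some _ _ _ _ f _)
  | |- PT (fun c => S (@?f c)) => refine (@PT_S _ _ f _)
  | |- PT (fun c => predn (@?f c)) => refine (@PT_pred _ _ f _)
  | |- PT (fun c => addn (@?f c) (@?g c)) => refine (@PT_add _ _ f g _ _)
  | |- PT (fun c => subn (@?f c) (@?g c)) => refine (@PT_sub _ _ f g _ _)
  | |- PT (fun c => muln (@?f c) (@?g c)) => refine (@PT_mul _ _ f g _ _)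
  | |- PT (fun c => expn (@?f c) ?n) => refine (@PT_exp _ _ f n _)
  | |- PT (fun c => inl (@?f c)) => refine (@PT_inl _ _ _ _ _ _ f _)
  | |- PT (fun c => inr (@?f c)) => refine (@PT_inr _ _ _ _ _ _ f _)
  | |- PT (fun c => map (@?f c) (@?s c)) => refine (@PT_map _ _ _ _ _ _ s f _ _)
  | |- PT (fun c => seq.filter (@?f c) (@?s c)) => refine (@PT_filter _ _ _ _ s f _ _)
  | |- PT (fun c => has (@?f c) (@?s c)) => refine (@PT_has _ _ _ _ s f _ _)
  | |- PT (fun c => all (@?f c) (@?s c)) => refine (@PT_all _ _ _ _ s f _ _)
  | |- PT (fun c => count (@?f c) (@?s c)) => refine (@PT_count _ _ _ _ s f _ _)
  | |- PT (fun c => flatten (@?s c)) => refine (@PT_flatten _ _ _ _ s _)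
  | |- PT (fun c => cat (@?f c) (@?g c)) => refine (@PT_cat _ _ _ _ f g _ _)
  | |- PT (fun c => undup (@?s c)) => refine (@PT_undup _ _ _ _ _ s _)
  | |- PT (fun c => size (@?s c)) => refine (@PT_size _ _ _ _ s _)
  | |- PT (fun c => rev (@?s c)) => refine (@PT_rev _ _ _ _ s _)
  | |- PT (fun c => ohead (@?s c)) => refine (@PT_ohead _ _ _ _ s _)
  | |- PT (fun c => iota (@?f c) (@?g c)) => refine (@PT_iota _ _ f g _ _)
  | |- PT (fun c => nth ?x (@?f c) (@?g c)) => refine (@PT_nth _ _ _ _ f x g _ _)
  end
  | eapply PT_if | eapply PT_match_seq | eapply PT_match_option | eapply PT_match_nat ].
Ltac pt := repeat pt_step.

Lemma PT_hit {C} {EC : Enc C} (S A : C -> seq nat) : PT S -> PT A -> PT (fun c => hit (S c) (A c)).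
Proof. by move=> pS pA; rewrite /hit; pt. Qed.

Lemma PT_subset {C} {EC : Enc C} (R A : C -> seq nat) : PT R -> PT A -> PT (fun c => sub (R c) (A c)).
Proof. by move=> pR pA; rewrite /sub; pt. Qed.

Lemma PT_dif {C} {EC : Enc C} (A R : C -> seq nat) : PT A -> PT R -> PT (fun c => dif (A c) (R c)).
Proof. by move=> pA pR; rewrite /dif; pt. Qed.

Lemma PT_cap {C} {EC : Enc C} (A R : C -> seq nat) : PT A -> PT R -> PT (fun c => cap (A c) (R c)).
Proof. by move=> pA pR; rewrite /cap; pt. Qed.

Ltac pt_u1 := lazymatch goal with
  | |- PT (fun c => hit (@?f c) (@?g c)) => refine (@PT_hit _ _ f g _ _)
  | |- PT (fun c => sub (@?f c) (@?g c)) => refine (@PT_subset _ _ f g _ _)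
  | |- PT (fun c => dif (@?f c) (@?g c)) => refine (@PT_dif _ _ f g _ _)
  | |- PT (fun c => cap (@?f c) (@?g c)) => refine (@PT_cap _ _ f g _ _)
  end.
Ltac pt_user ::= pt_u1.

Lemma PT_hits {C} {EC : Enc C} (S : C -> seq nat) F : PT S -> PT F -> PT (fun c => hits (S c) (F c)).
Proof. by move=> pS pF; rewrite /hits; pt. Qed.

Lemma PT_cnt {C} {EC : Enc C} (F : C -> fam) R n : PT F -> PT R -> PT n -> PT (fun c => cnt (F c) (R c) (n c)).
Proof. by move=> pF pR pn; rewrite /cnt; pt. Qed.

Lemma PT_subs0 n : PT (subs n).
Proof.
elim: n => [|n IHn]; first exact: PT_const.
apply: (PT_ext (f := fun A : seq nat => if A is x :: A' then [seq x :: B | B <- subs n A'] ++ subs n A' else [:: [::]])).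
  by case.
by pt.
Qed.

Lemma PT_subs {C} {EC : Enc C} n (A : C -> seq nat) : PT A -> PT (fun c => subs n (A c)).
Proof. by move=> pA; refine (PT_comp (PT_subs0 n) pA). Qed.

Lemma PT_hearts {C} {EC : Enc C} r (F : C -> fam) : PT F -> PT (fun c => hearts r (F c)).
Proof. by move=> pF; rewrite /hearts; pt; apply: PT_subs; pt. Qed.

Lemma PT_flower {C} {EC : Enc C} r (w : C -> nat) (F : C -> fam) : PT w -> PT F -> PT (fun c => flower r (w c) (F c)).
Proof.
move=> pw pF; rewrite /flower /flowers; apply: PT_ohead; apply: PT_flatmapc => i; apply: PT_flatmapc => j.
rewrite /is_flower; pt; first exact: PT_hearts.
by apply: PT_cnt; pt.
Qed.

Lemma PT_hstep {C} {EC : Enc C} (R : C -> seq nat) F : PT R -> PT F -> PT (fun c => hstep (R c) (F c)).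
Proof. by move=> pR pF; rewrite /hstep; pt. Qed.

Lemma PT_petals {C} {EC : Enc C} (n : C -> nat) (R : C -> seq nat) F : PT n -> PT R -> PT F -> PT (fun c => petals (n c) (R c) (F c)).
Proof. by move=> pn pR pF; rewrite /petals; pt. Qed.

Lemma PT_pstep {C} {EC : Enc C} (n : C -> nat) (R : C -> seq nat) F : PT n -> PT R -> PT F -> PT (fun c => pstep (n c) (R c) (F c)).
Proof.
move=> pn pR pF; rewrite /pstep; have pp := PT_petals pn pR pF; pt; exact: (PT_comp pp (PT_fst PT_id)).
Qed.

Ltac pt_u2 := lazymatch goal with
  | |- PT (fun c => hits (@?f c) (@?g c)) => refine (@PT_hits _ _ f g _ _)
  | |- PT (fun c => cnt (@?f c) (@?g c) (@?h c)) => refine (@PT_cnt _ _ f g h _ _ _)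
  | |- PT (fun c => subs ?n (@?f c)) => refine (@PT_subs _ _ n f _)
  | |- PT (fun c => hearts ?n (@?f c)) => refine (@PT_hearts _ _ n f _)
  | |- PT (fun c => flower ?n (@?f c) (@?g c)) => refine (@PT_flower _ _ n f g _ _)
  | |- PT (fun c => hstep (@?f c) (@?g c)) => refine (@PT_hstep _ _ f g _ _)
  | |- PT (fun c => pstep (@?f c) (@?g c) (@?h c)) => refine (@PT_pstep _ _ f g h _ _ _)
  end.
Ltac pt_user ::= first [pt_u1 | pt_u2].

Lemma PT_heartS {C} {EC : Enc C} r (w : C -> nat) F : PT w -> PT F -> PT (fun c => heartS r (w c) (F c)).
Proof. by move=> pw pF; rewrite /heartS; pt. Qed.

Definition szs (A : seq nat) := sz A.
Definition szf (F : fam) := sz F.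

Lemma sz_sub (A B : seq nat) : subseq A B -> (szs A).+1 <= (szs B).+1.
Proof.
rewrite ltnS; elim: B A => [|y B IHB] [|x A] H; [by []|by []|exact: sz_gt0|].
have E z D : szs (z :: D) = (sz z + szs D).+1 by [].
by move: H; rewrite /= !E; case: eqP => [->|_] /IHB; rewrite ?E; lia.
Qed.

Lemma sz_heartS r w F : sz (heartS r w F) <= sz F.
Proof. by rewrite !sz_seqE ltnS; apply: sum_heartS; exact: sz_sub. Qed.

Lemma sz_iter_heartS r w n F : sz (iter n (heartS r w) F) <= sz F.
Proof. by elim: n => // n IHn; apply: leq_trans (sz_heartS _ _ _) IHn. Qed.

Lemma sz_expand r w F F' : F' \in expand r w F -> sz F' <= sz F.
Proof. by move=> H; rewrite !sz_seqE ltnS; apply: (sum_expand sz_sub H). Qed.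

Lemma PT_chain {C} {EC : Enc C} r (w : C -> nat) (F : C -> fam) : PT w -> PT F -> PT (fun c => chain r (w c) (F c)).
Proof.
move=> pw pF; rewrite /chain.
refine (PT_iter (T := fun c => sz (F c)) _ pF _ (PT_polyb pF) _); first by pt.
  by refine (PT_heartS r _ _); pt.
by move=> c i _; exact: sz_iter_heartS.
Qed.

Lemma sz_bound_in (X : eqType) {EX : Enc X} (s : seq X) N : (forall x, x \in s -> sz x <= N) ->
  sz s <= size s * N.+1 + 1.
Proof.
elim: s => // x s IHs H; rewrite sz_cons /= mulSn.
have h1 : sz s <= size s * N.+1 + 1 by apply: IHs => y ys; apply: H; rewrite inE ys orbT.
have h2 : sz x <= N by apply: H; rewrite mem_head.
by move: (size s * _) h1 h2 => u; lia.
Qed.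

Lemma PT_traject {C} {EC : Enc C} X {EX : Enc X} (h : C -> X -> X) (x : C -> X) (n : C -> nat) (T : C -> nat) :
  PT (fun p : C * X => h p.1 p.2) -> PT x -> PT n -> polyb T ->
  (forall c i, sz (iter i (h c) (x c)) <= T c) ->
  PT (fun c => traject (h c) (x c) (n c)).
Proof.
move=> ph px pn pT H; pose g c (p : X * seq X) := (h c p.1, p.1 :: p.2).
have E c m : iter m (g c) (x c, [::]) = (iter m (h c) (x c), rev (traject (h c) (x c) m)).
  by elim: m => // m IHm; rewrite iterS IHm trajectSr rev_rcons.
apply: (@PT_ext _ _ _ _ (fun c => rev (iter (n c) (g c) (x c, [::])).2)) => [c|].
  by rewrite E revK.
apply: PT_rev; apply: PT_snd.
refine (PT_iter (T := fun c => T c + sz (n c) * (T c + 1) + 2) pn _ _ _ _).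
- by pt.
- rewrite /g; pt; refine (PT_comp ph (PT_pair _ _)); pt.
- have a := PT_polyb pn; do ?[apply: polyb_add|apply: polyb_mul|exact: polyb_const|done].
move=> c i lei; rewrite E sz_pair sz_rev.
have h1 := H c i.
have h2 : sz (traject (h c) (x c) i) <= i * (T c).+1 + 1.
  elim: i {lei h1} (x c) (H c) => // i IHi y Hy; rewrite trajectS sz_cons mulSn.
  have := IHi (h c y) (fun j => _); have := Hy 0; rewrite /= => a b.
  have {}b : sz (traject (h c) (h c y) i) <= i * (T c).+1 + 1.
    by apply: b => j; rewrite -iterSr; exact: Hy.
  by move: (i * _) a b => u; lia.
have : i * (T c).+1 <= sz (n c) * (T c + 1) by rewrite addn1 leq_mul2r; apply/orP; right; rewrite sz_nat; lia.
by move: (i * _) (sz (n c) * _) h1 h2 => u v; lia.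
Qed.

Lemma PT_expand {C} {EC : Enc C} r (w : C -> nat) (F : C -> fam) : PT w -> PT F -> PT (fun c => expand r (w c) (F c)).
Proof.
move=> pw pF; rewrite /expand; pt.
refine (PT_traject (T := fun c => sz (F c)) _ pF _ (PT_polyb pF) _); first by refine (PT_heartS r _ _); pt.
  by pt.
by move=> c i; exact: sz_iter_heartS.
Qed.

Ltac pt_u3 := lazymatch goal with
  | |- PT (fun c => chain ?n (@?f c) (@?g c)) => refine (@PT_chain _ _ n f g _ _)
  | |- PT (fun c => expand ?n (@?f c) (@?g c)) => refine (@PT_expand _ _ n f g _ _)
  end.
Ltac pt_user ::= first [pt_u1 | pt_u2 | pt_u3].

Lemma PT_beta {C} {EC : Enc C} q (k l : C -> nat) : PT k -> PT l -> PT (fun c => beta q (k c) (l c)).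
Proof. by move=> pk pl; rewrite /beta; pt. Qed.

Lemma levels_arith a b u v f m t i : a <= u + 1 -> b <= v + 1 -> u <= i * m.+1 * f.+1 ->
  v <= m.+1 * f.+1 -> i <= t ->
  (a + b).+3 <= (t.*2.+1 * (m.*2.+1 + 2) + m.*2.+1 + 2) * (f + 1) + 10.
Proof.
move=> a1 b1 u1 v1 it; have : u + v <= t.+1 * m.+1 * f.+1.
  rewrite mulSn mulnDl addnC leq_add //; apply: leq_trans u1 _.
  by rewrite -!mulnA leq_mul2r it orbT.
have : t.+1 * m.+1 * f.+1 <= (t.*2.+1 * (m.*2.+1 + 2) + m.*2.+1 + 2) * (f + 1).
  rewrite addn1 leq_mul2r; apply/orP; right; apply: (@leq_trans (t.*2.+1 * (m.*2.+1 + 2))).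
    by apply: leq_mul; lia.
  by lia.
move: (t.+1 * _ * _) (_ * (f + 1)) => p q; lia.
Qed.

(** The cutoff bounds the number of families per level, and no step enlarges the encoding of a
    family. *)
Lemma PT_levels {C} {EC : Enc C} r (w lim T : C -> nat) (F : C -> fam) :
  PT w -> PT lim -> PT T -> PT F -> PT (fun c => levels r (w c) (lim c) (T c) (F c)).
Proof.
move=> pw plim pT pF; rewrite /levels.
refine (PT_iter (T := fun c => (sz (T c) * (sz (lim c) + 2) + sz (lim c) + 2) * (sz (F c) + 1) + 10) pT _ _ _ _).
- by pt.
- by rewrite /level_step; pt.
- have a := PT_polyb pT; have b := PT_polyb plim; have d := PT_polyb pF.
  by do ?[apply: polyb_add|apply: polyb_mul|exact: polyb_const|done].
move=> c i lei.
suff H : forall p, iter i (level_step r (w c) (lim c)) (Some ([::], [:: F c])) = Some p ->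
    [/\ size p.1 <= i * (lim c).+1, size p.2 <= (lim c).+1, forall F', F' \in p.1 -> szf F' <= szf (F c)
     & forall F', F' \in p.2 -> szf F' <= szf (F c)].
  case E: (iter i _ _) => [p|]; last by rewrite /sz /=; lia.
  have [z1 z2 s1 s2] := H p E; have b1 := sz_bound_in s1; have b2 := sz_bound_in s2.
  have -> : sz (Some p) = (sz p.1 + sz p.2).+3 by rewrite {1}/sz /=  -/(sz p.1) -/(sz p.2) addSn.
  have e1 : size p.1 * (sz (F c)).+1 <= i * (lim c).+1 * (sz (F c)).+1 by rewrite leq_mul2r z1 orbT.
  have e2 : size p.2 * (sz (F c)).+1 <= (lim c).+1 * (sz (F c)).+1 by rewrite leq_mul2r z2 orbT.
  move: b1 b2 e1 e2 lei; rewrite (sz_nat (T c)) (sz_nat (lim c)).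
  by move=> b1 b2 e1 e2 lei; exact: levels_arith b1 b2 e1 e2 lei.
elim: i {lei} => [|i IHi] p.
  by move=> [<-] /=; split=> //= F'; rewrite inE => /eqP ->.
rewrite iterS; case: (iter _ _ _) IHi => // q /(_ q erefl)[z1 z2 s1 s2] /=; case: ifP => // le [<-] /=.
split.
- by rewrite size_cat mulSn addnC leq_add.
- exact: leqW.
- by move=> F'; rewrite mem_cat => /orP[/s1|/s2].
by move=> F' /flatten_mapP[F1 /s2 s F'1]; apply: leq_trans (sz_expand F'1) s.
Qed.

Lemma PT_dense_insts {C} {EC : Enc C} r (lim k l : C -> nat) (F : C -> fam) :
  PT lim -> PT F -> PT k -> PT l -> PT (fun c => dense_insts r (lim c) (F c) (k c) (l c)).
Proof.
move=> plim pF pk pl; rewrite /dense_insts /leaf1 /singles /dense_depth.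
have pb : PT (fun c => beta 1 (k c).+1 (l c)) by refine (PT_beta _ _ _); pt.
pt; first by refine (PT_levels r _ _ _ _); pt.
all: try (refine (PT_comp pb _)); pt.
Qed.

Lemma pack_rev L : pack L = foldl (fun P A => if hit (flatten P) A then P else A :: P) [::] (rev L).
Proof. by rewrite foldl_rev. Qed.

Lemma sz_pack L : szf (pack L) <= szf L.
Proof.
have E A F : szf (A :: F) = (szs A + szf F).+1 by [].
by elim: L => //= A L IHL; case: ifP => _; rewrite !E; lia.
Qed.

Lemma PT_pack {C} {EC : Enc C} (L : C -> fam) : PT L -> PT (fun c => pack (L c)).
Proof.
move=> pL; refine (PT_ext (fun c => esym (pack_rev (L c))) _).
refine (PT_foldl_b (T := fun c => szf (L c)) _ _ _ (PT_polyb pL) _); [by pt|by pt|by pt|].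
move=> c i; rewrite -[take i _]revK -pack_rev; apply: leq_trans (sz_pack _) _.
by rewrite /szf sz_rev; apply: leq_trans (sz_take _ _) _; rewrite sz_rev.
Qed.

Ltac pt_u4 := lazymatch goal with
  | |- PT (fun c => pack (@?f c)) => refine (@PT_pack _ _ f _)
  end.
Ltac pt_user ::= first [pt_u1 | pt_u2 | pt_u3 | pt_u4].

Lemma PT_pet {C} {EC : Enc C} (F : C -> fam) T M : PT F -> PT T -> PT M -> PT (fun c => pet (F c) (T c) (M c)).
Proof. by move=> pF pT pM; rewrite /pet; pt. Qed.

Ltac pt_u5 := lazymatch goal with
  | |- PT (fun c => pet (@?f c) (@?g c) (@?h c)) => refine (@PT_pet _ _ f g h _ _ _)
  end.
Ltac pt_user ::= first [pt_u1 | pt_u2 | pt_u3 | pt_u4 | pt_u5].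

Lemma PT_nu {C} {EC : Enc C} (F : C -> fam) T M : PT F -> PT T -> PT M -> PT (fun c => nu (F c) (T c) (M c)).
Proof. by move=> pF pT pM; rewrite /nu; pt. Qed.

Lemma PT_thr {C} {EC : Enc C} (yl : C -> seq nat) j : PT yl -> PT j -> PT (fun c => thr (yl c) (j c)).
Proof. by move=> pyl pj; rewrite /thr; pt. Qed.

Lemma PT_grow {C} {EC : Enc C} (F : C -> fam) M L : PT F -> PT M -> PT L -> PT (fun c => grow (F c) (M c) (L c)).
Proof. by move=> pF pM pL; rewrite /grow; pt. Qed.

Lemma PT_unsettled {C} {EC : Enc C} (F : C -> fam) s : PT F -> PT s -> PT (fun c => unsettled (F c) (s c)).
Proof. by move=> pF ps; rewrite /unsettled; pt. Qed.

Lemma PT_traces {C} {EC : Enc C} (F : C -> fam) s : PT F -> PT s -> PT (fun c => traces (F c) (s c)).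
Proof. by move=> pF ps; rewrite /traces; pt; refine (PT_unsettled _ _); pt. Qed.

Ltac pt_u6 := lazymatch goal with
  | |- PT (fun c => nu (@?f c) (@?g c) (@?h c)) => refine (@PT_nu _ _ f g h _ _ _)
  | |- PT (fun c => grow (@?f c) (@?g c) (@?h c)) => refine (@PT_grow _ _ f g h _ _ _)
  | |- PT (fun c => thr (@?f c) (@?g c)) => refine (@PT_thr _ _ f g _ _)
  | |- PT (fun c => traces (@?f c) (@?g c)) => refine (@PT_traces _ _ f g _ _)
  end.
Ltac pt_user ::= first [pt_u1 | pt_u2 | pt_u3 | pt_u4 | pt_u5 | pt_u6].

Lemma PT_round {C} {EC : Enc C} r (F : C -> fam) yl s : PT F -> PT yl -> PT s ->
  PT (fun c => round r (F c) (yl c) (s c)).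
Proof. by move=> pF pyl ps; rewrite /round; pt. Qed.

Lemma PT_rounds {C} {EC : Enc C} r n (F : C -> fam) yl s : PT F -> PT yl -> PT s ->
  PT (fun c => iter n (round r (F c) (yl c)) (s c)).
Proof. by move=> pF pyl ps; refine (PT_iterc _ _ ps); refine (PT_round r _ _ _); pt. Qed.

Lemma PT_late {C} {EC : Enc C} i (F : C -> fam) yl s : PT F -> PT yl -> PT s ->
  PT (fun c => late (F c) (yl c) i (s c)).
Proof. by move=> pF pyl ps; rewrite /late; pt. Qed.

Lemma PT_event {C} {EC : Enc C} r i (F : C -> fam) yl s : PT F -> PT yl -> PT s ->
  PT (fun c => event r (F c) (yl c) i (s c)).
Proof.
move=> pF pyl ps; have pl := PT_late i pF pyl ps; rewrite /event; refine (PT_rounds r r pF pyl _).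
by pt; refine (PT_comp pl _); pt.
Qed.

Lemma PT_paths {C} {EC : Enc C} r n (F : C -> fam) yl s : PT F -> PT yl -> PT s ->
  PT (fun c => paths r (F c) (yl c) n (s c)).
Proof.
move=> pF pyl; elim: n s => [|n IHn] s ps /=; first by pt.
apply: PT_cons => //; apply: PT_flatmapc => i; refine (IHn (fun c => _) _); exact: PT_event.
Qed.

Lemma PT_thresholds {C} {EC : Enc C} r (x b : C -> nat) : PT x -> PT b -> PT (fun c => thresholds r (x c) (b c)).
Proof. by move=> px pb; rewrite /thresholds; apply: PT_mapc => j; pt. Qed.

Lemma PT_sparse_bound {C} {EC : Enc C} r (x k w : C -> nat) : PT x -> PT k -> PT w ->
  PT (fun c => sparse_bound r (x c) (k c) (w c)).
Proof. by move=> px pk pw; rewrite /sparse_bound /sparse_factor /gbase; pt. Qed.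

Lemma PT_sparse_insts {C} {EC : Enc C} r (x k l : C -> nat) (F W : C -> fam) :
  PT x -> PT F -> PT k -> PT l -> PT W -> PT (fun c => sparse_insts r (x c) (F c) (k c) (l c) (W c)).
Proof.
move=> px pF pk pl pW; rewrite /sparse_insts.
have pb1 : PT (fun c => beta 1 (k c).+1 (l c)) by refine (PT_beta _ _ _); pt.
have pyl : PT (fun c => thresholds r (x c) (beta (ratio r ^ r.-1) (k c) (l c))).
  by refine (PT_thresholds r _ _) => //; refine (PT_beta _ _ _).
pt.
- refine (PT_paths r _ pF pyl _); rewrite /start; refine (PT_rounds r r pF pyl _); pt.
refine (PT_sparse_bound r _ _ _); pt; refine (PT_comp pb1 (PT_fst PT_id)).
Qed.

Lemma PT_merge {C} {EC : Enc C} (A : C -> seq nat) B : PT A -> PT B -> PT (fun c => merge (A c) (B c)).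
Proof. by move=> pA pB; rewrite /merge; pt. Qed.

Lemma sum_sz_flatten (B : fam) : \sum_(x <- flatten B) (sz x).+1 = \sum_(b <- B) \sum_(x <- b) (sz x).+1.
Proof. by rewrite big_flatten. Qed.

(** Nonempty blocks are no more numerous than their elements. Since splitting only rearranges the
    vertices, this bounds all the lists of blocks that occur, whatever the separators are. *)
Lemma sz_blocks (B : fam) : all (fun b => 0 < size b) B -> szf B <= 3 * szs (flatten B).
Proof.
rewrite /szf /szs !sz_seqE sum_sz_flatten => /allP nB.
have : \sum_(b <- B) (sz b).+1 <= \sum_(b <- B) 3 * \sum_(x <- b) (sz x).+1.
  rewrite !big_seq; apply: leq_sum => b /nB; case: b => // x b _.
  by rewrite sz_seqE !big_cons; lia.
rewrite -big_distrr /=; move: (\sum_(_ <- _) _) (\sum_(_ <- _) _) => u v; lia.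
Qed.

Lemma szs_perm (s t : seq nat) : perm_eq s t -> szs s = szs t.
Proof. by move=> p; rewrite /szs !sz_seqE (perm_big _ p). Qed.

Lemma comps_pos F U : all (fun b => 0 < size b) (comps F U).
Proof.
rewrite /comps; have : all (fun b : seq nat => 0 < size b) [seq [:: x] | x <- U].
  by apply/allP => b /mapP[x _ ->].
move: [seq [:: x] | x <- U]; elim: F => //= A F IHF B _; apply: IHF; exact: filter_all.
Qed.

Lemma sz_comps F U : szf (comps F U) <= 3 * szs U.
Proof. by rewrite -(szs_perm (perm_comps F U)); exact: sz_blocks (comps_pos F U). Qed.

Lemma PT_comps {C} {EC : Enc C} (F : C -> fam) U : PT F -> PT U -> PT (fun c => comps (F c) (U c)).
Proof.
move=> pF pU; rewrite /comps.
refine (PT_foldl_b (T := fun c => 3 * szs (U c)) pF _ _ _ _).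
- by pt.
- by refine (PT_merge _ _); pt.
- by apply: polyb_mul (polyb_const _) _; exact: PT_polyb pU.
by move=> c i; exact: (sz_comps (take i (F c)) (U c)).
Qed.

Ltac pt_u7 := lazymatch goal with
  | |- PT (fun c => comps (@?f c) (@?g c)) => refine (@PT_comps _ _ f g _ _)
  end.
Ltac pt_user ::= first [pt_u1 | pt_u2 | pt_u3 | pt_u4 | pt_u5 | pt_u6 | pt_u7].

Lemma PT_split_block {C} {EC : Enc C} (F W : C -> fam) U : PT F -> PT W -> PT U ->
  PT (fun c => split_block (F c) (W c) (U c)).
Proof. by move=> pF pW pU; rewrite /split_block /balanced; pt. Qed.

Ltac pt_u8 := lazymatch goal with
  | |- PT (fun c => split_block (@?f c) (@?g c) (@?h c)) => refine (@PT_split_block _ _ f g h _ _ _)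
  end.
Ltac pt_user ::= first [pt_u1 | pt_u2 | pt_u3 | pt_u4 | pt_u5 | pt_u6 | pt_u7 | pt_u8].

Lemma PT_split_all {C} {EC : Enc C} (F W B : C -> fam) : PT F -> PT W -> PT B ->
  PT (fun c => split_all (F c) (W c) (B c)).
Proof. by move=> pF pW pB; rewrite /split_all; pt. Qed.

Lemma sz_iter_split F W n V : szf (iter n (split_all F W) [:: V]) <= 3 * szs V + 3.
Proof.
have [V1|V1] := leqP (size V) 1.
  rewrite iter_split_small //; have -> : szf [:: V] = (szs V + 1).+1 by [].
  by move: (szs V) => v; lia.
have pos : all (fun b => 0 < size b) (iter n (split_all F W) [:: V]).
  elim: n => [|n IHn]; first by rewrite /= (leq_trans _ V1).
  rewrite iterS; apply/allP => b /flatten_mapP[U /(allP IHn) U0].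
  rewrite /split_block; case: ifP => _; first by rewrite inE => /eqP ->.
  case: ohead => [X|]; last by rewrite inE => /eqP ->.
  by rewrite mem_cat => /orP[/mapP[x _ ->] //|/(allP (comps_pos _ _))].
apply: leq_trans (sz_blocks pos) _; rewrite (szs_perm (perm_iter_split _ _ _ _)) /= cats0.
exact: leq_addr.
Qed.

Lemma PT_dporder {C} {EC : Enc C} (F W : C -> fam) V : PT F -> PT W -> PT V ->
  PT (fun c => dporder (F c) (W c) (V c)).
Proof.
move=> pF pW pV; rewrite /dporder; apply: PT_flatten.
refine (PT_iter (T := fun c => 3 * szs (V c) + 3) _ _ _ _ _).
- by pt.
- by pt.
- by refine (PT_split_all _ _ _); pt.
- apply: polyb_add (polyb_const _); apply: polyb_mul (polyb_const _) _; exact: PT_polyb pV.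
by move=> c i _; exact: sz_iter_split.
Qed.

Lemma PT_dpstep {C} {EC : Enc C} (x : C -> nat) st : PT x -> PT st -> PT (fun c => dpstep (x c) (st c)).
Proof. by move=> px ps; rewrite /dpstep /branch; pt. Qed.

Lemma szf_map_dif F X : szf [seq dif A X | A <- F] <= szf F.
Proof.
rewrite /szf !sz_seqE ltnS big_map; apply: leq_sum => A _; apply: sz_sub; exact: filter_subseq.
Qed.

Lemma dp_arith n lim f k z : n <= lim.+1 -> z <= n * (f + k.*2.+1).+2 + 1 ->
  z.+2 <= (lim.*2.+1 + 1) * (f + k.*2.+1 + 2) + 5.
Proof.
move=> n1 z1; have : n * (f + k.*2.+1).+2 <= (lim.*2.+1 + 1) * (f + k.*2.+1 + 2).
  by apply: leq_mul; lia.
move: (n * _) (_ * (_ + 2)) z1 => u v; lia.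
Qed.

Definition szl (s : seq (fam * nat)) := sz s.

Lemma PT_dp {C} {EC : Enc C} (lim k : C -> nat) (F : C -> fam) o : PT lim -> PT F -> PT k -> PT o ->
  PT (fun c => dp (lim c) (F c) (k c) (o c)).
Proof.
move=> plim pF pk po; rewrite /dp; pt.
  refine (PT_foldl_b (T := fun c => (sz (lim c) + 1) * (szf (F c) + sz (k c) + 2) + 5) po _ _ _ _).
  - by pt.
  - by rewrite /dpfold; pt; refine (PT_dpstep _ _); pt.
  - have a := PT_polyb plim; have b := PT_polyb pF; have d := PT_polyb pk.
    by do ?[apply: polyb_add|apply: polyb_mul|exact: polyb_const|done].
  move=> c i; move: (take i (o c)) => t.
  suff main : forall st, foldl (dpfold (lim c)) (Some [:: (F c, k c)]) t = Some st ->
     size st <= (lim c).+1 /\ forall s, s \in st -> szf s.1 <= szf (F c) /\ s.2 <= k c.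
    case E: (foldl _ _ t) => [st|]; last by rewrite /sz /=; lia.
    have [z1 s1] := main st E.
    have -> : sz (Some st) = (szl st).+2 by [].
    have b1 : szl st <= size st * (szf (F c) + (k c).*2.+1).+2 + 1.
      apply: sz_bound_in => s /s1[a b].
      have -> : sz s = (szf s.1 + sz s.2).+1 by case: (s).
      by rewrite sz_nat ltnS leq_add // ltnS leq_double.
    by rewrite (sz_nat (lim c)) (sz_nat (k c)); exact: dp_arith z1 b1.
  have : forall s, s \in [:: (F c, k c)] -> szf s.1 <= szf (F c) /\ s.2 <= k c.
    by move=> s; rewrite inE => /eqP ->.
  have : size [:: (F c, k c)] <= (lim c).+1 by [].
  elim: t [:: (F c, k c)] => [|x t IHo] st0 z0 h0 st /=; first by move=> [<-].
  case: ifP => le; last by rewrite dpfold_none.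
  apply: IHo; first exact: leqW.
  move=> s; rewrite mem_undup => /flatten_mapP[[R b] /h0[/= a1 a2]].
  rewrite /branch mem_cat /= => /orP[].
    case: ifP => // _; rewrite inE => /eqP -> /=; split; first exact: leq_trans (sz_filter _ _) a1.
    exact: leq_trans (leq_pred _) a2.
  by case: ifP => // _; rewrite inE => /eqP -> /=; split=> //; exact: leq_trans (szf_map_dif _ _) a1.
rewrite /nilp; pt.
Qed.

Lemma PT_solve1 {C} {EC : Enc C} (lim : C -> nat) (W : C -> fam) (J : C -> inst) :
  PT lim -> PT W -> PT J -> PT (fun c => solve1 (lim c) (W c) (J c)).
Proof.
move=> plim pW pJ; rewrite /solve1; refine (PT_dp _ _ _ _); pt.
by refine (PT_dporder _ _ _); pt.
Qed.

Ltac pt_u9 := lazymatch goal with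
  | |- PT (fun c => solve1 (@?f c) (@?g c) (@?h c)) => refine (@PT_solve1 _ _ f g h _ _ _)
  end.
Ltac pt_user ::= first [pt_u1 | pt_u2 | pt_u3 | pt_u4 | pt_u5 | pt_u6 | pt_u7 | pt_u8 | pt_u9].

Lemma PT_combine {C} {EC : Enc C} (R : C -> seq (option bool)) : PT R -> PT (fun c => combine (R c)).
Proof. by move=> pR; rewrite /combine /is_yes /is_fail; pt. Qed.

Ltac pt_ua := lazymatch goal with
  | |- PT (fun c => dense_insts ?r (@?f c) (@?g c) (@?h c) (@?i c)) => refine (@PT_dense_insts _ _ r f h i g _ _ _ _)
  | |- PT (fun c => sparse_insts ?r (@?f c) (@?g c) (@?h c) (@?i c) (@?j c)) =>
      refine (@PT_sparse_insts _ _ r f h i g j _ _ _ _ _)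
  | |- PT (fun c => combine (@?f c)) => refine (@PT_combine _ _ f _)
  end.
Ltac pt_user ::= first [pt_u1 | pt_u2 | pt_u3 | pt_u4 | pt_u5 | pt_u6 | pt_u7 | pt_u8 | pt_u9 | pt_ua].

Lemma PT_attempt {C} {EC : Enc C} dense r (x k l P : C -> nat) (F W : C -> fam) :
  PT x -> PT F -> PT k -> PT l -> PT W -> PT P ->
  PT (fun c => attempt dense r (x c) (F c) (k c) (l c) (W c) (P c)).
Proof.
by move=> px pF pk pl pW pP; rewrite /attempt /insts; case: dense; pt.
Qed.

Ltac pt_ub := lazymatch goal with
  | |- PT (fun c => attempt ?b ?r (@?x c) (@?f c) (@?k c) (@?l c) (@?w c) (@?p c)) =>
      refine (@PT_attempt _ _ b r x k l p f w _ _ _ _ _ _)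
  end.
Ltac pt_user ::= first [pt_u1 | pt_u2 | pt_u3 | pt_u4 | pt_u5 | pt_u6 | pt_u7 | pt_u8 | pt_u9 | pt_ua | pt_ub].

(** * The loop over l as a program *)

Definition state := (nat * fam * (nat * nat) * (fam * nat))%type.

Section Prog.
Variables (dense : bool) (r : nat).

Definition prep (x : seq (seq bool) * nat) : fam := kernel r x.2 (kcl (radj x.1) (size x.1) r).
Definition st c F k l : state := (c, F, (k, l), (Wseq (undup (flatten F)) l, padding F k l)).
Definition run_attempt (s : state) :=
  attempt dense r s.1.1.1 s.1.1.2 s.1.2.1 s.1.2.2 s.2.1 s.2.2.
(** The candidates and the padding are extended by one factor. A power with variable exponent is not
    polynomial in its arguments, whereas one more multiplication is polynomial in the present
    state. *)
Definition step (s : state) : state + bool :=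
  if run_attempt s is Some b then inr b else
  inl (s.1.1, (s.1.2.1, s.1.2.2.+1),
       ([::] :: [seq v :: z | v <- undup (flatten s.1.1.2), z <- s.2.1],
        (size (flatten s.1.1.2) + s.1.2.1 + 2) * s.2.2)).
Definition init (y : nat * (seq (seq bool) * nat)) : state := st y.1 (prep y.2) y.2.2 1.

Lemma step_st c F k l : step (st c F k l) =
  if run_attempt (st c F k l) is Some b then inr b else inl (st c F k l.+1).
Proof. by rewrite /step; case: run_attempt => //; rewrite /st /= /padding expnS. Qed.

Lemma PT_run_attempt : PT run_attempt.
Proof. by rewrite /run_attempt; pt. Qed.

Lemma PT_step : PT step.
Proof. by have pr := PT_run_attempt; rewrite /step; pt. Qed.

Lemma PT_kcl {C} {EC : Enc C} (rows : C -> seq (seq bool)) : PT rows ->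
  PT (fun c => kcl (radj (rows c)) (size (rows c)) r).
Proof.
move=> pr; rewrite /kcl; refine (PT_iterc _ _ _); last by pt.
by rewrite /extend_clq /radj; pt.
Qed.

Lemma PT_prep : PT prep.
Proof.
have pk : PT (fun x : seq (seq bool) * nat => kcl (radj x.1) (size x.1) r) by refine (PT_kcl _); pt.
by rewrite /prep /kernel; pt.
Qed.

Lemma PT_init : PT init.
Proof.
have pp := PT_prep.
have p2 : PT (fun y : nat * (seq (seq bool) * nat) => prep y.2) by refine (PT_comp pp _); pt.
rewrite /init /st /Wseq /padding /=; pt.
Qed.

(** [q.1] is the input; [q.2] holds an index whose attempt answers and the answer that all attempts
    up to this index agree on. *)
Definition good c (q : (seq (seq bool) * nat) * (nat * bool)) :=
  [/\ 0 < q.2.1, forall l b, 0 < l <= q.2.1 -> run_attempt (st c (prep q.1) q.1.2 l) = Some b -> b = q.2.2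
    & run_attempt (st c (prep q.1) q.1.2 q.2.1) != None].

(* The loop is run on states for which some attempt is known to succeed: the index of that
   attempt and the answer are carried along for the proof, but are not encoded. *)
Definition goodt c := {q : (seq (seq bool) * nat) * (nat * bool) | good c q}.
#[local] Instance Enc_goodt c : Enc (goodt c) := fun q => enc (sval q).1.
Definition loopt c := {p : goodt c * nat | 0 < p.2 <= (sval p.1).2.1}.
#[local] Instance Enc_loopt c : Enc (loopt c) :=
  fun p => enc (st c (prep (sval (sval p).1).1) (sval (sval p).1).1.2 (sval p).2).

Definition mkloop c (p : goodt c * nat) (h : 0 < p.2 <= (sval p.1).2.1) : loopt c := exist _ p h.

Definition sz_st c F k l := sz (st c F k l).

Lemma init_arith u v z : u <= v -> ((z + 1).+1 + u).+1 <= (1 + z + v).+2.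
Proof. lia. Qed.

Lemma loop_arith x m y : x <= m -> x + y * (m + 8) + 7 <= (y + 1) * (m + 8).
Proof. by rewrite mulnDl; lia. Qed.

Lemma program_arith a L m m' i i' : 0 < L -> m <= m' -> i <= i' ->
  ((1 + a + i).+2 + ((L - 1 + 1) * (m + 8) + 2)).+1 <= i' + (L + 1) * (m' + 8) + a + 10.
Proof.
move=> L0 le1 le2; rewrite subnK // mulnDl.
by have : L * (m + 8) <= L * (m' + 8); [rewrite leq_mul2l leq_add2r le1 orbT|lia].
Qed.

(** The exponent [d] precedes [c], although [c] is part of the states: in the end [c] depends on
    [phi] and the constants of the class, while the exponent of the number of vertices may depend on
    [r] only. *)
Lemma program_ex : exists d, forall c, exists P : program, forall q S, good c q ->
  (forall l, 0 < l <= q.2.1 -> sz (st c (prep q.1) q.1.2 l) <= S) ->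
  exists2 t, run P (enc q.1) (enc q.2.2) t &
    t <= (sz c + sz q.1 + 4) ^ d + (q.2.1 + 1) * (S.+1 ^ d + 8) + sz c + 10.
Proof.
have [Ts [cs [ds ps] _]] := PT_step; have [Ti [ci [di pi] _]] := PT_init.
exists (ds + di) => c.
pose stp (p : loopt c) := st c (prep (sval (sval p).1).1) (sval (sval p).1).1.2 (sval p).2.
(* The value [inr false] is a default that is never returned: the attempt at the last admissible
   index answers, so the loop does not run past it. *)
pose g (p : loopt c) : loopt c + bool :=
  if run_attempt (stp p) is Some b then inr b else
  if (insub ((sval p).1, (sval p).2.+1) : option (loopt c)) is Some p' then inl p' else inr false.
have cg : computes g (fun p => (sz (stp p)).+1 ^ ds).
  apply: (computes_transport cs) => p; exists (stp p); split=> //; rewrite step_st -/(stp p) /g.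
  case E: (run_attempt (stp p)) => [b|] //.
  case: insubP => [p' _ pE|nlt] /=.
    have E1 : (sval p').1 = (sval p).1 by rewrite -[sval p']/(val p') pE.
    have E2 : (sval p').2 = (sval p).2.+1 by rewrite -[sval p']/(val p') pE.
    by rewrite /enc /= [in RHS]/enc /Enc_loopt E1 E2.
  exfalso; have [_ _] := svalP (sval p).1; have /andP[_ le] := svalP p.
  have -> : (sval (sval p).1).2.1 = (sval p).2.
    by apply/eqP; rewrite eqn_leq le andbT leqNgt; exact: nlt.
  by rewrite -/(stp p) E.
pose f (p : loopt c) := (sval (sval p).1).2.2.
pose mx (p : loopt c) := \max_(l < (sval (sval p).1).2.1.+1 | 0 < l)
  sz_st c (prep (sval (sval p).1).1) (sval (sval p).1).1.2 l.
have mxP p : sz (stp p) <= mx p.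
  have /andP[l0 le] := svalP p; rewrite /mx.
  exact: (leq_bigmax_cond (Ordinal (le : (sval p).2 < (sval (sval p).1).2.1.+1)) l0).
pose TF (p : loopt c) := ((sval (sval p).1).2.1 - (sval p).2 + 1) * ((mx p).+1 ^ ds + 8).
have leX (a b e : nat) : a <= b -> a.+1 ^ e <= b.+1 ^ e by case: e => // e; rewrite leq_exp2r.
have cf : computes f (fun p => TF p + 2).
  apply: (computes_loop (mu := fun p => (sval (sval p).1).2.1 - (sval p).2) cg) => p.
  have le1 := leX _ _ ds (mxP p); rewrite /g.
  case E: (run_attempt (stp p)) => [b|].
    split; last first.
      apply: leq_trans (leq_pmull _ _); last by rewrite addn1.
      by apply: leq_add.
    have [_ H _] := svalP (sval p).1; symmetry; exact: H (svalP p) E.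
  case: insubP => [p' lt pE|nlt]; last first.
    exfalso; have [_ _] := svalP (sval p).1; have /andP[_ le] := svalP p.
    have -> : (sval (sval p).1).2.1 = (sval p).2.
      by apply/eqP; rewrite eqn_leq le andbT leqNgt; exact: nlt.
    by rewrite -/(stp p) E.
  have E1 : (sval p').1 = (sval p).1 by rewrite -[sval p']/(val p') pE.
  have E2 : (sval p').2 = (sval p).2.+1 by rewrite -[sval p']/(val p') pE.
  rewrite /f /TF /mx E1 E2; split=> //; first exact: ltn_sub2l.
  set y := _ - (sval p).2.
  have -> : (sval (sval p).1).2.1 - (sval p).2.+1 + 1 = y by rewrite /y addn1 subnSK.
  exact: loop_arith.
have firstP (q : goodt c) : 0 < (q, 1).2 <= (sval (q, 1).1).2.1 by have [] := svalP q.
pose h (q : goodt c) : loopt c := mkloop (firstP q).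
have ch : computes h (fun q => (1 + sz c + ((sz c + sz (sval q).1 + 2) ^ di)).+2).
  have c1 : computes (fun q : goodt c => (c, (sval q).1)) (fun q => (sz c + 1).+1).
    apply: computes_pair (computes_const _) _.
    by apply: (computes_transport (@computes_id (seq (seq bool) * nat) _)) => q; exists (sval q).1.
  have c2 := computes_comp c1 ci.
  apply: (computes_transport c2) => q; exists q; split=> //=.
  have h1 : Ti (c, (sval q).1) <= (sz c + sz (sval q).1 + 2) ^ di.
    by rewrite addn2; exact: (pi (c, (sval q).1)).
  exact: init_arith h1.
have call := computes_comp ch cf.
(* Function 0 is the entry point, so the helpers are stored from index 1 on. *)
have [e [Lc Hc]] := call 1; exists (e :: Lc) => q S gq HS.
have lP : loaded (e :: Lc) 1 Lc by move=> i lti; rewrite /body add1n.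
have [t ev le_t] := Hc _ lP (exist _ q gq) [::].
exists t; first exact: ev.
apply: (leq_trans le_t) => /=.
have [L0 _ _] := gq; apply: program_arith => //.
  apply: (@leq_trans (S.+1 ^ ds)).
    by apply: leX; apply/bigmax_leqP => l l0; apply: HS; rewrite l0 -ltnS ltn_ord.
  by apply: leq_pexp2l => //; exact: leq_addr.
apply: (@leq_trans ((sz c + sz q.1 + 4) ^ di)).
  by case: (di) => // e'; rewrite leq_exp2r // leq_add2l.
by rewrite leq_pexp2l ?leq_addl //; lia.
Qed.

End Prog.

Lemma chain_sub r w F A : A \in chain r w F -> exists2 B : seq nat, B \in F & sub A B.
Proof.
rewrite /chain; elim: (size _) A => [|n IHn] A; first by exists A; rewrite ?sub_refl.
rewrite iterS {1}/heartS; case E: flower => [[c R]|]; last exact: IHn.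
rewrite inE => /orP[/eqP ->|]; last by rewrite mem_filter => /andP[_ /IHn].
have := flower_hearts E; rewrite mem_undup => /flatten_mapP[B /IHn[D DF BD] /subs_subseq/mem_subseq RB].
by exists D => //; apply: sub_trans BD; apply/subP.
Qed.

Lemma kernel_sub r k F A : A \in kernel r k F -> A = [::] \/ exists2 B : seq nat, B \in F & sub A B.
Proof.
by rewrite /kernel; case: ifP => _; [move/chain_sub; right|rewrite inE => /eqP ->; left].
Qed.

Lemma sz_small n (A : seq nat) : (forall x, x \in A -> x < n) -> szs A <= size A * n.*2 + 1.
Proof.
rewrite /szs; elim: A => // x A IHA H; rewrite sz_cons sz_nat /= mulSn.
have h1 : sz A <= size A * n.*2 + 1 by apply: IHA => y yA; apply: H; rewrite inE yA orbT.
have h2 : x < n by apply: H; rewrite mem_head.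
by move: (size A * _) h1 => u; lia.
Qed.

Lemma sz_fam_small n (F : fam) : (forall x, x \in flatten F -> x < n) ->
  szf F <= size (flatten F) * n.*2 + (size F).*2 + 1.
Proof.
rewrite /szf; elim: F => // A F IHF H; rewrite sz_cons /= size_cat mulnDl.
have h1 : sz F <= size (flatten F) * n.*2 + (size F).*2 + 1.
  by apply: IHF => x xF; apply: H; rewrite /= mem_cat xF orbT.
have h2 : szs A <= size A * n.*2 + 1 by apply: sz_small => x xA; apply: H; rewrite /= mem_cat xA.
by move: h1 h2; rewrite /szs; move: (size A * _) (size (flatten F) * _) => u v; lia.
Qed.

Lemma st_arith c f k l w p n m x : f <= m * n.*2 + m.*2 + 1 -> w <= x * (l * n.*2 + 2) + 1 ->
  p = x.*2.+1 -> k <= m -> m <= x -> l <= x -> 0 < x ->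
  (((c.*2.+1 + f).+1 + (k.*2.+1 + l.*2.+1).+1).+1 + (w + p).+1).+1 <= 30 * c.+1 * n.+1 * (x * x).
Proof.
move=> h1 h2 -> km mx lx x0.
have a3 : x <= x * x by rewrite leq_pmulr.
have a1 : m * n.*2 <= 2 * (n * (x * x)).
  have -> : m * n.*2 = 2 * (n * m) by lia.
  by rewrite !leq_mul2l (leq_trans mx a3) !orbT.
have a2 : x * (l * n.*2 + 2) <= 2 * (n * (x * x)) + 2 * (x * x).
  have -> : x * (l * n.*2 + 2) = 2 * (n * (x * l)) + 2 * x by lia.
  by rewrite leq_add // ?leq_mul2l ?lx ?a3 !orbT.
have -> : 30 * c.+1 * n.+1 * (x * x) = 30 * (c * n.+1 * (x * x)) + 30 * (n * (x * x)) + 30 * (x * x) by lia.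
have a4 : c <= c * n.+1 * (x * x) by rewrite -mulnA leq_pmulr // !muln_gt0 x0.
by move: (n * (x * x)) (c * n.+1 * (x * x)) (m * n.*2) (x * (l * _ + 2)) (x * x) a1 a2 a3 a4 h1 h2; lia.
Qed.

Lemma sz_st_bound c (F : fam) k l n : 0 < l -> (forall x, x \in flatten F -> x < n) ->
  size F <= (size (flatten F)).+1 ->
  sz_st c F k l <= 30 * c.+1 * n.+1 * ((size (flatten F) + k + 2) ^ l * (size (flatten F) + k + 2) ^ l).
Proof.
move=> l0 Fn zF; set m := size (flatten F) + k + 2; set x := m ^ l.
have m2 : 1 < m by rewrite /m addn2.
have mx : m <= x by rewrite /x -{1}[m]expn1 leq_pexp2l //; lia.
have lx : l <= x by rewrite /x; apply: ltnW; exact: ltn_expl.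
have V0n y : y \in undup (flatten F) -> y < n by rewrite mem_undup; exact: Fn.
have wB : szf (Wseq (undup (flatten F)) l) <= x * (l * n.*2 + 2) + 1.
  have h : szf (Wseq (undup (flatten F)) l) <= size (Wseq (undup (flatten F)) l) * (l * n.*2 + 1).+1 + 1.
    apply: sz_bound_in => z; rewrite mem_Wseq => /andP[zl /allP zV].
    apply: leq_trans (sz_small (n := n) _) _; first by move=> y /zV/V0n.
    by rewrite leq_add2r leq_mul2r zl orbT.
  apply: leq_trans h _; rewrite leq_add2r -addnS leq_mul2r; apply/orP; right.
  apply: leq_trans (size_Wseq _ _) _; rewrite /x; case: (l) l0 => // l' _.
  rewrite leq_exp2r // /m -addnA; apply: leq_ltn_trans (size_undup _) _.
  by rewrite -[X in X < _]addn0 ltn_add2l addn2.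
have fB : szf F <= m * n.*2 + m.*2 + 1.
  apply: leq_trans (sz_fam_small Fn) _; rewrite leq_add2r; apply: leq_add.
    by rewrite leq_mul2r /m -addnA leq_addr orbT.
  by rewrite leq_double; apply: leq_trans zF _; rewrite /m addn2 ltnS -addnS leq_addr.
have E : sz_st c F k l = (((c.*2.+1 + szf F).+1 + (k.*2.+1 + l.*2.+1).+1).+1 +
    (szf (Wseq (undup (flatten F)) l) + sz (padding F k l)).+1).+1.
  by rewrite /sz_st /st !sz_pair !(sz_nat c) (sz_nat k) (sz_nat l).
rewrite E; apply: st_arith fB wB _ _ mx lx _.
- by rewrite sz_nat.
- by rewrite /m -addnA addnCA leq_addr.
- by rewrite /x expn_gt0 (ltnW m2).
Qed.

(** The kernel has at most [r * r * (k + 2) ^ r] elements. As [k + 2] is at least 2, the constant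
    factor is moved into the exponent. *)
Lemma m_arith r k m0 : 0 < r -> m0 <= k * (r * k.+1 ^ r.-1) * r ->
  m0 + k + 2 <= (k + 2) ^ (r * r + r + 1).
Proof.
move=> r0 h; set x := k + 2; have x2 : 1 < x by rewrite /x addn2.
have xr : 0 < x ^ r by rewrite expn_gt0 (ltnW x2).
have h1 : m0 <= r * r * x ^ r.
  apply: (leq_trans h); have -> : k * (r * k.+1 ^ r.-1) * r = r * r * (k * k.+1 ^ r.-1) by lia.
  rewrite leq_mul2l; apply/orP; right; rewrite -{2}(prednK r0) expnS leq_mul //; first by rewrite /x; lia.
  by case: (r.-1) => // r'; rewrite leq_exp2r // /x; lia.
have h2 : x <= x ^ r by rewrite -{1}[x]expn1 leq_pexp2l //; lia.
apply: (@leq_trans ((r * r + 1) * x ^ r)); first by rewrite mulnDl mul1n -addnA -/x leq_add.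
rewrite (_ : r * r + r + 1 = (r * r + 1) + r); last by lia.
rewrite expnD leq_mul2r; apply/orP; right.
by apply: ltnW; apply: (@leq_trans (2 ^ (r * r + 1))); [exact: ltn_expl|rewrite leq_exp2r // addn1].
Qed.

Lemma total_arith d c n k L e m : 0 < L -> 0 < e -> m <= 8 * n.+1 ^ 2 * (k + 2) ->
  (c.*2.+1 + m + 4) ^ d +
    (L + 1) * ((30 * c.+1 * n.+1 * ((k + 2) ^ (e * L) * (k + 2) ^ (e * L))).+1 ^ d + 8) + c.*2.+1 + 10 <=
  (((c.*2 + 13) ^ d + 9 * (31 * c.+1) ^ d + c.*2 + 11) * n.+1 ^ (2 * d)) * (k + 2) ^ ((d + 1 + 2 * e * d) * L).
Proof.
move=> L0 e0 hm; set x := k + 2; set N := n.+1 ^ (2 * d).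
have x2 : 1 < x by rewrite /x addn2.
have xp i : 0 < x ^ i by rewrite expn_gt0 (ltnW x2).
have N0 : 0 < N by rewrite expn_gt0.
set y := (30 * c.+1 * n.+1 * _).+1; set X := x ^ _.
have LX : L + 1 <= x ^ L by rewrite addn1; exact: ltn_expl.
have t1 : (c.*2.+1 + m + 4) ^ d <= (c.*2 + 13) ^ d * N * X.
  have -> : (c.*2 + 13) ^ d * N * X = ((c.*2 + 13) * n.+1 ^ 2) ^ d * X by rewrite expnMn -expnM.
  apply: (@leq_trans (((c.*2 + 13) * n.+1 ^ 2) ^ d * x ^ d)).
    rewrite -expnMn; case: (d) => // d'; rewrite leq_exp2r //.
    have : 0 < n.+1 ^ 2 * x by rewrite muln_gt0 expn_gt0 /= (ltnW x2).
    rewrite -mulnA mulnDl; move: hm; rewrite -/x -mulnA; move: (n.+1 ^ 2 * x) => u hm u0; nia.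
  by rewrite leq_mul2l leq_pexp2l ?(ltnW x2) ?orbT //; nia.
have t2 : (L + 1) * (y ^ d + 8) <= 9 * (31 * c.+1) ^ d * N * X.
  have yb : y ^ d <= (31 * c.+1) ^ d * N * x ^ (2 * e * d * L).
    have -> : (31 * c.+1) ^ d * N * x ^ (2 * e * d * L) = (31 * c.+1 * n.+1 ^ 2 * x ^ (2 * e * L)) ^ d.
      by rewrite [2 * e * d * L]mulnAC !expnMn -!expnM -expnD addnn -mul2n.
    case: (d) => // d'; rewrite leq_exp2r // /y -expnD.
    have -> : e * L + e * L = 2 * e * L by lia.
    rewrite expnS expn1; have := xp (2 * e * L); move: (x ^ _) => u u0.
    have : 30 * c.+1 * n.+1 * u + c.+1 * n.+1 * u = 31 * c.+1 * n.+1 * u by lia.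
    have : 0 < c.+1 * n.+1 * u by rewrite !muln_gt0 u0.
    have : 31 * c.+1 * n.+1 * u <= 31 * c.+1 * (n.+1 * n.+1) * u.
      by rewrite leq_mul2r leq_mul2l leq_pmulr // !orbT.
    move: (30 * _ * _ * u) (c.+1 * _ * u) (31 * _ * _ * u) (31 * _ * _ * u) => p q s t; lia.
  have z1 : 0 < (31 * c.+1) ^ d * N * x ^ (2 * e * d * L) by rewrite !muln_gt0 N0 xp expn_gt0.
  apply: (@leq_trans (x ^ L * (9 * ((31 * c.+1) ^ d * N * x ^ (2 * e * d * L))))).
    by apply: leq_mul => //; move: (_ * x ^ _) z1 yb => u; lia.
  have -> : x ^ L * (9 * ((31 * c.+1) ^ d * N * x ^ (2 * e * d * L))) = 9 * (31 * c.+1) ^ d * N * (x ^ L * x ^ (2 * e * d * L)).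
    by lia.
  by rewrite leq_mul2l -expnD leq_pexp2l ?(ltnW x2) ?orbT //; lia.
have t3 : c.*2.+1 + 10 <= (c.*2 + 11) * N * X.
  have : 0 < N * X by rewrite muln_gt0 N0 xp.
  by rewrite -mulnA; move: (N * X) => u; nia.
have -> : ((c.*2 + 13) ^ d + 9 * (31 * c.+1) ^ d + c.*2 + 11) * N * X =
   (c.*2 + 13) ^ d * N * X + 9 * (31 * c.+1) ^ d * N * X + (c.*2 + 11) * N * X by lia.
by rewrite -addnA leq_add // leq_add.
Qed.

(** * From a successful attempt to a solver *)

Section Solver.
Variables (dense : bool) (r : nat).
Hypothesis r0 : 0 < r.

(** What a graph must satisfy for the attempt at [l = L] to answer: the consequence of (P1) used in
    the sparse case, and a small order or treewidth for all vertex sets that an attempt can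
    produce. *)
Definition hopeful c (G : sgraph) k L :=
  [/\ 0 < L,
    ~~ dense -> 2 < r /\ 0 < c /\
      forall (U : seq nat) (M : fam), uniq U -> all (fun x => x < order G) U -> uniq M ->
      (forall T : seq nat, T \in M ->
         [/\ sorted ltn T, 0 < size T < r, sub T U & clq (radj (adjacency_rows G)) T]) ->
      size M <= c * size U
    & forall V, uniq V -> all (fun x => x < order G) V -> size V <= size_bound dense r c k L ->
      (dense -> forall X, sorted ltn X -> sub X V -> clq (radj (adjacency_rows G)) X ->
         size X <= r + 2 ^ r * beta 1 k.+1 L) ->
      size V <= L \/ treewidth (isub G V) < L].

Lemma sz_rows (G : sgraph) : sz (adjacency_rows G) <= (4 * order G + 2) * order G + 1.
Proof.
have rowB (s : seq bool) : sz s <= 4 * size s + 1.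
  by elim: s => // b s IHs; rewrite sz_cons /=; have := sz_bool b; lia.
have H (R : seq (seq bool)) : all (fun s => size s == order G) R -> sz R <= (4 * order G + 2) * size R + 1.
  elim: R => [|s R IHR]; first by rewrite muln0.
  move=> /andP[/eqP zs /IHR h]; rewrite sz_cons /= mulnS; have := rowB s; rewrite zs.
  by move: (_ * size R) h => u; lia.
by apply: leq_trans (H _ _) _; [apply/allP => s /mapP[x _ ->]; rewrite size_map size_enum_ord|rewrite size_rows].
Qed.

Lemma solver : exists b E, forall c, exists A (P : program), forall (G : sgraph) k L,
  hopeful c G k L ->
  exists2 t, run P (enc_instance G k) (enc_bool (Kr_coverable r G k)) t &
    t <= A * (order G).+1 ^ b * (k + 2) ^ (E * L).
Proof.
have [d H] := program_ex dense r; pose e := r * r + r + 1.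
exists (2 * d), (d + 1 + 2 * e * d) => c; have [P HP] := H c.
exists ((c.*2 + 13) ^ d + 9 * (31 * c.+1) ^ d + c.*2 + 11), P => G k L [L0 few ok].
set n := order G; pose rows := adjacency_rows G; pose F := prep r (rows, k).
have szr : size rows = n by exact: size_rows.
pose K := kcl (radj rows) n r.
have FE : F = kernel r k K by rewrite /F /prep /= szr.
have wfK : wf r K by apply: wf_kcl => //; exact: radj_sym.
have memK B : (B \in K) = [&& size B == r, sorted ltn B, all (fun x => x < n) B & clq (radj rows) B].
  by apply: mem_kcl; exact: radj_sym.
have wfF : [::] \notin F -> wf r F by rewrite FE; exact: wf_kernel.
have cF A : A \in F -> clq (radj rows) A.
  rewrite FE => /kernel_sub[->//|[B]]; rewrite memK => /and4P[_ _ _ cB] AB; exact: clq_sub cB.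
have Fn x : x \in flatten F -> x < n.
  move=> /flattenP[A]; rewrite FE => /kernel_sub[->//|[B]]; rewrite memK => /and4P[_ _ /allP Bn _].
  by move=> /subP AB /AB/Bn.
have V0n x : x \in undup (flatten F) -> x < n by rewrite mem_undup; exact: Fn.
have allF B : sorted ltn B -> size B = r -> clq (radj rows) B -> sub B (undup (flatten F)) ->
    has (fun A => sub A B) F.
  move=> sB zB cB /subP BV; rewrite FE /kernel; case: ifP => // _.
  have BK : B \in K by rewrite memK zB eqxx sB cB andbT; apply/allP => x /BV/V0n.
  by have [D DK DB] := @covers_chain r k.+1 K B BK; apply/hasP; exists D.
have few' : ~~ dense -> 2 < r /\ 0 < c /\
    forall (U : seq nat) (M : fam), uniq U -> {subset U <= flatten F} -> uniq M ->
    (forall T : seq nat, T \in M -> [/\ sorted ltn T, 0 < size T < r, sub T U & clq (radj rows) T]) ->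
    size M <= c * size U.
  move=> nd; have [r3 [c0 h]] := few nd; split=> //; split=> // U M uU UF; apply: h => //.
  by apply/allP => x /UF/Fn.
have covE : Kr_coverable r G k = true <-> exists2 S, size S <= k & hits S F.
  have cK := coverableP G r k; rewrite FE; split.
    by move=> /cK[S Sk hS]; exists S => //; rewrite -kernelP.
  by move=> [S Sk hS]; apply/cK; exists S => //; rewrite (@kernelP r k K S wfK Sk).
have gq : good dense r c ((rows, k), (L, Kr_coverable r G k)).
  split=> //= [l b /andP[l0 _]|].
    rewrite -/F /run_attempt /= => E1; have := attempt_sound r0 l0 wfF cF allF few' E1.
    by case: b {E1} => [] [h1 h2]; [apply/esym/covE/h1|apply/esym/negbTE/negP => /covE/h2].
  rewrite -/F /run_attempt /=; apply: attempt_ok r0 L0 wfF cF allF few' _ => V uV VV0; apply: ok => //.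
  by apply/allP => x /VV0/V0n.
set S := 30 * c.+1 * n.+1 * ((k + 2) ^ (e * L) * (k + 2) ^ (e * L)).
have zF : size F <= (size (flatten F)).+1.
  rewrite FE /kernel; case: ifP => // _; have [_ _ z _] := wf_chain (ltn0Sn k) wfK.
  rewrite -sum_size; apply: leqW; elim: (chain _ _ _) z => // A F' IHF' z.
  rewrite big_cons /= -add1n leq_add //; first by have /andP[] := z A (mem_head _ _).
  by apply: IHF' => B BF; apply: z; rewrite inE BF orbT.
have HS l : 0 < l <= L -> sz (st c F k l) <= S.
  move=> /andP[l0 lL]; apply: leq_trans (@sz_st_bound c F k l n l0 Fn zF) _.
  have h : (size (flatten F) + k + 2) ^ l <= (k + 2) ^ (e * L).
    rewrite expnM; apply: (@leq_trans (((k + 2) ^ e) ^ l)).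
      case: (l) l0 => // l' _; rewrite leq_exp2r //; apply: m_arith r0 _.
      by rewrite FE; exact: kernel_size.
    by apply: leq_pexp2l => //; rewrite expn_gt0 addn2.
  by rewrite leq_mul2l; apply/orP; right; exact: leq_mul.
have [t ev le_t] := HP _ S gq HS; exists t; first exact: ev.
apply: (leq_trans le_t) => /=; rewrite (sz_nat c).
apply: total_arith => //; first by rewrite /e addn1.
have := sz_rows G; rewrite sz_pair -/rows (sz_nat k) -/n; move: (sz rows) => u h.
have : u <= 4 * n.+1 ^ 2 by apply: leq_trans h _; rewrite expnS expn1; nia.
have : 0 < n.+1 ^ 2 by rewrite expn_gt0.
move: (n.+1 ^ 2) => v v0 uv; nia.
Qed.

End Solver.

Local Open Scope ring_scope.

(** * The choice of l *)

Lemma le_powR (R : realType) (p x y : R) : 0 <= p -> 0 <= x -> x <= y -> x `^ p <= y `^ p.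
Proof.
by move=> p0 x0 xy; apply: ge0_ler_powR => //; rewrite nnegrE // (le_trans x0).
Qed.

Section Numeric.
Variable R : realType.

Lemma affine_le (a b y : R) : 0 <= a -> 0 <= b -> 0 <= y -> a * y + b <= (a + b) * y + (a + b).
Proof.
move=> a0 b0 y0; have : 0 <= b * y by exact: mulr_ge0.
by rewrite mulrDl; move: (a * y) (b * y) => u v; lra.
Qed.

Section Params.
Variables (gamma alpha phi : R).
Hypotheses (gamma0 : 0 <= gamma) (alpha01 : 0 < alpha < 1) (phi0 : 0 <= phi).
Let den := gamma + alpha * (phi + 1) + 1.
Let mu := (1 - alpha) / den.
Definition epsilon := (gamma + alpha * (phi + 2)) / (gamma + alpha * (phi + 1) + 1).

Let den0 : 0 < den.
Proof.
have /andP[a0 _] := alpha01; rewrite /den ltr_wpDl // addr_ge0 // mulr_ge0 ?(ltW a0) //.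
by rewrite addr_ge0.
Qed.

Lemma epsilonE : epsilon = 1 - mu.
Proof.
have d0 : gamma + alpha * (phi + 1) + 1 != 0 by rewrite gt_eqF.
by rewrite /epsilon /mu /den; field.
Qed.

Lemma mu_gt0 : 0 < mu.
Proof. by have /andP[_ a1] := alpha01; apply: divr_gt0 => //; rewrite subr_gt0. Qed.

Lemma epsilon_lt1 : epsilon < 1.
Proof. by rewrite epsilonE; have := mu_gt0; lra. Qed.

Lemma epsilon_gt0 : 0 < epsilon.
Proof.
have /andP[a0 _] := alpha01; apply: divr_gt0 => //.
by rewrite ltr_wpDl // mulr_gt0 // ltr_wpDl.
Qed.

(** The equation that determines the exponent. If [l = k ^ eps] then [w = k ^ mu]; for cliques of
    order [w] and [k * w ^ (phi + 1)] vertices, (P2) gives treewidth [k ^ eps] again, up to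
    constants. *)
Lemma epsilon_split : mu * gamma + (1 + mu * (phi + 1)) * alpha = epsilon.
Proof.
have d0 : gamma + alpha * (phi + 1) + 1 != 0 by rewrite gt_eqF.
by rewrite /epsilon /mu /den; field.
Qed.

(** The second part is the condition of [hopeful] on vertex sets, with [A * (k * w ^ psi)] as the
    bound on their size and [A * w] as the bound on their cliques. The constants in the bound on [L]
    must not involve [gamma] and [alpha]. *)
Lemma choose_size (A psi k : nat) (K : R) : (0 < A)%N -> psi%:R <= phi + 1 -> 0 <= K ->
  exists2 L : nat, (0 < L)%N /\
    L%:R <= (4 * A%:R ^+ 2 + 4 * A%:R + K * A%:R + 2) * k%:R `^ epsilon + (A%:R + 1)
  & let w := beta 1 k.+1 L in
    (A * (k * w ^ psi) <= L)%N \/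
    K * (A * w + 1)%:R `^ gamma * (A * (k * w ^ psi))%:R `^ alpha < L%:R.
Proof.
move=> A0 psile K0; have /andP[a0 a1] := alpha01.
have mu0 := mu_gt0; have eps0 := epsilon_gt0.
pose X : R := k%:R `^ mu; pose Y : R := k%:R `^ epsilon.
have X0 : 0 <= X by exact: powR_ge0.
have Y0 : 0 <= Y by exact: powR_ge0.
have A1 : 1 <= A%:R :> R by rewrite ler1n.
have wP L : (0 < L)%N -> let w := beta 1 k.+1 L in [/\ (0 < w)%N & (w.-1 * L <= k)%N].
  move=> L0 w; split=> //; have [_] := betaP k.+1 (isT : (0 < 1)%N) L0; rewrite -/w expn1 ltnS.
  by case: (w.-1) => // w' /(_ isT).
have XY : (0 < k)%N -> X * Y = k%:R.
  move=> k0; rewrite /X /Y -powRD; last by rewrite pnatr_eq0 -lt0n k0 implybT.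
  by rewrite epsilonE addrC subrK powRr1.
(* When [X] is small, rounding [w] to an integer would spoil the estimate. Then [L = A * k.+1]
   forces [w = 1], so that whole vertex sets have at most [L] vertices, and [k = X * Y <= 4 * A * Y]
   shows that this [L] is still within the bound. *)
have [small|big] := boolP ((k == 0%N) || (X < 4 * A%:R)).
  exists (A * k.+1)%N; first split; first by rewrite muln_gt0 A0.
    have kY : k%:R <= 4 * A%:R * Y.
      have [->|k0] := posnP k; first by rewrite !mulr_ge0.
      move: small; rewrite -leqn0 leqNgt k0 /= => lt; rewrite -XY //; apply: ler_wpM2r => //.
      exact: ltW.
    have h1 : A%:R * k%:R <= A%:R * (4 * A%:R * Y) by apply: ler_wpM2l => //; lra.
    have E1 : A%:R * (4 * A%:R * Y) = 4 * A%:R ^+ 2 * Y by ring.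
    rewrite natrM -natr1 mulrDr mulr1 -/Y; rewrite E1 in h1.
    have h2 : 0 <= (4 * A%:R + K * A%:R + 2) * Y by apply: mulr_ge0 => //; have := mulr_ge0 K0 (ler0n R A); lra.
    have -> : (4 * A%:R ^+ 2 + 4 * A%:R + K * A%:R + 2) * Y =
       4 * A%:R ^+ 2 * Y + (4 * A%:R + K * A%:R + 2) * Y by ring.
    by move: h1 h2; move: (_ * Y) (_ * Y) (A%:R * k%:R) => u v t; lra.
  move=> w; left; have L0 : (0 < A * k.+1)%N by rewrite muln_gt0 A0.
  have [w0 wk] := wP _ L0; rewrite -/w in w0 wk.
  have w1 : w = 1%N.
    have : (w.-1 * k.+1 <= k)%N by apply: leq_trans wk; rewrite leq_mul2l leq_pmull ?orbT.
    by case: (w) w0 => // -[|w'] // _; rewrite /= mulSn => h; exfalso; move: h; rewrite leqNgt ltn_addr // ltnSn.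
  by rewrite w1 exp1n muln1 leq_mul2l leqnSn orbT.
rewrite negb_or -leNgt -lt0n in big; have /andP[k0 bigX] := big.
have k1 : 1 <= k%:R :> R by rewrite ler1n.
have Y1 : 1 <= Y by rewrite -(powRr0 k%:R) ler_powR // ltW.
have X1 : 1 <= X by rewrite -(powRr0 k%:R) ler_powR // ltW.
(* The summand [4 * A] gives [w.-1 * (4 * A) <= X], hence [A * w + 1 <= X] because [4 * A <= X]. The
   summand [K * A] dominates the constant of the treewidth bound. *)
pose C := 4 * A%:R + K * A%:R + 1.
have KA0 : 0 <= K * A%:R by exact: mulr_ge0.
exists (Num.truncn (C * Y)).+1; first split => //.
  have : (Num.truncn (C * Y))%:R <= C * Y by rewrite truncn_le mulr_ge0 // /C; lra.
  rewrite -natr1 -/Y => h; have e1 : 0 <= (4 * A%:R ^+ 2 + 1) * Y.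
    by rewrite mulr_ge0 // addr_ge0 // mulr_ge0 // sqr_ge0.
  have -> : (4 * A%:R ^+ 2 + 4 * A%:R + K * A%:R + 2) * Y = C * Y + (4 * A%:R ^+ 2 + 1) * Y.
    by rewrite /C; ring.
  by move: h e1; move: (C * Y) ((_ + 1) * Y) => u v; lra.
set L := (Num.truncn (C * Y)).+1 => w; right.
have LC : C * Y < L%:R by exact: truncnS_gt.
have [w0 wk] := wP L isT; rewrite -/w in w0 wk.
have w1X : (w.-1)%:R * (4 * A%:R) <= X.
  have Ypos : 0 < Y by lra.
  rewrite -(ler_pM2r Ypos) XY // -mulrA; apply: le_trans (_ : (w.-1 * L)%:R <= _).
    rewrite natrM; apply: ler_wpM2l => //; apply: le_trans (ltW LC).
    by apply: ler_wpM2r => //; rewrite /C; lra.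
  by rewrite ler_nat.
have wE : w%:R = (w.-1)%:R + 1 :> R by rewrite natr1 prednK.
have w'0 : 0 <= (w.-1)%:R :> R by [].
have AwX : A%:R * w%:R + 1 <= X.
  rewrite wE mulrDr mulr1; move: w1X; have -> : (w.-1)%:R * (4 * A%:R) = 4 * (A%:R * (w.-1)%:R) :> R by ring.
  by move: (A%:R * _) => u; lra.
have wX : w%:R <= X.
  apply: le_trans AwX; have : w%:R <= A%:R * w%:R :> R by rewrite ler_peMl.
  by move: (A%:R * _) => u; lra.
have h1 : (A * w + 1)%:R `^ gamma <= k%:R `^ (mu * gamma).
  rewrite powRrM -/X; apply: le_powR => //; by rewrite natrD natrM.
have h2 : (A * (k * w ^ psi))%:R `^ alpha <= A%:R * k%:R `^ ((1 + mu * (phi + 1)) * alpha).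
  rewrite natrM powRM //; apply: ler_pM; rewrite ?powR_ge0 //.
    by apply: ler1_powR => //; exact: ltW.
  rewrite powRrM; apply: le_powR; [exact: ltW|exact: ler0n|].
  rewrite natrM natrX powRD; last by rewrite pnatr_eq0 -lt0n k0 implybT.
  rewrite powRr1 //; apply: ler_wpM2l => //.
  rewrite powRrM -/X -powR_mulrn //; apply: (le_trans (_ : _ <= X `^ psi%:R)).
    exact: le_powR.
  exact: ler_powR.
apply: le_lt_trans LC; apply: (@le_trans _ _ (K * k%:R `^ (mu * gamma) * (A%:R * k%:R `^ ((1 + mu * (phi + 1)) * alpha)))).
  apply: ler_pM => //; rewrite ?powR_ge0 // ?mulr_ge0 ?powR_ge0 //.
  exact: ler_wpM2l.
have -> : K * k%:R `^ (mu * gamma) * (A%:R * k%:R `^ ((1 + mu * (phi + 1)) * alpha)) =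
    K * A%:R * (k%:R `^ (mu * gamma) * k%:R `^ ((1 + mu * (phi + 1)) * alpha)) by ring.
rewrite -powRD; last by rewrite pnatr_eq0 -lt0n k0 implybT.
rewrite epsilon_split -/Y; apply: ler_wpM2r => //; rewrite /C; lra.
Qed.

End Params.

Section Class.
Variables (r : nat) (phi K0 : R).
Hypotheses (r0 : (0 < r)%N) (phi0 : 0 <= phi).
Let K := `|K0|.
Let Kge0 : 0 <= K. Proof. exact: normr_ge0. Qed.

(** Each of the [m] factors of the falling factorial is at least [q / 2]. *)
Lemma binomial_power q m : (2 * m <= q)%N -> (q ^ m <= 2 ^ m * m`! * 'C(q, m))%N.
Proof.
move=> mq; rewrite -mulnA [(m`! * _)%N]mulnC bin_ffact ffact_prod.
have -> : (2 ^ m * \prod_(i < m) (q - i) = \prod_(i < m) (2 * (q - i)))%N.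
  by rewrite big_split /= prod_nat_const card_ord.
rewrite -{1}(card_ord m) -prod_nat_const; apply: leq_prod => i _.
by have := ltn_ord i; lia.
Qed.

(* The cliques with [r - 1] vertices of a clique on [q] vertices are too many for large [q]. *)
Lemma clique_bound_ex : phi + 2 < r%:R -> exists Q : nat, forall q : nat,
  ('C(q, r.-1))%:R <= K * q.+1%:R `^ phi * q%:R -> (q <= Q)%N.
Proof.
move=> rphi; set m := r.-1; pose d := m%:R - phi - 1.
have d0 : 0 < d by rewrite /d; have : r%:R = m%:R + 1 :> R; [rewrite natr1 prednK|lra].
pose Z := (2 ^ m * m`!)%:R * K * 2 `^ phi.
have Z0 : 0 <= Z by rewrite !mulr_ge0 ?powR_ge0.
exists (2 * m + Num.bound (Z `^ d^-1))%N => q H; rewrite leqNgt; apply/negP => lt.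
have mq : (2 * m <= q)%N by apply: ltnW; apply: leq_ltn_trans lt; exact: leq_addr.
have q0 : (0 < q)%N by apply: leq_ltn_trans lt.
have q1 : 1 <= q%:R :> R by rewrite ler1n.
have qpos : 0 < q%:R :> R by rewrite ltr0n.
have h1 : q%:R `^ m%:R <= Z * q%:R `^ (phi + 1).
  rewrite powR_mulrn // -natrX; apply: (@le_trans _ _ ((2 ^ m * m`! * 'C(q, m))%:R)).
    by rewrite ler_nat binomial_power.
  rewrite natrM /Z -!mulrA; apply: ler_wpM2l => //; apply: (le_trans H); rewrite -mulrA; apply: ler_wpM2l => //.
  rewrite powRD ?(gt_eqF qpos) ?implybT // powRr1 // mulrA; apply: ler_wpM2r => //.
  rewrite -powRM //; apply: le_powR => //; rewrite -natr1; lra.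
have h2 : q%:R `^ d <= Z.
  rewrite -(ler_pM2r (powR_gt0 (phi + 1) qpos)) -powRD ?(gt_eqF qpos) ?implybT //.
  by apply: le_trans h1; rewrite (_ : d + (phi + 1) = m%:R) // /d; ring.
have h3 : q%:R <= Z `^ d^-1.
  have -> : q%:R = (q%:R `^ d) `^ d^-1 by rewrite -powRrM mulfV ?gt_eqF // powRr1.
  by apply: le_powR => //; rewrite ?powR_ge0 // invr_ge0 ltW.
have h4 : Z `^ d^-1 < (Num.bound (Z `^ d^-1))%:R by apply: archi_boundP; exact: powR_ge0.
have := le_lt_trans h3 h4; rewrite ltr_nat => /ltnW h5.
by have := leq_ltn_trans (leq_trans h5 (leq_addl (2 * m) _)) lt; rewrite ltnn.
Qed.

Section Property.
Variables (gamma alpha : R) (GG : graph_class).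
Hypotheses (gamma0 : 0 <= gamma) (alpha01 : 0 < alpha < 1) (her : hereditary GG)
  (PP : property_P_with K0 r phi gamma alpha GG).

Lemma property_isub (G : sgraph) V w : GG G -> uniq V -> all (fun x => (x < order G)%N) V ->
  (forall X, sorted ltn X -> sub X V -> clq (radj (adjacency_rows G)) X -> (size X < w)%N) ->
  (num_cliques_lt (isub G V) r)%:R <= K * w%:R `^ phi * (size V)%:R /\
  (treewidth (isub G V))%:R <= K * w%:R `^ gamma * (size V)%:R `^ alpha.
Proof.
move=> GGG uV Vn H; have GH : GG (isub G V) := her GGG (isub_induced uV Vn).
have w0 : (0 < w)%N.
  by have := H [::] isT (isT : sub [::] V) isT.
have cn : (clique_number (isub G V) < w)%N.
  rewrite -(prednK w0) ltnS; apply: clique_number_isub => // X sX XV cX.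
  by rewrite -ltnS prednK //; exact: H.
have [h1 h2] := PP GH cn; split; [apply: (le_trans h1)|apply: (le_trans h2)].
  by rewrite /=; do ?[apply: ler_wpM2r]; rewrite ?powR_ge0 ?ler_norm.
by do ?[apply: ler_wpM2r]; rewrite ?powR_ge0 ?ler_norm.
Qed.

(** (P1) is applied to the clique itself, an induced subgraph in the class, where every subset with
    [r - 1] elements is counted. *)
Lemma clique_count (G : sgraph) X : GG G -> (1 < r)%N -> sorted ltn X ->
  all (fun x => (x < order G)%N) X -> clq (radj (adjacency_rows G)) X ->
  ('C(size X, r.-1))%:R <= K * (size X).+1%:R `^ phi * (size X)%:R.
Proof.
move=> GGG r1 sX Xn cX; have uX := sorted_ltn_uniq sX.
have [|h _] := @property_isub G X (size X).+1 GGG uX Xn.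
  by move=> Y sY YX _; rewrite ltnS; exact: sub_size.
apply: le_trans h; rewrite ler_nat -{1}(card_ord (size X)) -card_draws /num_cliques_lt.
apply: subset_leq_card; apply/fintype.subsetP => A; rewrite !inE => /eqP zA.
have A0 : A != finset.set0 by rewrite -card_gt0 zA -ltnS prednK // ltnW.
rewrite A0 zA prednK ?(ltnW r1) // leqnn !andbT.
apply/forall_inP => i iA; apply/forall_inP => j jA; apply/implyP => ij.
by move/clqP: cX; apply; rewrite ?mem_nth // nth_uniq.
Qed.

End Property.

(** In both cases the vertex sets have [O(k * w ^ psi)] elements with [psi <= phi + 1]: here [psi]
    is [r - 1] if [r <= phi + 2], and 1 otherwise. The constants are chosen before [gamma], [alpha]
    and the class. *)
Lemma class_hopeful : exists (c : nat) (C1 : R), 0 <= C1 /\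
  forall (gamma alpha : R) (GG : graph_class), 0 <= gamma -> 0 < alpha < 1 -> hereditary GG ->
  property_P_with K0 r phi gamma alpha GG -> forall k, exists2 L : nat,
    L%:R <= C1 * k%:R `^ epsilon gamma alpha phi + C1 &
    forall G, GG G -> hopeful (r%:R <= phi + 2) r c G k L.
Proof.
have [dense|sparse] := boolP (r%:R <= phi + 2).
  (* The square is for the number of vertices, [k * (r * w ^ r.-1) * r], and the rest for the clique
     bound [r + 2 ^ r * w]. *)
  pose A := (r * r + r + 2 ^ r)%N; exists 0%N.
  exists (4 * A%:R ^+ 2 + 4 * A%:R + K * A%:R + 2 + (A%:R + 1)); split.
    by rewrite !addr_ge0 ?mulr_ge0 ?exprn_ge0.
  move=> gamma alpha GG g0 a01 her PP k.
  have A0 : (0 < A)%N by rewrite /A addn_gt0 expn_gt0 orbT.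
  have psi : (r.-1)%:R <= phi + 1 by have : r%:R = (r.-1)%:R + 1 :> R; [rewrite natr1 prednK|lra].
  have [L [L0 leL] HL] := choose_size g0 a01 phi0 k A0 psi Kge0.
  exists L.
    apply: (le_trans leL); apply: affine_le; rewrite ?powR_ge0 // !addr_ge0 ?mulr_ge0 ?exprn_ge0 //.
  move=> G GGG; split=> // V uV Vn zV /(_ isT) HX.
  set w := beta 1 k.+1 L in HL HX zV *.
  have zA : (size V <= A * (k * w ^ r.-1))%N.
    apply: (leq_trans zV); rewrite /size_bound -/w /A.
    have -> : (k * (r * w ^ r.-1) * r = r * r * (k * w ^ r.-1))%N.
      by move: (w ^ _)%N => u; ring.
    by rewrite leq_mul2r; apply/orP; right; rewrite -addnA leq_addr.
  case: HL => [le|lt]; first by left; exact: leq_trans zA le.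
  right; have [|_ h] := property_isub her PP (w := (A * w + 1)%N) GGG uV Vn.
    move=> X sX XV cX; rewrite addn1 ltnS; apply: leq_trans (HX X sX XV cX) _.
    have w0 : (0 < w)%N by []; rewrite /A !mulnDl leq_add2r.
    by apply: leq_trans (leq_addl _ _); rewrite leq_pmulr.
  rewrite -(ltr_nat R); apply: (le_lt_trans h); apply: le_lt_trans lt.
  apply: ler_wpM2l; first by rewrite mulr_ge0 ?powR_ge0.
  by apply: le_powR; rewrite ?ler_nat //; case/andP: a01 => /ltW.
rewrite -ltNge in sparse; have [Q HQ] := clique_bound_ex sparse.
have r3 : (2 < r)%N by rewrite -(ltr_nat R); apply: le_lt_trans sparse; rewrite lerDr.
(* All cliques have at most [Q] vertices, so (P1) with [omega = Q + 1] bounds the number of small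
   cliques by this constant times the number of vertices. *)
pose c := (Num.bound (K * Q.+1%:R `^ phi)).+1.
pose A := (sparse_factor r c + Q + 1)%N; exists c.
exists (4 * A%:R ^+ 2 + 4 * A%:R + K * A%:R + 2 + (A%:R + 1)); split.
  by rewrite !addr_ge0 ?mulr_ge0 ?exprn_ge0.
move=> gamma alpha GG g0 a01 her PP k.
have A0 : (0 < A)%N by rewrite /A addn1.
have psi : 1%:R <= phi + 1 by rewrite lerDr.
have [L [L0 leL] HL] := choose_size g0 a01 phi0 k A0 psi Kge0.
exists L.
  apply: (le_trans leL); apply: affine_le; rewrite ?powR_ge0 // !addr_ge0 ?mulr_ge0 ?exprn_ge0 //.
move=> G GGG.
have cl X : sorted ltn X -> all (fun x => (x < order G)%N) X -> clq (radj (adjacency_rows G)) X -> (size X <= Q)%N.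
  by move=> sX Xn cX; apply: HQ; exact: (clique_count her PP GGG (ltnW r3) sX Xn cX).
have clV V X : all (fun x => (x < order G)%N) V -> sorted ltn X -> sub X V ->
    clq (radj (adjacency_rows G)) X -> (size X <= Q)%N.
  by move=> Vn sX /subP XV; apply: cl => //; apply/allP => x /XV/(allP Vn).
split=> // [_|V uV Vn zV _].
  split=> //; split=> // U M uU Un uM HM.
  have [|h _] := property_isub her PP (w := Q.+1) GGG uU Un.
    by move=> X sX XU cX; rewrite ltnS; exact: clV Un sX XU cX.
  rewrite -(ler_nat R); apply: (@le_trans _ _ (num_cliques_lt (isub G U) r)%:R).
    by rewrite ler_nat; exact: num_cliques_isub.
  apply: (le_trans h); rewrite natrM; apply: ler_wpM2r => //; apply: ltW.
  apply: (@lt_trans _ _ (Num.bound (K * Q.+1%:R `^ phi))%:R); last by rewrite ltr_nat.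
  by apply: archi_boundP; rewrite mulr_ge0 ?powR_ge0.
set w := beta 1 k.+1 L in HL zV *.
have w0 : (0 < w)%N by [].
have zA : (size V <= A * (k * w ^ 1))%N.
  apply: (leq_trans zV); rewrite /size_bound /sparse_bound -/w expn1 mulnCA /A.
  by rewrite leq_mul2r -addnA leq_addr orbT.
case: HL => [le|lt]; first by left; exact: leq_trans zA le.
right; have [|_ h] := property_isub her PP (w := (A * w + 1)%N) GGG uV Vn.
  move=> X sX XV cX; rewrite addn1 ltnS; apply: leq_trans (clV V X Vn sX XV cX) _.
  by apply: leq_trans (leq_pmulr _ w0); rewrite /A addnAC leq_addl.
rewrite -(ltr_nat R); apply: (le_lt_trans h); apply: le_lt_trans lt.
apply: ler_wpM2l; first by rewrite mulr_ge0 ?powR_ge0.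
by apply: le_powR; rewrite ?ler_nat //; case/andP: a01 => /ltW.
Qed.

End Class.
End Numeric.

(** The empty clique has 0 vertices and is disjoint from every set of deleted vertices. *)
Lemma uncoverable0 G k : Kr_coverable 0 G k = false.
Proof.
apply/negbTE/negP => /coverableP[S _ /allP/(_ [::])]; rewrite /kcl inE eqxx => /(_ isT).
by [].
Qed.

(** For [k <= 1] the logarithm is 0, by convention also at 0, so the power of [k + 2] has to go into
    the leading constant [c1]. For [k >= 2] one has [k + 2 <= k ^ 2], and [c2] contains the change
    of base from e to 2. *)
Lemma exponential_time (R : realType) (b E A : nat) (C1 : R) : 0 <= C1 ->
  exists2 c0 : R, 0 <= c0 & forall (c eps : R) (n k L t : nat), c0 <= c -> 0 < eps ->
  L%:R <= C1 * k%:R `^ eps + C1 ->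
  (t <= A * n.+1 ^ b * (k + 2) ^ (E * L))%N ->
  t%:R <= c * 2 `^ (c * (k%:R `^ eps * ln k%:R)) * n.+1%:R ^+ b :> R.
Proof.
move=> C10; pose D : R := 2 * C1 * E%:R.
have D0 : 0 <= D by rewrite !mulr_ge0.
have ln2 : 0 < ln 2 :> R by rewrite ln_gt0 // ltr1n.
pose c1 : R := A%:R * 3 `^ D; pose c2 : R := 2 * D / ln 2.
have c10 : 0 <= c1 by rewrite mulr_ge0 ?powR_ge0.
have c20 : 0 <= c2 by rewrite !mulr_ge0 // invr_ge0 ltW.
have p3 : 1 <= 3 `^ D :> R by rewrite -[leLHS](powRr0 3) ler_powR // ler1n.
exists (c1 + c2); first exact: addr_ge0.
move=> c eps n k L t lec eps0 LE tle.
have c1c : c1 <= c by apply: le_trans lec; rewrite lerDl.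
have c2c : c2 <= c by apply: le_trans lec; rewrite lerDr.
have c0 : 0 <= c by apply: le_trans c1c.
apply: (@le_trans _ _ (A%:R * (k + 2)%:R ^+ (E * L) * n.+1%:R ^+ b)).
  by rewrite -!natrX -!natrM ler_nat mulnAC.
apply: ler_wpM2r; first exact: exprn_ge0.
have [k1|k2] := leqP k 1.
  have -> : ln k%:R = 0 :> R.
    by case: k k1 {LE tle} => [|[|//]] _; [rewrite ln0|rewrite ln1].
  rewrite !mulr0 powRr0 mulr1; apply: le_trans c1c; rewrite /c1; apply: ler_wpM2l => //.
  apply: (@le_trans _ _ (3 ^+ (E * L))).
    by apply: lerXn2r; rewrite ?nnegrE // ler_nat; case: k k1 {LE tle} => [|[|]].
  rewrite -powR_mulrn //; apply: ler_powR; first by rewrite ler1n.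
  have y1 : k%:R `^ eps <= 1 :> R.
    by case: k k1 {LE tle} => [|[|//]] _; [rewrite powR0 ?gt_eqF|rewrite powR1].
  rewrite natrM mulrC /D; apply: ler_wpM2r => //; apply: (le_trans LE).
  have : C1 * k%:R `^ eps <= C1 by rewrite ler_piMr.
  by move: (C1 * _) => u; lra.
have k0 : 0 < k%:R :> R by rewrite ltr0n ltnW.
have k1 : 1 <= k%:R :> R by rewrite ler1n ltnW.
set y := k%:R `^ eps in LE *.
have y1 : 1 <= y by rewrite -(powRr0 k%:R) ler_powR // ltW.
have lnk : 0 <= ln k%:R :> R by exact: ln_ge0.
have Ly : L%:R <= 2 * C1 * y.
  apply: (le_trans LE); have : C1 <= C1 * y by rewrite ler_peMr.
  by rewrite -mulrA; move: (C1 * y) => u; lra.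
apply: ler_pM; rewrite ?exprn_ge0 //.
  apply: le_trans c1c; rewrite /c1; by rewrite ler_peMr.
apply: (@le_trans _ _ ((k%:R * k%:R) ^+ (E * L))).
  apply: lerXn2r; rewrite ?nnegrE // ?mulr_ge0 //.
  by rewrite -natrM ler_nat; move: k2; clear; case: k => [|[|[|k]]] //; lia.
rewrite -expr2 -exprM -powR_mulrn // /powR !gt_eqF //= ler_expR.
have h1 : (2 * (E * L))%:R * ln k%:R <= 2 * D * y * ln k%:R :> R.
  apply: ler_wpM2r => //; rewrite !natrM /D.
  have -> : 2 * (2 * C1 * E%:R) * y = 2 * (E%:R * (2 * C1 * y)) by ring.
  by apply: ler_wpM2l => //; apply: ler_wpM2l.
apply: (le_trans h1).
have -> : 2 * D * y * ln k%:R = c2 * (y * ln k%:R) * ln 2.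
  by rewrite /c2; field; rewrite gt_eqF.
apply: ler_wpM2r; first exact: ltW.
by apply: ler_wpM2r => //; rewrite mulr_ge0 // (le_trans _ y1).
Qed.

Theorem theorem5p1 (R : realType) (r : nat) :
  exists b : nat, forall phi K : R, 0 <= phi ->
  exists c : R, forall (gamma alpha : R) (GG : graph_class),
    0 <= gamma -> 0 < alpha < 1 ->
    hereditary GG -> property_P_with K r phi gamma alpha GG ->
    let eps := (gamma + alpha * (phi + 2)) / (gamma + alpha * (phi + 1) + 1) in
    eps < 1 /\
    exists P : program,
      solves_Kr_cover P r GG
        (fun n k => c * 2 `^ (c * (k%:R `^ eps * ln k%:R)) * n.+1%:R ^+ b).
Proof.
have [->|r0] := posnP r.
  exists 0%N => phi K phi0; exists 1 => gamma alpha GG g0 a01 _ _ eps.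
  split; first exact: (epsilon_lt1 g0 a01 phi0).
  exists [:: Nil] => G k _; rewrite uncoverable0; exists 1%N; first exact: EvalNil.
  rewrite expr0 mulr1 !mul1r -[leLHS](powRr0 2); apply: ler_powR; first by rewrite ler1n.
  rewrite mulr_ge0 ?powR_ge0 //; case: k => [|k]; first by rewrite ln0.
  by rewrite ln_ge0 // ler1n.
have [bt [Et Ht]] := solver true r0; have [bf [Ef Hf]] := solver false r0.
(* The exponent has to be fixed before [phi], which decides between the two cases; the sum dominates
   the exponents of both. *)
exists (bt + bf)%N => phi K phi0.
have [x [C1 [C10 HC]]] := class_hopeful K r0 phi0.
have [b [E [le H]]] : exists b E, (b <= bt + bf)%N /\ exists A (P : program), forall (G : sgraph) k L,
    hopeful (r%:R <= phi + 2) r x G k L ->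
    exists2 t, run P (enc_instance G k) (enc_bool (Kr_coverable r G k)) t &
    (t <= A * (order G).+1 ^ b * (k + 2) ^ (E * L))%N.
  case: (r%:R <= phi + 2); [exists bt, Et|exists bf, Ef].
    by split; [exact: leq_addr|exact: Ht].
  by split; [exact: leq_addl|exact: Hf].
have [A [P HP]] := H.
have [c c0 Hc] := exponential_time (bt + bf) E A C10.
exists c => gamma alpha GG g0 a01 her PP eps.
split; first exact: (epsilon_lt1 g0 a01 phi0).
exists P => G k GGG; have [L leL HL] := HC gamma alpha GG g0 a01 her PP k.
have [t ev le_t] := HP G k L (HL G GGG); exists t => //.
apply: (Hc c eps (order G) k L t) => //; first exact: (epsilon_gt0 g0 a01 phi0).
apply: (leq_trans le_t); rewrite leq_mul2r leq_mul2l; apply/orP; right; apply/orP; right.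
exact: leq_pexp2l.
Qed.
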